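(* Let $d\in(0,1/2)$, $\alpha>0$, $h\in(0,1/2-d)$, and $$Z^d(t)=\int_{-\infty}^t\left(\frac{\alpha}{\alpha+t-u}\right)^{1-h}dL^d(u),\qquad t\in\mathbb{R}.$$ Then $Z^d$ is a stationary process with long memory.
   Context: Fractional Lévy process: $L=\{L(t),t\in\mathbb{R}\}$ is a (not identically zero) two-sided Lévy process on a complete probability space $(\Omega_L,\mathcal{F}_L,P_L)$, i.e. $L(t)=L^{(1)}(t)1_{\{t\ge0\}}-L^{(2)}(-t)1_{\{t\le 0\}}$ with $L^{(1)},L^{(2)}$ independent copies of a one-sided Lévy process, with $E[L(1)]=0$, $E[L(1)^2]<\infty$ and no Brownian component. For $d\in(0,1/2)$, $$L^d_t=\frac1{\Gamma(d+1)}\int_{\mathbb{R}}[(t-s)_+^d-(-s)_+^d]\,dL(s),\quad t\in\mathbb{R},$$ the integral being in the $L^2(\Omega_L)$ sense. Integration with respect to $L^d$: $(I^d_-g)(x)=\frac1{\Gamma(d)}\int_x^\infty g(t)(t-x)^{d-1}dt$, and $H$ is the completion of $L^1(\mathbb{R})\cap L^2(\mathbb{R})$ for the norm $\|g\|_H^2=E[L(1)^2]\int_{\mathbb{R}}(I^d_-g)^2(u)\,du$. For $g\in H$, $\int_{\mathbb{R}} g\,dL^d=\int_{\mathbb{R}}(I^d_-g)(s)\,dL(s)$ in $L^2(\Omega_L)$, and $\int_{-\infty}^t g\,dL^d=\int_{\mathbb{R}} g\,1_{(-\infty,t)}\,dL^d$. Stationary means that all finite-dimensional distributions are invariant under time shifts.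 Long memory means non-summability of the covariance: $\sum_{n=1}^\infty E_L[Z^d(0)Z^d(n)]=\infty$, where $E_L$ is expectation under $P_L$. *)

(* Defs.v *)
From mathcomp Require Import all_boot all_order all_algebra.
From mathcomp Require Import all_classical all_reals all_analysis.
Set Implicit Arguments.
Unset Strict Implicit.
Unset Printing Implicit Defensive.
Import Order.TTheory GRing.Theory Num.Theory.
Import numFieldNormedType.Exports.
Local Open Scope classical_set_scope.
Local Open Scope ring_scope.

Section Processes.
Context {disp : measure_display} {T : measurableType disp} {R : realType}.
Variable P : probability T R.
Implicit Types X Y : R -> T -> R.

Definition fdd X n (t : n.-tuple R) : set (n.-tuple R) -> \bar R :=
  pushforward P (fun w => [tuple X (tnth t i) w | i < n]).

Definition same_law (D : set R) X Y : Prop :=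
  forall n (t : n.-tuple R), (forall i, D (tnth t i)) ->
  forall A : set (n.-tuple R), measurable A -> fdd X t A = fdd Y t A.

Definition stationary X : Prop :=
  forall n (t : n.-tuple R) (s : R) (A : set (n.-tuple R)), measurable A ->
  fdd X [tuple tnth t i + s | i < n] A = fdd X t A.

Definition long_memory X : Prop :=
  (fun N => \sum_(1 <= n < N.+1) 'E_P[fun w => (X 0 w * X n%:R w)%R])%E @ \oo
    --> +oo%E.

Definition sigma_of (D : set R) X : set (set T) :=
  <<s [set A | exists t B, [/\ D t, measurable B & A = X t @^-1` B]] >>.

Definition independent_processes (D : set R) X Y : Prop :=
  forall A B, sigma_of D X A -> sigma_of D Y B -> P (A `&` B) = (P A * P B)%E.

(* It suffices to consider infinite nondecreasing sequences of times: a finite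
   one can be extended by repeating its last term. *)
Definition independent_increments X : Prop :=
  forall (t : nat -> R), 0 <= t 0%N -> (forall i, t i <= t i.+1) ->
  forall n (B : 'I_n -> set R), (forall i, measurable (B i)) ->
  P [set w | forall i : 'I_n, B i (X (t i.+1) w - X (t i) w)] =
  (\prod_(i < n) P [set w | B i (X (t i.+1) w - X (t i) w)%R])%E.

Definition stationary_increments X : Prop :=
  forall s t : R, 0 <= s -> s <= t -> forall B : set R, measurable B ->
  P [set w | B (X t w - X s w)] = P [set w | B (X (t - s) w)].

Definition stochastically_continuous X : Prop :=
  forall t e : R, 0 <= t -> 0 < e ->
  P [set w | e < `|X s w - X t w|] @[s --> within [set s | 0 <= s] (nbhs t)]
    --> 0%E.

Definition cadlag (x : R -> R) : Prop :=
  (forall t, 0 <= t -> x s @[s --> t^'+] --> x t) /\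
  (forall t, 0 < t -> cvg (x s @[s --> t^'-])).

Definition levy_process X : Prop :=
  [/\ forall t, 0 <= t -> measurable_fun setT (X t),
      {ae P, forall w, X 0 w = 0},
      independent_increments X,
      stationary_increments X &
      stochastically_continuous X] /\
  {ae P, forall w, cadlag (X ^~ w)}.

Definition two_sided_levy_process X : Prop :=
  exists X1 X2,
  [/\ levy_process X1 /\ levy_process X2,
      independent_processes [set t | 0 <= t] X1 X2,
      same_law [set t | 0 <= t] X1 X2 &
      forall t w, X t w = (if 0 <= t then X1 t w else 0) -
                          (if t <= 0 then X2 (- t) w else 0)].

Definition not_identically_zero X : Prop :=
  ~ (forall t, {ae P, forall w, X t w = 0}).

(* Levy-Khintchine representation E[e^(iuY)] = e^(psi u), with
     psi u = i gamma u - sigma2 u^2 / 2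
             + \int (e^(iux) - 1 - iux 1_(|x| <= 1)) nu(dx),
   separated into real and imaginary parts. *)
Definition levy_triplet (Y : T -> R) (gamma sigma2 : R)
    (nu : {measure set R -> \bar R}) : Prop :=
  let re_psi u := - (sigma2 * u ^+ 2 / 2) +
    \int[nu]_x (cos (u * x) - 1) in
  let im_psi u := gamma * u +
    \int[nu]_x (sin (u * x) - u * x * \1_(`[-1, 1]) x) in
  [/\ 0 <= sigma2, nu [set 0] = 0%E,
      (\int[nu]_x (Num.min 1 (x ^+ 2))%:E < +oo)%E,
      forall u, \int[P]_w cos (u * Y w) = expR (re_psi u) * cos (im_psi u) &
      forall u, \int[P]_w sin (u * Y w) = expR (re_psi u) * sin (im_psi u)].

Definition no_brownian_component X : Prop :=
  exists gamma nu, levy_triplet (X 1) gamma 0 nu.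

End Processes.

Section Integrals.
Context {disp : measure_display} {T : measurableType disp} {R : realType}.
Variables (P : probability T R) (L : R -> T -> R).
Local Notation leb := (@lebesgue_measure R).

(* A triple (a, s, t) stands for the step a 1_(s, t]. *)
Definition step_fun (q : seq (R * R * R)) (x : R) : R :=
  \sum_(p <- q) (let: (a, s, t) := p in a * \1_(`]s, t]) x).

Definition step_int (q : seq (R * R * R)) (w : T) : R :=
  \sum_(p <- q) (let: (a, s, t) := p in a * (L t w - L s w)).

Definition step_wf (q : seq (R * R * R)) : bool :=
  all (fun p => let: (_, s, t) := p in s <= t) q.

(* Y is a version of \int f dL: an L^2(P)-limit of integrals of step functions
   that converge to f in L^2(R). *)
Definition is_levy_int (f : R -> R) (Y : T -> R) : Prop :=
  measurable_fun setT Y /\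
  exists q : nat -> seq (R * R * R),
  [/\ forall n, step_wf (q n),
      'N[leb]_2%:E[EFin \o (step_fun (q n) \- f)%R]%E @[n --> \oo] --> 0%E &
      'N[P]_2%:E[EFin \o (step_int (q n) \- Y)%R]%E @[n --> \oo] --> 0%E].

(* The integral is an almost sure class; levy_int picks one version, and is the
   zero variable when the integral does not exist. *)
Definition levy_int (f : R -> R) : T -> R :=
  xget (cst 0) [set Y | measurable_fun setT f /\ is_levy_int f Y].

Definition Gamma (a : R) : R :=
  \int[leb]_(x in `]0, +oo[) (x `^ (a - 1) * expR (- x)).

(* powR at 0 is 0 for a nonzero exponent, so this is x_+^d for d != 0. *)
Definition pos_pow (x d : R) : R := (Num.max x 0) `^ d.

Definition frac_levy (d t : R) : T -> R :=
  levy_int (fun s => (Gamma (d + 1))^-1 *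
                     (pos_pow (t - s) d - pos_pow (- s) d)).

Definition frac_int (d : R) (g : R -> R) (x : R) : R :=
  (Gamma d)^-1 * \int[leb]_(t in `]x, +oo[) (g t * (t - x) `^ (d - 1)).

Definition H_normsq (d : R) (g : R -> R) : \bar R :=
  ('E_P[fun w => (L 1 w ^+ 2)%R] * \int[leb]_u ((frac_int d g u) ^+ 2)%:E)%E.

(* The functions that represent an element of the completion H: those whose
   fractional integral converges absolutely almost everywhere and which are
   limits for the H-norm of elements of L^1 and L^2. *)
Definition in_H (d : R) (g : R -> R) : Prop :=
  [/\ measurable_fun setT g,
      {ae leb, forall x, leb.-integrable `]x, +oo[
         (fun t => (g t * (t - x) `^ (d - 1))%:E)} &
      exists2 gs : nat -> R -> R,
        forall n, gs n \in Lfun leb 1%E /\ gs n \in Lfun leb 2%:E &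
        H_normsq d (gs n \- g) @[n --> \oo] --> 0%E].

(* The integral of g with respect to frac_levy d, by definition an integral
   with respect to L; it is the zero variable when g is not in H. *)
Definition frac_levy_int (d : R) (g : R -> R) : T -> R :=
  if `[< in_H d g >] then levy_int (frac_int d g) else cst 0.

Definition frac_levy_int_upto (d t : R) (g : R -> R) : T -> R :=
  frac_levy_int d (fun u => g u * \1_(`]-oo, t[) u).

End Integrals.

(* Main.v *)
Require Import Defs.
From HB Require Import structures.
From mathcomp Require Import all_boot all_order all_algebra.
From mathcomp Require Import all_classical all_reals all_analysis.
From mathcomp Require Import measurable_realfun ring lra.
Set Implicit Arguments.
Unset Strict Implicit.
Unset Printing Implicit Defensive.
Import Order.TTheory GRing.Theory Num.Theory.
Import numFieldNormedType.Exports.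
Local Open Scope classical_set_scope.
Local Open Scope ring_scope.

(** Write $w(v) = (\alpha/(\alpha+v))^{1-h} 1_{v > 0}$, so that the integrand of
    $Z^d(t)$ is $w(t - u)$. Fractional integration commutes with reflected
    translations: $I^d_-(w(t - \cdot))(x) = F(t - x)$ with
    $F(y) = \Gamma(d)^{-1} \int_0^\infty w(y - s) s^{d-1} ds$. Therefore
    $Z^d(t) = \int F(t - x) dL(x)$ is a moving average driven by $L$
    ([moving_average_levy_int]). The kernel $F$ is continuous, nonnegative,
    vanishes on the left of 0 and is $O(y^{d+h-1})$ at infinity
    ([ma_kernel_envelope]); it is square integrable because $d + h < 1/2$.

    The integral with respect to $L$ is an isometry up to the factor
    $E[L(1)^2]$ ([levy_int_isometry]), by polarization of
    $E[(L(t) - L(s))^2] = |t - s| E[L(1)^2]$ ([two_sided_increment_sqint]). To get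
    this identity from the moments of $L(1)$ alone, one first shows that the other
    times have second moments ([levy_L2]): a sum of two independent variables is
    square integrable only if both are. The mean and the variance are then additive
    functions of time, and locally bounded, hence linear ([levy_moments]).

    Stationarity. The increments of $L$ over the cells of a regular grid are
    independent and identically distributed, so the law of a window of increments
    depends only on its size ([window_law]). To compare $Z^d(t)$ with $Z^d(t + s)$,
    take grids whose mesh divides $s$: the step approximations of $F(t - \cdot)$ and
    $F(t + s - \cdot)$ are then the same up to a translation of the window, so
    their integrals have the same finite-dimensional laws
    ([moving_average_shift]), and this passes to limits in mean square
    ([limit_law_le]).

    Long memory. By the polarized isometry,
    $E[Z^d(0) Z^d(n)] = E[L(1)^2] \int F(-x) F(n - x) dx$. As $F \ge 0$ and $F(y)$ is
    at least a multiple of $1/(\alpha + y)$ for $y \ge 1$ ([ma_kernel_lower]), the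
    interval $[-2, -1]$ alone contributes a multiple of $1/n$
    ([moving_average_covariance_ge]), and the harmonic series diverges. The factor
    $E[L(1)^2]$ is positive because $L$ is not identically zero
    ([two_sided_variance_gt0]). *)

(** * Square integrals *)

(** A sequence of extended reals that tends to 0 is eventually finite, so only
    real bounds need to be tested. *)
Lemma ge0_cvge0P {R : realType} (u : nat -> \bar R) : (forall n, 0 <= u n)%E ->
  (u n @[n --> \oo] --> 0)%E <->
  (forall e, 0 < e -> \forall n \near \oo, (u n < e%:E)%E).
Proof.
move=> u0; rewrite fine_cvgP; split=> [[fu cu] e e0|H].
  move/cvgrPdist_lt : cu => /(_ e e0); apply: filterS2 fu => n fun_ /=.
  by rewrite sub0r normrN ger0_norm ?fine_ge0// -lte_fin fineK.
split.
  have := H 1 ltr01; apply: filterS => n un1.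
  by rewrite ge0_fin_numE// (lt_trans un1)// ltry.
apply/cvgrPdist_lt => e e0; apply: filterS (H e e0) => n un /=.
rewrite sub0r normrN ger0_norm ?fine_ge0// -lte_fin fineK//.
by rewrite ge0_fin_numE// (lt_trans un)// ltry.
Qed.

Section SquareIntegral.
Context {disp : measure_display} {T : measurableType disp} {R : realType}.
Variable mu : {measure set T -> \bar R}.
Implicit Types f g : T -> R.

(** The square of the $L^2$ norm. Without the root it is a nonnegative integral,
    to which monotone limits and the parallelogram identities apply directly. *)
Definition sqint f : \bar R := (\int[mu]_x (f x ^+ 2)%:E)%E.

Lemma sqint_ge0 f : (0 <= sqint f)%E.
Proof. by apply: integral_ge0 => x _; rewrite lee_fin sqr_ge0. Qed.

Lemma sqint0 : sqint (cst 0) = 0%E.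
Proof. by rewrite /sqint; under eq_integral do rewrite expr0n; rewrite integral0. Qed.

Lemma sqint_subrr f : sqint (f \- f) = 0%E.
Proof. by rewrite -sqint0; congr sqint; apply/funext => x /=; rewrite subrr. Qed.

Lemma measurable_sq f : measurable_fun setT f ->
  measurable_fun setT (fun x => (f x ^+ 2)%:E).
Proof. by move=> mf; apply/measurable_EFinP; exact: measurable_funX. Qed.

Lemma Lnorm2_sqint f : ('N[mu]_2%:E[EFin \o f] = sqint f `^ 2^-1)%E.
Proof.
rewrite unlock; congr poweR; apply: eq_integral => x _ /=.
by rewrite powR_mulrn ?normr_ge0// real_normK ?num_real.
Qed.

Lemma Lnorm2_cvg0 (F : nat -> T -> R) :
  ('N[mu]_2%:E[EFin \o F n] @[n --> \oo] --> 0)%E <->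
  (sqint (F n) @[n --> \oo] --> 0)%E.
Proof.
rewrite !ge0_cvge0P.
- split=> H e e0.
  + have := H (Num.sqrt e); rewrite sqrtr_gt0 => /(_ e0); apply: filterS => n.
    rewrite Lnorm2_sqint poweR12_sqrt ?sqint_ge0//.
    by case: (sqint (F n)) (sqint_ge0 (F n)) => //= r; rewrite !lee_fin !lte_fin => r0; rewrite ltr_sqrt.
  + have := H (e ^+ 2); rewrite exprn_gt0// => /(_ isT); apply: filterS => n.
    rewrite Lnorm2_sqint poweR12_sqrt ?sqint_ge0//.
    case: (sqint (F n)) (sqint_ge0 (F n)) => //= r; rewrite !lee_fin !lte_fin => r0 re.
    by rewrite -(ger0_norm (ltW e0)) -sqrtr_sqr ltr_sqrt// exprn_gt0.
- by move=> n; exact: Lnorm_ge0.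
- by move=> n; exact: sqint_ge0.
Qed.

Lemma sqintZ c f : measurable_fun setT f ->
  (sqint (fun x => c * f x)%R = (c ^+ 2)%:E * sqint f)%E.
Proof.
move=> mf; rewrite /sqint -ge0_integralZl_EFin ?sqr_ge0//.
- by apply: eq_integral => x _; rewrite -EFinM exprMn.
- by move=> x _; rewrite lee_fin sqr_ge0.
- exact: measurable_sq.
Qed.

Lemma sqint_le f g : measurable_fun setT f -> measurable_fun setT g ->
  (forall x, `|f x| <= `|g x|) -> (sqint f <= sqint g)%E.
Proof.
move=> mf mg fg; apply: ge0_le_integral => //.
- by move=> x _; rewrite lee_fin sqr_ge0.
- exact: measurable_sq.
- exact: measurable_sq.
- by move=> x _; rewrite lee_fin -[leLHS]real_normK ?num_real// -[leRHS]real_normK ?num_real// ler_sqr ?nnegrE.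
Qed.

(** With weights $1 + c$ and $1 + 1/c$, $c$ small, this bound compares the norms
    of two nearby functions without losing a constant factor. *)
Lemma sqint_weighted a b (u f g : T -> R) : 0 <= a -> 0 <= b ->
  measurable_fun setT u -> measurable_fun setT f -> measurable_fun setT g ->
  (forall x, u x ^+ 2 <= a * f x ^+ 2 + b * g x ^+ 2) ->
  (sqint u <= a%:E * sqint f + b%:E * sqint g)%E.
Proof.
move=> a0 b0 mu_ mf mg H.
have nn (c : R) (h : T -> R) (x : T) : 0 <= c -> setT x -> (0 <= c%:E * (h x ^+ 2)%:E :> \bar R)%E.
  by move=> c0 _; rewrite -EFinM lee_fin mulr_ge0// sqr_ge0.
have mm (c : R) (h : T -> R) : measurable_fun setT h ->
    measurable_fun setT (fun x => c%:E * (h x ^+ 2)%:E)%E.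
  by move=> mh; apply: measurable_funeM; exact: measurable_sq.
rewrite /sqint -!ge0_integralZl_EFin//;
  try (by move=> x _; rewrite lee_fin sqr_ge0); try exact: measurable_sq.
rewrite -ge0_integralD//; try exact: mm; try by move=> x; exact: nn.
apply: ge0_le_integral => //.
- by move=> x _; rewrite lee_fin sqr_ge0.
- exact: measurable_sq.
- by apply: emeasurable_funD; exact: mm.
- by move=> x _; rewrite -!EFinM -EFinD lee_fin.
Qed.

Lemma sqintD_le f g : measurable_fun setT f -> measurable_fun setT g ->
  (sqint (f \+ g)%R <= 2%:E * sqint f + 2%:E * sqint g)%E.
Proof.
move=> mf mg; apply: sqint_weighted => //; first exact: measurable_funD.
by move=> x /=; have := sqr_ge0 (f x - g x); lra.
Qed.

Lemma sqintN f : sqint (\- f)%R = sqint f.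
Proof. by apply: eq_integral => x _ /=; rewrite sqrrN. Qed.

Lemma sqintBC f g : sqint (f \- g)%R = sqint (g \- f)%R.
Proof. by apply: eq_integral => x _ /=; rewrite -sqrrN opprB. Qed.

Lemma sqintB_le f g : measurable_fun setT f -> measurable_fun setT g ->
  (sqint (f \- g)%R <= 2%:E * sqint f + 2%:E * sqint g)%E.
Proof.
move=> mf mg; rewrite -(sqintN g); apply: (@sqintD_le f (\- g)) => //.
exact: measurableT_comp.
Qed.

Lemma sqintD_lty f g : measurable_fun setT f -> measurable_fun setT g ->
  (sqint f < +oo)%E -> (sqint g < +oo)%E -> (sqint (f \+ g)%R < +oo)%E.
Proof.
move=> mf mg ff fg; apply: le_lt_trans (sqintD_le mf mg) _.
by apply: lte_add_pinfty; apply: lte_mul_pinfty.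
Qed.

Lemma sqintB_lty f g : measurable_fun setT f -> measurable_fun setT g ->
  (sqint f < +oo)%E -> (sqint g < +oo)%E -> (sqint (f \- g)%R < +oo)%E.
Proof.
move=> mf mg ff fg; apply: le_lt_trans (sqintB_le mf mg) _.
by apply: lte_add_pinfty; apply: lte_mul_pinfty.
Qed.

Lemma sqint_fin f : (sqint f < +oo)%E -> sqint f \is a fin_num.
Proof. by move=> ?; rewrite ge0_fin_numE// sqint_ge0. Qed.

(** By [sqint_weighted] in both directions: a weight close to 1 on the limit, a
    large weight on the vanishing difference. *)
Lemma sqint_cvg (F : nat -> T -> R) f :
  (forall n, measurable_fun setT (F n)) -> measurable_fun setT f ->
  (sqint f < +oo)%E -> (sqint (F n \- f)%R @[n --> \oo] --> 0)%E ->
  (sqint (F n) @[n --> \oo] --> sqint f)%E.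
Proof.
move=> mF mf ff cF.
have mFf n : measurable_fun setT (F n \- f) by exact: measurable_funB.
have fin : \forall n \near \oo, (sqint (F n \- f)%R < 1%:E)%E.
  by move/ge0_cvge0P : cF => /(_ (fun n => sqint_ge0 _)) /(_ 1 ltr01).
rewrite -(fineK (sqint_fin ff)); apply/fine_cvgP; split.
  apply: filterS fin => n fn; apply: sqint_fin.
  rewrite (_ : F n = (F n \- f) \+ f); last by apply/funext => x /=; rewrite subrK.
  by apply: sqintD_lty => //; rewrite (lt_trans fn)// ltry.
apply/cvgrPdist_lt => e e0.
set b := fine (sqint f).
have b0 : 0 <= b by rewrite fine_ge0// sqint_ge0.
(* With this weight the norm of [F n] stays below b + e, and c (b + e + 1) is a
   small part of e. *)
pose c := e / (4 * (b + e + 1)).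
have b1 : 0 < b + e + 1 by lra.
have c0 : 0 < c by rewrite divr_gt0// mulr_gt0.
have ci0 : 0 < c^-1 by rewrite invr_gt0.
have cb : c * (b + e + 1) = e / 4.
  by rewrite /c invfM mulrA -mulrA mulVf ?mulr1// gt_eqF.
have : \forall n \near \oo, (sqint (F n \- f)%R < (e / 8 / (1 + c^-1))%:E)%E.
  move/ge0_cvge0P : cF => /(_ (fun n => sqint_ge0 _)); apply.
  by rewrite divr_gt0// ?divr_gt0// addr_gt0.
apply: filterS2 fin => n fn1 fn /=.
have fFf : (sqint (F n \- f)%R < +oo)%E by rewrite (lt_trans fn1)// ltry.
have fF : (sqint (F n) < +oo)%E.
  rewrite (_ : F n = (F n \- f) \+ f); last by apply/funext => x /=; rewrite subrK.
  exact: sqintD_lty.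
have W1 : (sqint (F n) <= (1 + c)%:E * sqint f + (1 + c^-1)%:E * sqint (F n \- f)%R)%E.
  apply: sqint_weighted => //; rewrite ?addr_ge0 ?ltW// => x /=.
  have : 0 <= c * (f x - c^-1 * (F n x - f x)) ^+ 2 by rewrite mulr_ge0 ?sqr_ge0// ltW.
  rewrite (_ : c * _ = c * f x ^+ 2 - 2 * (c * c^-1) * (f x * (F n x - f x)) +
    c * c^-1 * c^-1 * (F n x - f x) ^+ 2); last by ring.
  by rewrite mulfV ?gt_eqF//; move: (c^-1) => d; lra.
have W2 : (sqint f <= (1 + c)%:E * sqint (F n) + (1 + c^-1)%:E * sqint (F n \- f)%R)%E.
  apply: sqint_weighted => //; rewrite ?addr_ge0 ?ltW// => x /=.
  have : 0 <= c * (F n x + c^-1 * (F n x - f x)) ^+ 2 by rewrite mulr_ge0 ?sqr_ge0// ltW.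
  rewrite (_ : c * _ = c * F n x ^+ 2 + 2 * (c * c^-1) * (F n x * (F n x - f x)) +
    c * c^-1 * c^-1 * (F n x - f x) ^+ 2); last by ring.
  by rewrite mulfV ?gt_eqF//; move: (c^-1) => d; lra.
move: W1 W2 fn; rewrite -(fineK (sqint_fin ff)) -(fineK (sqint_fin fF)) -(fineK (sqint_fin fFf)).
rewrite -/b -!EFinM -!EFinD !lee_fin lte_fin ltr_pdivlMr ?addr_gt0//.
set A := fine _; set a := fine _; rewrite [a * _]mulrC; set Ca := _ * a => W1 W2 Ca8.
have ce0 : 0 < c * e by rewrite mulr_gt0.
have cb0 : 0 <= c * b by rewrite mulr_ge0// ltW.
have cA : A <= b + e by lra.
have {}cA : c * A <= c * (b + e) by rewrite ler_wpM2l// ltW.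
by rewrite /= ltr_norml; apply/andP; split; lra.
Qed.

Lemma sqint_integrable f : measurable_fun setT f -> (sqint f < +oo)%E ->
  mu.-integrable setT (fun x => (f x ^+ 2)%:E).
Proof.
move=> mf ff; apply/integrableP; split; first exact: measurable_sq.
rewrite (eq_integral (fun x => (f x ^+ 2)%:E))// => x _.
by rewrite gee0_abs// lee_fin sqr_ge0.
Qed.

Lemma mul_integrable f g : measurable_fun setT f -> measurable_fun setT g ->
  (sqint f < +oo)%E -> (sqint g < +oo)%E ->
  mu.-integrable setT (fun x => (f x * g x)%:E).
Proof.
move=> mf mg ff fg.
apply: (@le_integrable _ _ _ mu setT measurableT _
  (fun x => (f x ^+ 2)%:E + (g x ^+ 2)%:E)%E).
- by apply/measurable_EFinP; exact: measurable_funM.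
- move=> x _ /=; rewrite lee_fin normrM [leRHS]ger0_norm ?addr_ge0 ?sqr_ge0//.
  rewrite -[f x ^+ 2]real_normK ?num_real// -[g x ^+ 2]real_normK ?num_real//.
  have := sqr_ge0 (`|f x| - `|g x|).
  have := sqr_ge0 `|f x|; have := sqr_ge0 `|g x|; lra.
- by apply: integrableD => //; exact: sqint_integrable.
Qed.

Lemma sqintD_exact f g : measurable_fun setT f -> measurable_fun setT g ->
  (sqint f < +oo)%E -> (sqint g < +oo)%E ->
  (sqint (f \+ g)%R = sqint f + sqint g + 2%:E * \int[mu]_x (f x * g x)%:E)%E.
Proof.
move=> mf mg ff fg; have ifg := mul_integrable mf mg ff fg.
have if2 := sqint_integrable mf ff; have ig2 := sqint_integrable mg fg.
rewrite -integralZl// /sqint -integralD// -integralD//; last first.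
- exact: integrableZl.
- exact: integrableD.
by apply: eq_integral => x _ /=; congr EFin; ring.
Qed.

Lemma sqint_polarization f g : measurable_fun setT f -> measurable_fun setT g ->
  (sqint f < +oo)%E -> (sqint g < +oo)%E ->
  (sqint (f \+ g)%R = sqint (f \- g)%R + 4%:E * \int[mu]_x (f x * g x)%:E)%E.
Proof.
move=> mf mg ff fg; have ifg := mul_integrable mf mg ff fg.
rewrite -integralZl// /sqint -integralD//; last first.
- exact: integrableZl.
- by apply: sqint_integrable; [exact: measurable_funB | exact: sqintB_lty].
by apply: eq_integral => x _ /=; congr EFin; ring.
Qed.

Lemma sqint_eq0 f : measurable_fun setT f -> sqint f = 0%E ->
  {ae mu, forall x, f x = 0}.
Proof.
move=> mf f0.
have /ae_eq_integral_abs : measurable_fun setT (fun x => (f x ^+ 2)%:E) by exact: measurable_sq.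
move=> /(_ mu measurableT) [H _].
have /H : (\int[mu]_x `|(f x ^+ 2)%:E|)%E = 0%E.
  rewrite -[RHS]f0; apply: eq_integral => x _.
  by rewrite gee0_abs// lee_fin sqr_ge0.
apply: filterS => x /(_ I) [] /eqP; rewrite sqrf_eq0 => /eqP.
by [].
Qed.

Lemma sqint_chebyshev f e : measurable_fun setT f -> 0 < e ->
  (mu [set x | (e <= `|f x|)%R] <= (e ^- 2)%:E * sqint f)%E.
Proof.
move=> mf e0.
have mS : measurable [set x | (e <= `|f x|)%R].
  rewrite -[X in measurable X]setTI.
  by apply: (@measurable_fun_le _ _ R setT (cst e)) => //; exact: measurableT_comp.
rewrite -(setIT [set x | _]) -integral_indic// /sqint -ge0_integralZl_EFin//; first last.
- by rewrite invr_ge0 exprn_ge0// ltW.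
- exact: measurable_sq.
- by move=> x _; rewrite lee_fin sqr_ge0.
apply: ge0_le_integral => //.
- by apply/measurable_EFinP; exact: measurable_indic.
- by apply: measurable_funeM; exact: measurable_sq.
- move=> x _; rewrite -EFinM lee_fin indicE.
  have [/set_mem/= ex|_] := boolP (x \in _); last first.
    by rewrite mulr_ge0 ?sqr_ge0// invr_ge0 exprn_ge0// ltW.
  rewrite mulrC ler_pdivlMr ?exprn_gt0// mul1r -[leRHS]real_normK ?num_real//.
  by rewrite ler_sqr ?nnegrE// ltW.
Qed.

End SquareIntegral.

(** * Completeness in mean square *)

Section MeanSquareCompleteness.
Context {disp : measure_display} {T : measurableType disp} {R : realType}.
Variable P : probability T R.

(** The inequality between the means of $2^{-n}$ and $2^n x^2$: a second moment
    at most $4^{-n}$ gives a first absolute moment at most $2^{-n}$. *)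
Lemma abs_le_weighted_sq (x : R) n :
  `|x| <= 2^-1 * (2^-1 ^+ n + 2 ^+ n * x ^+ 2).
Proof.
have h : 2^-1 ^+ n * 2 ^+ n = 1 :> R by rewrite -exprMn mulVf ?expr1n.
have p : 0 < 2^-1 ^+ n :> R by rewrite exprn_gt0// invr_gt0.
have q : 0 < 2 ^+ n :> R by rewrite exprn_gt0.
move: (2^-1 ^+ n) (2 ^+ n) h p q => a b ab a0 b0.
rewrite -(real_normK (num_real x)); move: `|x| => y.
have : 0 <= b * (y - a) ^+ 2 by rewrite mulr_ge0 ?sqr_ge0// ltW.
rewrite (_ : b * _ = b * y ^+ 2 - 2 * (a * b) * y + a * b * a); last by ring.
rewrite ab; lra.
Qed.

Lemma integral_abs_le_sqint (f : T -> R) n : measurable_fun setT f ->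
  (sqint P f <= ((4^-1) ^+ n)%:E)%E ->
  (\int[P]_x `|f x|%:E <= (2^-1 ^+ n)%:E)%E.
Proof.
move=> mf fn.
have ff : (sqint P f < +oo)%E by rewrite (le_lt_trans fn)// ltry.
apply: (@le_trans _ _ (\int[P]_x ((2^-1 * 2^-1 ^+ n)%:E + (2^-1 * 2 ^+ n)%:E * (f x ^+ 2)%:E))%E).
  apply: ge0_le_integral => //.
  - by apply/measurable_EFinP; exact: measurableT_comp.
  - by apply: emeasurable_funD => //; apply: measurable_funeM; exact: measurable_sq.
  - by move=> x _; rewrite -EFinM -EFinD lee_fin (le_trans (abs_le_weighted_sq _ n))// mulrDr mulrA.
have i2n : 0 <= 2^-1 * 2 ^+ n :> R by rewrite mulr_ge0// ?invr_ge0// exprn_ge0.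
rewrite ge0_integralD//; last 2 first.
- by move=> x _; rewrite -EFinM lee_fin mulr_ge0// sqr_ge0.
- by apply: measurable_funeM; exact: measurable_sq.
rewrite integral_cst//= probability_setT mule1 ge0_integralZl_EFin//; last 2 first.
- by move=> x _; rewrite lee_fin sqr_ge0.
- exact: measurable_sq.
apply: (@le_trans _ _ ((2^-1 * 2^-1 ^+ n)%:E + (2^-1 * 2 ^+ n)%:E * ((4^-1) ^+ n)%:E)%E).
  by rewrite leeD2l// lee_wpmul2l.
rewrite -EFinM -EFinD lee_fin -mulrA -exprMn.
rewrite (_ : 2 / 4 = 2^-1 :> R); last by lra.
by rewrite -mulrDl (_ : 2^-1 + 2^-1 = 1 :> R) ?mul1r//; lra.
Qed.

Variable X : nat -> T -> R.
Hypothesis mX : forall n, measurable_fun setT (X n).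
Hypothesis fastX : forall n, (sqint P (X n.+1 \- X n)%R <= (4^-1 ^+ n)%:E)%E.

Let mXB n m : measurable_fun setT (X n \- X m).
Proof. exact: measurable_funB. Qed.

(** The expected absolute increments are summable, hence the increments are
    almost surely summable. *)
Lemma fast_cauchy_ae_cvg : {ae P, forall x, cvgn (X ^~ x)}.
Proof.
pose D n x := `|X n.+1 x - X n x|.
have mD n : measurable_fun setT (fun x => (D n x)%:E).
  by apply/measurable_EFinP; apply: measurableT_comp => //; exact: (mXB n.+1 n).
have D0 n x : (0 <= (D n x)%:E)%E by rewrite lee_fin normr_ge0.
have mS : measurable_fun setT (fun x => (\sum_(0 <= n <oo) (D n x)%:E)%E).
  exact: (@ge0_emeasurable_sum _ _ _ setT (fun n x => (D n x)%:E) xpredT).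
have intS : P.-integrable setT (fun x => (\sum_(0 <= n <oo) (D n x)%:E)%E).
  apply/integrableP; split => //.
  rewrite (eq_integral (fun x => (\sum_(0 <= n <oo) (D n x)%:E)%E)); last first.
    by move=> x _; rewrite gee0_abs// nneseries_ge0.
  rewrite integral_nneseries//; apply: (@le_lt_trans _ _ 2%:E); last exact: ltry.
  apply: lime_le.
    by apply: is_cvg_nneseries => n _ _; exact: integral_ge0.
  apply: nearW => n.
  apply: (@le_trans _ _ (\sum_(0 <= k < n) (2^-1 ^+ k)%:E)%E).
    by apply: lee_sum => k _; exact: (@integral_abs_le_sqint (X k.+1 \- X k)).
  rewrite sumEFin lee_fin.
  have := @geometric_le_lim R n 1 2^-1 ler01.
  rewrite invr_gt0 ltr0n gtr0_norm ?invr_gt0// invf_lt1// ltr1n => /(_ isT isT).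
  rewrite (_ : 1 / (1 - 2^-1) = 2); last by field.
  apply: le_trans; rewrite /series /=; apply: ler_sum => k _.
  by rewrite mul1r.
have := integrable_ae measurableT intS.
apply: filterS => x /(_ I) fS.
have cD : cvgn (series (D ^~ x)).
  apply: nondecreasing_is_cvgn.
    by apply/nondecreasing_seqP => n; rewrite seriesSr lerDl normr_ge0.
  exists (fine (\sum_(0 <= n <oo) (D n x)%:E)%E) => _ [n _ <-].
  rewrite -lee_fin fineK// -sumEFin.
  exact: (@nneseries_lim_ge _ (fun n => (D n x)%:E) xpredT 0 n).
have {}cD : cvgn (series (fun n => X n.+1 x - X n x)) by exact: normed_cvg.
have -> : X ^~ x = (fun n => series (fun n => X n.+1 x - X n x) n + X 0%N x).
  by apply/funext => n; rewrite /series/= telescope_sumr// subrK.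
by apply: is_cvgD => //; exact: is_cvg_cst.
Qed.

Lemma fast_cauchy_sqint n j : (sqint P (X (n + j)%N \- X n)%R <= (4 * 4^-1 ^+ n)%:E)%E.
Proof.
elim: j n => [|j IH] n.
  by rewrite addn0 sqint_subrr lee_fin mulr_ge0// exprn_ge0// invr_ge0.
rewrite (_ : X (n + j.+1)%N \- X n = (X (n.+1 + j)%N \- X n.+1) \+ (X n.+1 \- X n)); last first.
  by apply/funext => x /=; rewrite addnS addSn addrA subrK.
apply: le_trans (sqintD_le _ (mXB _ _) (mXB _ _)) _.
apply: (@le_trans _ _ (2%:E * (4 * 4^-1 ^+ n.+1)%:E + 2%:E * (4^-1 ^+ n)%:E)%E).
  by apply: leeD; rewrite lee_wpmul2l.
by rewrite -!EFinM -EFinD lee_fin exprS; lra.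
Qed.

(** Completeness of the mean-square norm, along a sequence whose increments
    decrease geometrically: by Fatou's lemma the almost sure limit is also the
    mean-square limit. *)
Lemma fast_cauchy_complete :
  exists2 Y, measurable_fun setT Y & (sqint P (X n \- Y)%R @[n --> \oo] --> 0)%E.
Proof.
(* The upper limit is measurable and exists also where the sequence diverges. *)
pose E x := limn_esup (fun n => (X n x)%:E).
have mE : measurable_fun setT E.
  by apply: measurable_fun_limn_esup => n; apply/measurable_EFinP.
pose Y x := fine (E x).
have mY : measurable_fun setT Y by exact: (measurableT_comp (fine_measurable measurableT) mE).
exists Y => //.
have cvY : {ae P, forall x, X n x @[n --> \oo] --> Y x}.
  apply: filterS fast_cauchy_ae_cvg => x cx.
  have cE : (X n x)%:E @[n --> \oo] --> (limn (X ^~ x))%:E by apply: cvg_EFin => //; exact: nearW.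
  by rewrite /Y /E (cvg_limn_einf_sup cE).2.
have bnd n : (sqint P (X n \- Y)%R <= (4 * 4^-1 ^+ n)%:E)%E.
  pose u j x := ((X (n + j)%N x - X n x) ^+ 2)%:E.
  have mu_ j : measurable_fun setT (u j) by exact: (measurable_sq (mXB (n + j)%N n)).
  have u0 j x : (0 <= u j x)%E by rewrite lee_fin sqr_ge0.
  apply: (@le_trans _ _ (\int[P]_x limn_einf (u ^~ x))%E); last first.
    apply: (le_trans (fatou _ _ _ _)) => //.
    apply: (le_trans (limn_einf_sup _)); rewrite limn_esup_lim.
    apply: lime_le; first exact: is_cvg_esups.
    apply: nearW => m; apply: ge_ereal_sup => _ [j _ <-].
    exact: fast_cauchy_sqint.
  apply: ae_ge0_le_integral => //.
  - by move=> x _; rewrite lee_fin sqr_ge0.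
  - by apply: measurable_sq; exact: measurable_funB.
  - by move=> x _; rewrite limn_einf_lim; apply: lime_ge; [exact: is_cvg_einfs|
      apply: nearW => m; apply: le_ereal_inf_tmp => _ [j _ <-]].
  - rewrite /limn_einf; apply: measurableT_comp; first exact: oppe_measurable.
    apply: measurable_fun_limn_esup => j.
    by apply: measurableT_comp => //; exact: oppe_measurable.
  apply: filterS cvY => x cx _.
  have cu : u j x @[j --> \oo] --> ((X n x - Y x) ^+ 2)%:E.
    apply: cvg_EFin; first exact: nearW.
    rewrite [X in _ --> X](_ : _ = (Y x - X n x) * (Y x - X n x)); last by ring.
    have cXn : (X (n + j)%N x - X n x) @[j --> \oo] --> Y x - X n x.
      apply: cvgB; last exact: cvg_cst.
      have := cx; rewrite -(cvg_shiftn n (X ^~ x)) /=.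
      by under eq_fun do rewrite addnC.
    by apply: (cvg_trans _ (cvgM cXn cXn)).
  by rewrite (cvg_limn_einf_sup cu).1.
apply: (@squeeze_cvge _ _ _ _ (cst 0%E) _ (fun n => (4 * 4^-1 ^+ n)%:E)).
- by apply: nearW => n; rewrite sqint_ge0 bnd.
- exact: cvg_cst.
- apply: cvg_EFin; first exact: nearW.
  rewrite -(mulr0 4); apply: cvgMr; apply: cvg_expr.
  by rewrite ger0_norm ?invr_ge0// invf_lt1// ltr1n.
Qed.

End MeanSquareCompleteness.

(** * Independence and moments *)

Lemma ae_witness d (S : measurableType d) (R : realType) (P : probability S R)
  (Q : S -> Prop) : {ae P, forall x, Q x} -> exists x, Q x.
Proof.
move=> aeQ; apply/not_existsP => nQ.
have : P.-negligible setT.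
  by apply: negligibleS aeQ => x _; exact: nQ.
move/(negligibleP _ measurableT) => P0; have := @probability_setT _ _ _ P.
by rewrite [LHS]P0 => /eqP; rewrite eq_sym onee_eq0.
Qed.

Section Independence.
Context {disp : measure_display} {T : measurableType disp} {R : realType}.
Variable P : probability T R.

Definition independent_pair (U V : T -> R) : Prop :=
  forall A B : set R, measurable A -> measurable B ->
  P (U @^-1` A `&` V @^-1` B) = (P (U @^-1` A) * P (V @^-1` B))%E.

Lemma sqint_cst (c : R) : (sqint P (cst c) = (c ^+ 2)%:E)%E.
Proof.
by have := @integral_cst _ _ _ P setT measurableT (c ^+ 2)%:E; rewrite /= probability_setT mule1. Qed.

Lemma L2_integrable (f : T -> R) : measurable_fun setT f ->
  (sqint P f < +oo)%E -> P.-integrable setT (fun x => (f x)%:E).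
Proof.
move=> mf ff; have := @mul_integrable _ _ _ P f (cst 1) mf.
rewrite sqint_cst ltry => /(_ (measurable_cst _) ff isT).
by under eq_fun do rewrite mulr1.
Qed.

Variables U V : T -> R.
Hypotheses (mU : measurable_fun setT U) (mV : measurable_fun setT V).
Hypothesis UV : independent_pair U V.

Let Ur : {mfun T >-> R} := HB.pack U (isMeasurableFun.Build _ _ _ _ U mU).
Let Vr : {mfun T >-> R} := HB.pack V (isMeasurableFun.Build _ _ _ _ V mV).
Let mu1 : probability _ R := distribution P Ur.
Let mu2 : probability _ R := distribution P Vr.
Let UV_ w := (U w, V w).
Let mUV : measurable_fun setT UV_. Proof. exact: measurable_fun_pair. Qed.

(** Independence says that the law of $(U, V)$ agrees with the product of the
    laws of $U$ and $V$ on rectangles. *)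
Let product_law A : measurable A -> (mu1 \x mu2)%E A = pushforward P UV_ A.
Proof.
apply: product_measure_unique => B C mB mC.
exact: UV.
Qed.

Lemma joint_integrable (f : R * R -> \bar R) : measurable_fun setT f ->
  P.-integrable setT (f \o UV_) -> (mu1 \x mu2)%E.-integrable setT f.
Proof.
move=> mf intf; have := @integrable_pushforward _ _ _ _ _ _ mUV P setT f mf intf measurableT.
move=> /integrableP[_ fin]; apply/integrableP; split => //.
by rewrite (eq_measure_integral (pushforward P UV_))// => A mA _; exact: product_law.
Qed.

Lemma joint_integral (f : R * R -> \bar R) : measurable_fun setT f ->
  P.-integrable setT (f \o UV_) ->
  (\int[mu1 \x mu2]_z f z = \int[P]_w f (U w, V w))%E.
Proof.
move=> mf intf.
rewrite (eq_measure_integral (pushforward P UV_)) => [|A mA _]; last exact: product_law.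
by rewrite integral_pushforward.
Qed.

(** By Fubini, for almost every value $v$ of $V$ the variable $U + v$ is square
    integrable; one such value suffices. *)
Lemma independent_sum_sqint : (sqint P (U \+ V)%R < +oo)%E -> (sqint P U < +oo)%E.
Proof.
move=> fUV.
pose f (z : R * R) : \bar R := ((z.1 + z.2) ^+ 2)%:E.
have mf : measurable_fun setT f.
  by apply/measurable_EFinP; apply: measurable_funX; exact: measurable_funD.
have intf : P.-integrable setT (f \o UV_).
  exact: (sqint_integrable (measurable_funD mU mV)).
have [v iv] := ae_witness (ae_integrable2 (joint_integrable mf intf)).
have {}iv : (sqint P (U \+ cst v)%R < +oo)%E.
  move/integrableP : iv => [_].
  rewrite ge0_integral_distribution//=.
    rewrite (_ : (\int[P]_x _)%E = sqint P (U \+ cst v)%R)//.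
    by apply: eq_integral => w _ /=; rewrite ger0_norm ?sqr_ge0.
  apply/measurable_EFinP; apply: measurableT_comp => //; apply: measurable_funX.
  exact: measurable_funD.
rewrite (_ : U = (U \+ cst v) \- cst v); last by apply/funext => x /=; rewrite addrK.
apply: sqintB_lty => //; first exact: measurable_funD.
by rewrite sqint_cst ltry.
Qed.

Lemma independent_expectation_mul :
  (sqint P U < +oo)%E -> (sqint P V < +oo)%E ->
  (\int[P]_w (U w * V w)%:E = (\int[P]_w (U w)%:E) * (\int[P]_w (V w)%:E))%E.
Proof.
move=> fU fV.
have iU := L2_integrable mU fU; have iV := L2_integrable mV fV.
pose f (z : R * R) : \bar R := (z.1 * z.2)%:E.
have mf : measurable_fun setT f.
  by apply/measurable_EFinP; exact: measurable_funM.
have mE : measurable_fun setT (@EFin R) by exact/measurable_EFinP.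
have intf : P.-integrable setT (f \o UV_) by exact: mul_integrable.
have EV : (\int[mu2]_y y%:E = \int[P]_w (V w)%:E)%E by rewrite integral_distribution.
have EU : (\int[mu1]_y y%:E = \int[P]_w (U w)%:E)%E by rewrite integral_distribution.
have i1 : mu1.-integrable setT (@EFin R) by apply: integrable_pushforward.
have i2 : mu2.-integrable setT (@EFin R) by apply: integrable_pushforward.
rewrite -(joint_integral mf intf) -integral12_prod_meas1; last exact: joint_integrable.
rewrite -EU -EV; rewrite /fubini_F /f /=.
under eq_integral do under eq_integral do rewrite EFinM.
under eq_integral do rewrite integralZl//.
rewrite -(fineK (integrable_fin_num measurableT i2)).
by rewrite integralZr.
Qed.

End Independence.

(** * Moments of one-sided Levy processes *)

Section AdditiveFunctions.
Context {R : realType}.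
Variables (f : R -> R) (M : R).
Hypothesis fD : forall s t, 0 <= s -> 0 <= t -> f (s + t) = f s + f t.

Lemma additive_natmul n t : 0 <= t -> f (n%:R * t) = n%:R * f t.
Proof.
move=> t0; elim: n => [|n IH].
  rewrite !mul0r; have := fD (lexx 0) (lexx 0); rewrite addr0; lra.
by rewrite -natr1 !mulrDl !mul1r fD ?mulr_ge0// IH.
Qed.

Hypothesis f_bounded : forall t, 0 <= t <= 1 -> `|f t| <= M.

(** The defect $f(Nt) - N t f(1)$ depends only on the fractional part of $Nt$,
    so $N |f(t) - t f(1)|$ is bounded in $N$. *)
Lemma additive_bounded_linear t : 0 <= t -> f t = t * f 1.
Proof.
move=> t0; apply/eqP; rewrite -subr_eq0; apply/eqP.
set D := f t - _.
have bnd (N : nat) : N%:R * `|D| <= M + `|f 1|.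
  have Nt : 0 <= N%:R * t by rewrite mulr_ge0.
  have /andP[k1 k2] := truncn_itv Nt.
  set k := Num.truncn _ in k1 k2; pose r := N%:R * t - k%:R.
  have r01 : 0 <= r <= 1 by rewrite subr_ge0 k1 lerBlDr addrC natr1 ltW.
  have /andP[r0 r1] := r01.
  have E : N%:R * D = f r - r * f 1.
    rewrite mulrBr -additive_natmul// (_ : N%:R * t = k%:R * 1 + r); last by rewrite mulr1 /r addrC subrK.
    rewrite fD ?mulr_ge0// additive_natmul// mulrA.
    by rewrite (_ : N%:R * t = k%:R + r); [ring | rewrite /r addrC subrK].
  rewrite -(normr_nat R N) -normrM E (le_trans (ler_normB _ _))// lerD ?f_bounded//.
  by rewrite normrM ler_piMl// ger0_norm.
apply/eqP; rewrite -normr_eq0 eq_le normr_ge0 andbT leNgt; apply/negP => D0.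
have C0 : 0 <= M + `|f 1| by rewrite addr_ge0// (le_trans _ (f_bounded (t := 0) _))// lexx ler01.
have := bnd (Num.truncn ((M + `|f 1|) / `|D|)).+1.
by rewrite -ler_pdivlMr// leNgt truncnS_gt.
Qed.

End AdditiveFunctions.

Section Laws.
Context {disp : measure_display} {T : measurableType disp} {R : realType}.
Variable P : probability T R.
Variables U V : T -> R.
Hypotheses (mU : measurable_fun setT U) (mV : measurable_fun setT V).
Hypothesis UV : forall B : set R, measurable B -> P (U @^-1` B) = P (V @^-1` B).

Lemma eq_law_sqint : sqint P U = sqint P V.
Proof.
have mf : measurable_fun setT (fun x : R => (x ^+ 2)%:E).
  by apply/measurable_EFinP; exact: measurable_funX.
have f0 : {in setT, forall y : R, (0 <= (y ^+ 2)%:E)%E} by move=> y _; rewrite lee_fin sqr_ge0.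
have := @ge0_integral_pushforward _ _ _ _ _ _ mU P setT _ measurableT mf f0.
have := @ge0_integral_pushforward _ _ _ _ _ _ mV P setT _ measurableT mf f0.
rewrite !preimage_setT /sqint => <- <-; apply: eq_measure_integral => A mA _.
exact: UV.
Qed.

Lemma eq_law_expectation : (sqint P U < +oo)%E ->
  (\int[P]_w (U w)%:E = \int[P]_w (V w)%:E)%E.
Proof.
move=> fU; have fV := fU; rewrite eq_law_sqint in fV.
have mE : measurable_fun setT (@EFin R) by exact/measurable_EFinP.
have := @integral_pushforward _ _ _ _ _ _ mU P setT _ mE (L2_integrable mU fU) measurableT.
have := @integral_pushforward _ _ _ _ _ _ mV P setT _ mE (L2_integrable mV fV) measurableT.
rewrite !preimage_setT /= => <- <-; apply: eq_measure_integral => A mA _.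
exact: UV.
Qed.

End Laws.

Section OneSidedLevyMoments.
Context {disp : measure_display} {T : measurableType disp} {R : realType}.
Variables (P : probability T R) (X : R -> T -> R).
Hypothesis X_levy : levy_process P X.

Lemma levy_measurable t : 0 <= t -> measurable_fun setT (X t).
Proof. by case: X_levy => -[mX _ _ _ _] _; exact: mX. Qed.

Lemma levy_increment_measurable s t : 0 <= s -> 0 <= t ->
  measurable_fun setT (fun w => X t w - X s w).
Proof. by move=> s0 t0; apply: measurable_funB; exact: levy_measurable. Qed.

Lemma levy_increment_law s t B : 0 <= s -> s <= t -> measurable B ->
  P ((fun w => X t w - X s w) @^-1` B) = P (X (t - s) @^-1` B).
Proof. by move=> s0 st mB; case: X_levy => -[_ _ _ sX _] _; exact: sX. Qed.

Lemma levy_increments_independent s t : 0 <= s -> 0 <= t ->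
  independent_pair P (fun w => X s w - X 0 w) (fun w => X (s + t) w - X s w).
Proof.
move=> s0 t0 A B mA mB; case: X_levy => -[_ _ iX _ _] _.
(* Times 0, s, s + t, then constant: the sequence of times has to be infinite. *)
pose tau (n : nat) := if n is n'.+1 then (if n' is _.+1 then s + t else s) else 0 : R.
have tau_nd i : tau i <= tau i.+1 by case: i => [|[|i]] //=; rewrite lerDl.
pose C (i : 'I_2) := if i == ord0 then A else B.
have mC i : measurable (C i) by rewrite /C; case: ifP.
have := iX tau (lexx _) tau_nd 2%N C mC.
rewrite big_ord_recl big_ord1 /C /= => <-.
congr (P _); apply/seteqP; split => [w [/= wA wB] i|w /= h].
  by case: i => -[|[|//]] i2.
by split; [exact: (h ord0) | exact: (h (lift ord0 ord0))].
Qed.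

Lemma levy_increment_sqint s t : 0 <= s -> s <= t ->
  sqint P (fun w => X t w - X s w) = sqint P (X (t - s)).
Proof.
move=> s0 st; apply: eq_law_sqint.
- by apply: levy_increment_measurable => //; exact: le_trans st.
- by apply: levy_measurable; rewrite subr_ge0.
- by move=> B mB; exact: levy_increment_law.
Qed.

Hypothesis X1_L2 : (sqint P (X 1) < +oo)%E.

(** For $t \le 1$, $X(1) - X(0)$ is the sum of the independent variables
    $X(t) - X(0)$ and $X(1) - X(t)$, and [independent_sum_sqint] applies; longer
    times are reached in steps of length 1. *)
Lemma levy_L2 t : 0 <= t -> (sqint P (X t) < +oo)%E.
Proof.
have L01 s : 0 <= s -> s <= 1 -> (sqint P (X s) < +oo)%E.
  move=> s0 s1; have s10 : 0 <= 1 - s by rewrite subr_ge0.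
  have := levy_increments_independent s0 s10; rewrite addrC subrK => ind.
  rewrite -{1}(subr0 s) -levy_increment_sqint//.
  apply: (independent_sum_sqint _ _ ind); try exact: levy_increment_measurable.
  rewrite (_ : _ \+ _ = (fun w => X 1 w - X 0 w)).
    by rewrite levy_increment_sqint// subr0.
  by apply/funext => w /=; rewrite addrC addrA subrK.
move=> t0; have [n tn] : exists n : nat, t <= n%:R.
  by exists (Num.truncn t).+1; rewrite ltW// truncnS_gt.
elim: n t t0 tn => [|n IH] t t0 tn; first by apply: L01 => //; exact: le_trans tn _.
have [t1|t1] := leP t 1; first exact: L01.
have t10 : 0 <= t - 1 by rewrite subr_ge0 ltW.
rewrite (_ : X t = X (t - 1) \+ (fun w => X t w - X (t - 1) w)); last first.
  by apply/funext => w /=; rewrite addrC subrK.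
apply: sqintD_lty.
- exact: levy_measurable.
- exact: levy_increment_measurable.
- by apply: IH => //; rewrite lerBlDr natr1.
- by rewrite levy_increment_sqint// ?gerBl// opprB addrC subrK.
Qed.

Let m t := fine (\int[P]_w (X t w)%:E)%E.
Let q t := fine (sqint P (X t)).

Let mE t : 0 <= t -> (\int[P]_w (X t w)%:E)%E = (m t)%:E.
Proof.
move=> t0; rewrite /m fineK//; apply: integrable_fin_num => //.
by apply: L2_integrable; [exact: levy_measurable | exact: levy_L2].
Qed.

Let qE t : 0 <= t -> sqint P (X t) = (q t)%:E.
Proof. by move=> t0; rewrite /q fineK// sqint_fin// levy_L2. Qed.

Lemma levy_increment_expectation s t : 0 <= s -> s <= t ->
  (\int[P]_w (X t w - X s w)%:E)%E = (\int[P]_w (X (t - s) w)%:E)%E.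
Proof.
move=> s0 st; apply: eq_law_expectation.
- by apply: levy_increment_measurable => //; exact: le_trans st.
- by apply: levy_measurable; rewrite subr_ge0.
- by move=> B mB; exact: levy_increment_law.
- by rewrite levy_increment_sqint// levy_L2// subr_ge0.
Qed.

Let mD s t : 0 <= s -> 0 <= t -> m (s + t) = m s + m t.
Proof.
move=> s0 t0; have st0 : 0 <= s + t by rewrite addr_ge0.
have sst : s <= s + t by rewrite lerDl.
apply: EFin_inj; rewrite EFinD -!mE//.
have -> : (\int[P]_w (X t w)%:E = \int[P]_w (X (s + t) w - X s w)%:E)%E.
  by rewrite levy_increment_expectation// addrAC subrr add0r.
rewrite -integralD//.
- by apply: eq_integral => w _; rewrite -EFinD; congr EFin; ring.
- by apply: L2_integrable; [exact: levy_measurable | exact: levy_L2].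
- apply: L2_integrable; first exact: levy_increment_measurable.
  by rewrite levy_increment_sqint// levy_L2// subr_ge0.
Qed.

(** The increments over $[0, s]$ and $[s, s + t]$ are independent, so the second
    moment of their sum has the cross term $2 E[X(s)] E[X(t)]$. *)
Let qD s t : 0 <= s -> 0 <= t -> q (s + t) = q s + q t + 2 * (m s * m t).
Proof.
move=> s0 t0; have st0 : 0 <= s + t by rewrite addr_ge0.
have sst : s <= s + t by rewrite lerDl.
have sts : s + t - s = t by rewrite addrAC subrr add0r.
apply: EFin_inj; rewrite !EFinD EFinM -!qE// EFinM -!mE//.
have -> : sqint P (X (s + t)) = sqint P ((fun w => X s w - X 0 w) \+ (fun w => X (s + t) w - X s w)).
  rewrite -[in LHS](subr0 (s + t)) -levy_increment_sqint//.
  by congr sqint; apply/funext => w /=; ring.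
have mU : measurable_fun setT (fun w => X s w - X 0 w) by exact: levy_increment_measurable.
have mV : measurable_fun setT (fun w => X (s + t) w - X s w) by exact: levy_increment_measurable.
have fU : (sqint P (fun w => X s w - X 0%R w)%R < +oo)%E by rewrite levy_increment_sqint// subr0 levy_L2.
have fV : (sqint P (fun w => X (s + t)%R w - X s w)%R < +oo)%E by rewrite levy_increment_sqint// sts levy_L2.
rewrite sqintD_exact// independent_expectation_mul//; last exact: levy_increments_independent.
by rewrite !levy_increment_sqint// !levy_increment_expectation// subr0 sts.
Qed.

Let v t := q t - m t ^+ 2.

Let vD s t : 0 <= s -> 0 <= t -> v (s + t) = v s + v t.
Proof. by move=> s0 t0; rewrite /v qD// mD//; ring. Qed.

Let vE t : 0 <= t -> sqint P (X t \- cst (m t)) = (v t)%:E.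
Proof.
move=> t0; have mX := levy_measurable t0.
have := @sqintD_exact _ _ _ P (X t) (cst (- m t)) mX (measurable_cst _) (levy_L2 t0).
rewrite sqint_cst ltry => /(_ isT) => ->.
rewrite qE//; under eq_integral do rewrite mulrC EFinM.
rewrite integralZl//; last by apply: L2_integrable => //; exact: levy_L2.
by rewrite mE// -!EFinM -!EFinD /v; congr EFin; ring.
Qed.

Let v_ge0 t : 0 <= t -> 0 <= v t.
Proof. by move=> t0; rewrite -lee_fin -vE// sqint_ge0. Qed.

Let v_le1 t : 0 <= t -> t <= 1 -> v t <= v 1.
Proof.
move=> t0 t1; have t10 : 0 <= 1 - t by rewrite subr_ge0.
have -> : v 1 = v t + v (1 - t) by rewrite -vD// addrC subrK.
by rewrite lerDl v_ge0.
Qed.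

(** Chebyshev puts $X(s)$ within a fixed distance of its mean and stochastic
    continuity puts it within distance 1 of 0, each with probability at least
    3/4; hence the mean is bounded near the origin. *)
Let m_bounded : exists2 M, 0 <= M & forall t, 0 <= t <= 1 -> `|m t| <= M.
Proof.
pose M := 2 * (v 1 + 1); have v1 := v_ge0 ler01.
have M0 : 0 < M by rewrite mulr_gt0// ltr_wpDl.
have [d d0 near0] : exists2 d, 0 < d & forall s, 0 <= s -> s <= 1 -> s < d -> `|m s| <= 1 + M.
  case: X_levy => -[_ X0 _ _ scX] _.
  have := scX 0 1 (lexx _) ltr01.
  move/fine_cvgP => [finX].
  move/cvgrPdist_lt => /(_ 4^-1); rewrite invr_gt0 ltr0n => /(_ isT).
  move=> H; have [d /= d0 dH] := filterI finX H.
  exists d => // s s0 s1 sd.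
  have sball : `|0 - s| < d by rewrite sub0r normrN ger0_norm.
  have [fs] := dH s sball s0.
  rewrite /= sub0r normrN ger0_norm ?fine_ge0// => Ps.
  have mXs0 := levy_increment_measurable (lexx 0) s0.
  have mXs := levy_measurable s0.
  have mA : measurable [set w | 1 < `|X s w - X 0 w|].
    rewrite (_ : mkset _ = ~` [set w | `|X s w - X 0 w| <= 1]); last first.
      by apply/seteqP; split => w /=; [rewrite ltNge => /negP | move/negP; rewrite -ltNge].
    apply: measurableC; rewrite -[X in measurable X]setTI.
    by apply: (@measurable_fun_le _ _ R setT _ (cst 1)) => //; exact: measurableT_comp.
  have mXm : measurable_fun setT (X s \- cst (m s)) by exact: measurable_funB.
  have mB : measurable [set w | M <= `|X s w - m s|].
    rewrite -[X in measurable X]setTI.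
    by apply: (@measurable_fun_le _ _ R setT (cst M)) => //; exact: measurableT_comp.
  have PB : (P [set w | (M <= `|X s w - m s|)%R] <= (4^-1)%:E)%E.
    apply: (le_trans (sqint_chebyshev P mXm M0)); rewrite vE// -EFinM lee_fin.
    rewrite (@le_trans _ _ (M ^- 2 * v 1))//.
      by rewrite ler_wpM2l ?v_le1// invr_ge0 exprn_ge0// ltW.
    rewrite mulrC ler_pdivrMr ?exprn_gt0// /M; nra.
  have PA : (P [set w | (1 < `|X s w - X 0 w|)%R] <= (4^-1)%:E)%E.
    by rewrite -(fineK fs) lee_fin ltW.
  have : (P ([set w | (1 < `|X s w - X 0 w|)%R] `|` [set w | (M <= `|X s w - m s|)%R]) < 1)%E.
    apply: le_lt_trans (measureU2 _ mA mB) _; apply: le_lt_trans (leeD PA PB) _.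
    by rewrite -EFinD lte_fin; lra.
  move=> PAB; rewrite leNgt; apply/negP => mM.
  have aeT : {ae P, forall w, w \in ([set w | (1 < `|X s w - X 0 w|)%R] `|` [set w | (M <= `|X s w - m s|)%R])}.
    apply: filterS X0 => w X0w; apply/mem_set => /=.
    rewrite X0w subr0; have [Xw|Xw] := ltP 1 (`|X s w|); [by left|right].
    rewrite leNgt; apply/negP => XM; move: mM; rewrite ltNge => /negP; apply.
    rewrite (_ : m s = X s w - (X s w - m s)); last by ring.
    by rewrite (le_trans (ler_normB _ _))// lerD// ltW.
  move: PAB; rewrite ltNge => /negP; apply.
  have mAB := measurableU _ _ mA mB.
  have /(negligibleP _ (measurableC mAB)) PC0 : P.-negligible
      (~` ([set w | (1 < `|X s w - X 0 w|)%R] `|` [set w | (M <= `|X s w - m s|)%R])).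
    by apply: negligibleS aeT => w /= nw /set_mem.
  have := probability_setC P mAB; rewrite [LHS]PC0.
  by move/eqP; rewrite eq_sym sube_eq// ?add0e => /eqP <-.
have [K Kd] : exists K : nat, K.+1%:R^-1 < d.
  exists (Num.truncn d^-1); rewrite invf_plt ?posrE//; exact: truncnS_gt.
exists (K.+1%:R * (1 + M)); first by rewrite mulr_ge0// addr_ge0// ltW.
move=> t /andP[t0 t1].
have tK : 0 <= t / K.+1%:R by rewrite divr_ge0.
rewrite (_ : t = K.+1%:R * (t / K.+1%:R)); last by rewrite mulrC divfK.
rewrite (additive_natmul mD)// normrM normr_nat ler_wpM2l// near0//.
  by rewrite ler_pdivrMr// mul1r (le_trans t1)// ler1n.
by apply: le_lt_trans Kd; rewrite ler_pdivrMr// mulVf.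
Qed.

(** The mean and the variance are additive in time and bounded on $[0, 1]$: the
    mean by [m_bounded], the variance because it is nonnegative, hence monotone.
    Bounded additive functions are linear. *)
Lemma levy_moments t : 0 <= t -> (\int[P]_w (X 1 w)%:E = 0)%E ->
  (\int[P]_w (X t w)%:E = 0)%E /\ sqint P (X t) = (t%:E * sqint P (X 1))%E.
Proof.
move=> t0 m1; have [M M0 mM] := m_bounded.
have m10 : m 1 = 0 by rewrite /m m1.
have mt0 : m t = 0 by rewrite (additive_bounded_linear mD mM t0) m10 mulr0.
have v_bounded r : 0 <= r <= 1 -> `|v r| <= v 1.
  by move=> /andP[r0 r1]; rewrite ger0_norm ?v_ge0 ?v_le1.
have := additive_bounded_linear vD v_bounded t0.
rewrite /v mt0 m10 expr0n subr0 subr0 => qt.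
by rewrite mE// mt0 qE// qE// -EFinM qt.
Qed.

End OneSidedLevyMoments.

(** * Increments of two-sided Levy processes *)

Section TwoSided.
Context {disp : measure_display} {T : measurableType disp} {R : realType}.
Variable P : probability T R.

Lemma sqint_ae (f g : T -> R) : measurable_fun setT f -> measurable_fun setT g ->
  {ae P, forall w, f w = g w} -> sqint P f = sqint P g.
Proof.
move=> mf mg fg; apply: ge0_ae_eq_integral => //.
- exact: measurable_sq.
- exact: measurable_sq.
- by move=> x _; rewrite lee_fin sqr_ge0.
- by move=> x _; rewrite lee_fin sqr_ge0.
- by apply: filterS fg => x -> _.
Qed.

(** Events of [sigma_of] are produced with measurability lemmas for the type whose
    measurable sets are this generated $\sigma$-algebra. *)
Lemma sigma_of_measurable (D : set R) (X : R -> T -> R) t : D t ->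
  measurable_fun (setT : set (g_sigma_algebraType
    [set A | exists t B, [/\ D t, measurable B & A = X t @^-1` B]])) (X t).
Proof.
move=> Dt _ B mB; rewrite setTI; apply: sub_sigma_algebra.
by exists t, B.
Qed.

Variable L : R -> T -> R.
Variables X1 X2 : R -> T -> R.
Hypotheses (X1_levy : levy_process P X1) (X2_levy : levy_process P X2).
Hypothesis X12_ind : independent_processes P [set t | 0 <= t] X1 X2.
Hypothesis X12_law : same_law P [set t | 0 <= t] X1 X2.
Hypothesis LE : forall t w, L t w = (if 0 <= t then X1 t w else 0) -
                          (if t <= 0 then X2 (- t) w else 0).
Hypothesis L1_L2 : (sqint P (L 1) < +oo)%E.
Hypothesis L1_mean : (\int[P]_w (L 1 w)%:E = 0)%E.

Lemma two_sided_measurable t : measurable_fun setT (L t).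
Proof.
rewrite (_ : L t = (fun w => if 0 <= t then X1 t w else 0) \-
   (fun w => if t <= 0 then X2 (- t) w else 0)); last by apply/funext => w; rewrite LE.
apply: measurable_funB.
- by have [t0|_] := boolP (0 <= t); [exact: (levy_measurable X1_levy) | exact: measurable_cst].
- have [t0|_] := boolP (t <= 0); last exact: measurable_cst.
  by apply: (levy_measurable X2_levy); rewrite oppr_ge0.
Qed.

Lemma two_sided_X1 w : L 1 w = X1 1 w.
Proof. by rewrite LE ler01 (lt_geF ltr01) subr0. Qed.

Let L1E : L 1 = X1 1. Proof. by apply/funext => w; exact: two_sided_X1. Qed.

Lemma same_law_marginal t B : 0 <= t -> measurable B ->
  P (X1 t @^-1` B) = P (X2 t @^-1` B).
Proof.
move=> t0 mB.
have mA : measurable [set x : 1.-tuple R | B (tnth x ord0)].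
  by have := @measurable_tnth _ R 1 ord0 measurableT B mB; rewrite setTI.
have E Y : P (Y t @^-1` B) = fdd P Y [tuple t] [set x : 1.-tuple R | B (tnth x ord0)].
  by rewrite /fdd /pushforward; congr (P _); apply/seteqP; split => w /=; rewrite tnth_mktuple.
by rewrite !E; apply: X12_law => // i; rewrite (ord1 i).
Qed.

Let s2 := fine (sqint P (L 1)).
Let s2E : sqint P (L 1) = s2%:E. Proof. by rewrite fineK// sqint_fin. Qed.

Lemma X1_moments t : 0 <= t ->
  (\int[P]_w (X1 t w)%:E = 0)%E /\ sqint P (X1 t) = (t * s2)%:E.
Proof.
move=> t0; have := levy_moments X1_levy _ t0.
by rewrite -L1E => /(_ L1_L2 L1_mean); rewrite s2E EFinM.
Qed.

Lemma X2_moments t : 0 <= t ->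
  (\int[P]_w (X2 t w)%:E = 0)%E /\ sqint P (X2 t) = (t * s2)%:E.
Proof.
move=> t0; have m1 := levy_measurable X1_levy ler01.
have m2 := levy_measurable X2_levy ler01.
have law1 B : measurable B -> P (X1 1 @^-1` B) = P (X2 1 @^-1` B) by exact: same_law_marginal.
have E1 := eq_law_sqint m1 m2 law1; rewrite -L1E in E1.
have E2 := eq_law_expectation m1 m2 law1; rewrite -L1E in E2.
have := levy_moments X2_levy _ t0.
by rewrite -E1 -E2// => /(_ L1_L2 L1_mean); rewrite s2E EFinM.
Qed.

(** Since $X_1(0) = X_2(0) = 0$ almost surely, one formula covers both signs of
    the time. *)
Lemma two_sided_ae : {ae P, forall w, forall t,
  L t w = X1 (Num.max t 0) w - X2 (Num.max (- t) 0) w}.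
Proof.
case: X1_levy => -[_ X10 _ _ _] _; case: X2_levy => -[_ X20 _ _ _] _.
apply: filterS2 X10 X20 => w w1 w2 t; rewrite LE.
have [t0|t0|<-] := ltgtP 0 t.
- by rewrite (_ : Num.max _ _ = 0) ?w2// max_r// oppr_le0 ltW.
- by rewrite w1 max_l// oppr_ge0 ltW.
- by rewrite oppr0 maxxx.
Qed.

Let maxD (s t : R) : s <= t -> (Num.max t 0 - Num.max s 0) + (Num.max (- s) 0 - Num.max (- t) 0) = t - s.
Proof. by move=> st; do !case: (leP _ 0) => ?; lra. Qed.

(** An increment of $L$ is the sum of an increment of $X_1$ over the part of the
    interval on the right of 0 and one of $X_2$ over the part on the left; these
    are independent and centered, so their variances add. *)
Lemma two_sided_increment_sqint s t :
  sqint P (L t \- L s) = (`|t - s| * s2)%:E.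
Proof.
wlog st : s t / s <= t.
  move=> H; have [st|/ltW ts] := leP s t; first exact: H.
  by rewrite sqintBC H// distrC.
have m0 x : 0 <= Num.max x 0 :> R by rewrite le_max lexx orbT.
have st1 : Num.max s 0 <= Num.max t 0 by do !case: (leP _ 0) => ?; lra.
have st2 : Num.max (- t) 0 <= Num.max (- s) 0 by do !case: (leP _ 0) => ?; lra.
pose U w := X1 (Num.max t 0) w - X1 (Num.max s 0) w.
pose V w := X2 (Num.max (- s) 0) w - X2 (Num.max (- t) 0) w.
have mU : measurable_fun setT U by exact: (levy_increment_measurable X1_levy).
have mV : measurable_fun setT V by exact: (levy_increment_measurable X2_levy).
have UV : independent_pair P U V.
  move=> A B mA mB; apply: X12_ind.
  - have := measurable_funB (@sigma_of_measurable [set t | 0 <= t] X1 _ (m0 t))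
      (@sigma_of_measurable [set t | 0 <= t] X1 _ (m0 s)).
    by move=> /(_ measurableT A mA); rewrite setTI.
  - have := measurable_funB (@sigma_of_measurable [set t | 0 <= t] X2 _ (m0 (- s)))
      (@sigma_of_measurable [set t | 0 <= t] X2 _ (m0 (- t))).
    by move=> /(_ measurableT B mB); rewrite setTI.
have [d1 d2] : 0 <= Num.max t 0 - Num.max s 0 /\ 0 <= Num.max (- s) 0 - Num.max (- t) 0.
  by rewrite !subr_ge0.
have X1_L2 : (sqint P (X1 1) < +oo)%E by rewrite -L1E.
have X2_L2 : (sqint P (X2 1) < +oo)%E by rewrite (X2_moments ler01).2 ltry.
have sU : sqint P U = ((Num.max t 0 - Num.max s 0) * s2)%:E.
  by rewrite (levy_increment_sqint X1_levy)// (X1_moments d1).2.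
have sV : sqint P V = ((Num.max (- s) 0 - Num.max (- t) 0) * s2)%:E.
  by rewrite (levy_increment_sqint X2_levy)// (X2_moments d2).2.
have EU : (\int[P]_w (U w)%:E = 0)%E.
  by rewrite (levy_increment_expectation X1_levy)// (X1_moments d1).1.
rewrite (@sqint_ae _ (U \+ V)).
- rewrite sqintD_exact ?sU ?sV ?ltry// independent_expectation_mul ?sU ?sV ?ltry//.
  by rewrite EU mul0e mule0 adde0 -EFinD -mulrDl maxD// ger0_norm// subr_ge0.
- by apply: measurable_funB; exact: two_sided_measurable.
- exact: measurable_funD.
- by apply: filterS two_sided_ae => w Lw /=; rewrite !Lw /U /V; lra.
Qed.

End TwoSided.

(** * The isometry and the integral with respect to a Levy process *)

(** The combination of distances that polarization produces from the variances of
    increments is the length of the intersection of the two intervals. *)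
Lemma overlap_length {R : realFieldType} (s t u v : R) : s <= t -> u <= v ->
  Num.max 0 (Num.min t v - Num.max s u) =
  2^-1 * (`|t - u| + `|s - v| - (`|t - v| + `|s - u|)).
Proof.
move=> st uv; have [tu|ut] := ltP t u.
  rewrite (min_l (x := t)) ?(max_r (x := s)) ?(max_l (x := 0)); try lra.
  rewrite (ltr0_norm (x := t - u)) 1?(ler0_norm (x := s - v)) 1?(ler0_norm (x := t - v)) 1?(ler0_norm (x := s - u)); lra.
have [vs|sv] := ltP v s.
  rewrite (min_r (x := t)) ?(max_l (x := s)) ?(max_l (x := 0)); try lra.
  rewrite (ger0_norm (x := t - u)) 1?(ger0_norm (x := s - v)) 1?(ger0_norm (x := t - v)) 1?(ger0_norm (x := s - u)); lra.
rewrite (ger0_norm (x := t - u)) 1?(ler0_norm (x := s - v)); [|lra|lra].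
rewrite max_r.
  have [tv|vt] := leP t v; have [su|us] := leP s u.
  - by rewrite (ler0_norm (x := t - v)) 1?(ler0_norm (x := s - u)); lra.
  - by rewrite (ler0_norm (x := t - v)) 1?(ger0_norm (x := s - u)); lra.
  - by rewrite (ger0_norm (x := t - v)) 1?(ler0_norm (x := s - u)); lra.
  - by rewrite (ger0_norm (x := t - v)) 1?(ger0_norm (x := s - u)); lra.
by rewrite subr_ge0 le_min !ge_max st sv ut uv.
Qed.

Section Isometry.
Context {disp : measure_display} {T : measurableType disp} {R : realType}.
Variables (P : probability T R) (L : R -> T -> R) (s2 : R).
Local Notation leb := (@lebesgue_measure R).
Hypothesis mL : forall t, measurable_fun setT (L t).
Hypothesis L_increment : forall s t, sqint P (L t \- L s)%R = (`|t - s| * s2)%:E.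

(** The identity of inner products, packed with the integrability that makes it
    stable under linear combinations. *)
Definition isometric (U : T -> R) (f : R -> R) (V : T -> R) (g : R -> R) : Prop :=
  [/\ P.-integrable setT (fun w => (U w * V w)%:E),
      leb.-integrable setT (fun x => (f x * g x)%:E) &
      (\int[P]_w (U w * V w)%:E = s2%:E * \int[leb]_x (f x * g x)%:E)%E].

Lemma isometric_sym U f V g : isometric U f V g -> isometric V g U f.
Proof.
have cT : (fun w => (V w * U w)%:E) = (fun w => (U w * V w)%:E).
  by apply/funext => w; rewrite mulrC.
have cR : (fun x => (g x * f x)%:E) = (fun x => (f x * g x)%:E).
  by apply/funext => x; rewrite mulrC.
by rewrite /isometric cT cR.
Qed.

Lemma isometric0 V g : isometric (cst 0) (cst 0) V g.
Proof.
split.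
- by under eq_fun do rewrite mul0r; exact: integrable0.
- by under eq_fun do rewrite mul0r; exact: integrable0.
- under eq_integral do rewrite mul0r; rewrite integral0.
  by under eq_integral do rewrite mul0r; rewrite integral0 mule0.
Qed.

Lemma isometric_linear a U f U' f' V g : isometric U f V g ->
  isometric U' f' V g ->
  isometric (fun w => a * U w + U' w) (fun x => a * f x + f' x) V g.
Proof.
move=> [i1 i2 E] [i1' i2' E'].
have eT : (fun w => ((a * U w + U' w) * V w)%:E) =
    (fun w => a%:E * (U w * V w)%:E + (U' w * V w)%:E)%E.
  by apply/funext => w /=; congr EFin; ring.
have eR : (fun w => ((a * f w + f' w) * g w)%:E) =
    (fun w => a%:E * (f w * g w)%:E + (f' w * g w)%:E)%E.
  by apply/funext => w /=; congr EFin; ring.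
rewrite /isometric eT eR; split.
- by apply: integrableD => //; exact: integrableZl.
- by apply: integrableD => //; exact: integrableZl.
- rewrite !integralD//; try exact: integrableZl.
  rewrite !integralZl// E E'.
  rewrite -(fineK (integrable_fin_num measurableT i2)) -(fineK (integrable_fin_num measurableT i2')).
  by rewrite -!EFinM -EFinD; congr EFin; ring.
Qed.

Let mB s t : measurable_fun setT (L t \- L s).
Proof. exact: measurable_funB. Qed.

Let fB s t : (sqint P (L t \- L s)%R < +oo)%E.
Proof. by rewrite L_increment ltry. Qed.

(** Polarization: $2(L_t-L_s)(L_v-L_u) = (L_t-L_u)^2+(L_s-L_v)^2-(L_t-L_v)^2-(L_s-L_u)^2$. *)
Lemma isometric_increment s t u v : s <= t -> u <= v ->
  isometric (L t \- L s) \1_(`]s, t]) (L v \- L u) \1_(`]u, v]).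
Proof.
move=> st uv.
have indE : (fun x => (\1_(`]s, t]) x * \1_(`]u, v]) x)%:E) =
    (EFin \o \1_[set` `]Num.max s u, Num.min t v]]) :> (R -> \bar R).
  apply/funext => x /=; congr EFin; rewrite !indicE -natrM mulnb; congr (nat_of_bool _)%:R.
  by rewrite !mem_setE/= !in_itv /= gt_max le_min; case: (s < x); case: (x <= t); case: (u < x); case: (x <= v).
split.
- exact: mul_integrable.
- by rewrite indE; exact: integrable_indic_itv.
rewrite indE integral_indic// setIT /= lebesgue_measure_itv/= lte_fin.
have E : (\int[P]_w (2 * ((L t w - L s w) * (L v w - L u w)))%:E =
  sqint P (L t \- L u)%R + sqint P (L s \- L v)%R - (sqint P (L t \- L v)%R + sqint P (L s \- L u)%R))%E.
  have i2 a b := sqint_integrable (mB a b) (fB a b).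
  rewrite /sqint -!integralD// -integralB//; try exact: integrableD.
  by apply: eq_integral => w _ /=; congr EFin; ring.
have iUV := mul_integrable (mB s t) (mB u v) (fB s t) (fB u v).
have E2 : (\int[P]_w (2 * ((L t w - L s w) * (L v w - L u w)))%:E =
    2%:E * \int[P]_w ((L t w - L s w) * (L v w - L u w))%:E)%E.
  by rewrite -integralZl.
have fin := integrable_fin_num measurableT iUV.
rewrite -[LHS](fineK fin); move: E; rewrite E2 -[X in (2%:E * X)%E](fineK fin).
move: (fine _) => I {fin E2}; rewrite !L_increment => E.
have {}E : 2 * I = `|t - u| * s2 + `|s - v| * s2 - (`|t - v| * s2 + `|s - u| * s2).
  exact: EFin_inj.
have -> : I = s2 * Num.max 0 (Num.min t v - Num.max s u).
  by rewrite overlap_length//; lra.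
rewrite EFinM; congr (_ * _)%E.
have [mM|Mm] := ltP (Num.max s u) (Num.min t v).
  by rewrite max_r// subr_ge0 ltW.
by rewrite max_l// subr_le0.
Qed.

Lemma step_int_nil : step_int L [::] = cst 0.
Proof. by apply/funext => x; rewrite /step_int big_nil. Qed.

Lemma step_fun_nil : step_fun [::] = cst 0 :> (R -> R).
Proof. by apply/funext => x; rewrite /step_fun big_nil. Qed.

Lemma isometric_step q q' : step_wf q -> step_wf q' ->
  isometric (step_int L q) (step_fun q) (step_int L q') (step_fun q').
Proof.
elim: q => [|[[a s] t] q IH]; rewrite /step_wf /=.
  by rewrite step_int_nil step_fun_nil => _ _; exact: isometric0.
move=> /andP[st wq] wq'.
have -> : step_int L ((a, s, t) :: q) = (fun w => a * (L t \- L s) w + step_int L q w).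
  by apply/funext => x; rewrite /step_int big_cons.
have -> : step_fun ((a, s, t) :: q) = (fun w => a * \1_(`]s, t]) w + step_fun q w).
  by apply/funext => x; rewrite /step_fun big_cons.
apply: isometric_linear; last exact: IH.
elim: q' wq' {IH} => [|[[b u] v] q' IH]; rewrite /step_wf /=.
  by rewrite step_int_nil step_fun_nil => _; apply: isometric_sym; exact: isometric0.
move=> /andP[uv wq']; apply: isometric_sym.
have -> : step_int L ((b, u, v) :: q') = (fun w => b * (L v \- L u) w + step_int L q' w).
  by apply/funext => x; rewrite /step_int big_cons.
have -> : step_fun ((b, u, v) :: q') = (fun w => b * \1_(`]u, v]) w + step_fun q' w).
  by apply/funext => x; rewrite /step_fun big_cons.
apply: isometric_linear; last by apply: isometric_sym; exact: IH.
by apply: isometric_increment.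
Qed.

Lemma step_isometry q : step_wf q ->
  sqint P (step_int L q) = (s2%:E * sqint leb (step_fun q))%E.
Proof. by move=> wq; case: (isometric_step wq wq) => _ _; apply. Qed.

End Isometry.

Section LevyIntegral.
Context {disp : measure_display} {T : measurableType disp} {R : realType}.
Variables (P : probability T R) (L : R -> T -> R) (s2 : R).
Local Notation leb := (@lebesgue_measure R).
Hypothesis mL : forall t, measurable_fun setT (L t).
Hypothesis L_increment : forall s t, sqint P (L t \- L s)%R = (`|t - s| * s2)%:E.
Hypothesis s2_ge0 : 0 <= s2.

Let scale (c : R) (p : R * R * R) := let: (a, s, t) := p in (c * a, s, t).

Lemma step_wf_scale c (q : seq (R * R * R)) : step_wf (map (scale c) q) = step_wf q.
Proof. by rewrite /step_wf all_map; apply: eq_all => -[[a s] t]. Qed.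

Lemma step_wf_cat (q q0 : seq (R * R * R)) : step_wf (q ++ q0) = step_wf q && step_wf q0.
Proof. exact: all_cat. Qed.

Lemma step_fun_linear c q q' :
  step_fun (q ++ map (scale c) q') = (fun x => step_fun q x + c * step_fun q' x).
Proof.
apply/funext => x; rewrite /step_fun big_cat big_map; congr (_ + _).
by rewrite mulr_sumr; apply: eq_bigr => -[[a s] t] _ /=; rewrite mulrA.
Qed.

Lemma step_int_linear c q q' :
  step_int L (q ++ map (scale c) q') = (fun x => step_int L q x + c * step_int L q' x).
Proof.
apply/funext => x; rewrite /step_int big_cat big_map; congr (_ + _).
by rewrite mulr_sumr; apply: eq_bigr => -[[a s] t] _ /=; rewrite mulrA.
Qed.

Lemma measurable_step_fun q : measurable_fun setT (step_fun q : R -> R).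
Proof.
apply: measurable_sum => -[[a s] t]; apply: measurable_funM => //.
Qed.

Lemma measurable_step_int q : measurable_fun setT (step_int L q).
Proof.
apply: measurable_sum => -[[a s] t]; apply: measurable_funM => //.
exact: measurable_funB.
Qed.

Lemma step_fun_L2 q : step_wf q -> (sqint leb (step_fun q) < +oo)%E.
Proof.
move=> wq; have [_ i _] := isometric_step mL L_increment wq wq.
exact: (integrable_lty measurableT i).
Qed.

Lemma step_int_L2 q : step_wf q -> (sqint P (step_int L q) < +oo)%E.
Proof.
move=> wq; have [i _ _] := isometric_step mL L_increment wq wq.
exact: (integrable_lty measurableT i).
Qed.

Lemma is_levy_intE f Y : is_levy_int P L f Y <-> measurable_fun setT Y /\
  exists q : nat -> seq (R * R * R), [/\ forall n, step_wf (q n),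
    (sqint leb (step_fun (q n) \- f)%R @[n --> \oo] --> 0)%E &
    (sqint P (step_int L (q n) \- Y)%R @[n --> \oo] --> 0)%E].
Proof.
by split=> -[mY [q [wq cf cY]]]; split => //; exists q; split => //; apply/Lnorm2_cvg0.
Qed.

Lemma levy_int_step q : step_wf q -> is_levy_int P L (step_fun q) (step_int L q).
Proof.
move=> wq; apply/is_levy_intE; split; first exact: measurable_step_int.
exists (fun=> q); split => //.
- by under eq_fun do rewrite sqint_subrr; exact: cvg_cst.
- by under eq_fun do rewrite sqint_subrr; exact: cvg_cst.
Qed.

Lemma cvg_sqint_linear d' (S : measurableType d') (mu : {measure set S -> \bar R}) c
    (F G : nat -> S -> R) (f g : S -> R) :
  (forall n, measurable_fun setT (F n)) -> (forall n, measurable_fun setT (G n)) ->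
  measurable_fun setT f -> measurable_fun setT g ->
  (sqint mu (F n \- f)%R @[n --> \oo] --> 0)%E ->
  (sqint mu (G n \- g)%R @[n --> \oo] --> 0)%E ->
  (sqint mu ((fun x => F n x + c * G n x) \- (fun x => f x + c * g x))%R @[n --> \oo] --> 0)%E.
Proof.
move=> mF mG mf mg cF cG.
have mFf n : measurable_fun setT (F n \- f) by exact: measurable_funB.
have mGg n : measurable_fun setT (G n \- g) by exact: measurable_funB.
apply: (@squeeze_cvge _ _ _ _ (cst 0%E) _
  (fun n => 2%:E * sqint mu (F n \- f)%R + (2 * c ^+ 2)%:E * sqint mu (G n \- g)%R)%E).
- apply: nearW => n; rewrite sqint_ge0 /=; apply: sqint_weighted => //.
  + by rewrite mulr_ge0// sqr_ge0.
  + by apply: measurable_funB; apply: measurable_funD => //; exact: measurable_funM.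
  + move=> x /=; have := sqr_ge0 ((F n x - f x) - c * (G n x - g x)); nra.
- exact: cvg_cst.
- have c1 : (2%:E * sqint mu (F n \- f)%R @[n --> \oo] --> 0)%E.
    by rewrite -(mule0 2%:E); exact: cvgeZl.
  have c2 : ((2 * c ^+ 2)%:E * sqint mu (G n \- g)%R @[n --> \oo] --> 0)%E.
    by rewrite -(mule0 (2 * c ^+ 2)%:E); exact: cvgeZl.
  by rewrite -(adde0 0%E); exact: cvgeD.
Qed.

Lemma is_levy_int_linear c f Y g Z : measurable_fun setT f -> measurable_fun setT g ->
  is_levy_int P L f Y -> is_levy_int P L g Z ->
  is_levy_int P L (fun x => f x + c * g x) (fun w => Y w + c * Z w).
Proof.
move=> mf mg /is_levy_intE [mY [q [wq qf qY]]] /is_levy_intE [mZ [r [wr rg rZ]]].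
apply/is_levy_intE; split.
  by apply: measurable_funD => //; exact: measurable_funM.
exists (fun n => q n ++ map (scale c) (r n)); split.
- by move=> n; rewrite step_wf_cat step_wf_scale wq wr.
- under eq_fun do rewrite step_fun_linear.
  by apply: cvg_sqint_linear => // n; exact: measurable_step_fun.
- under eq_fun do rewrite step_int_linear.
  by apply: cvg_sqint_linear => // n; exact: measurable_step_int.
Qed.

Lemma sqint_limit_lty d' (S : measurableType d') (mu : {measure set S -> \bar R})
    (F : nat -> S -> R) (f : S -> R) :
  (forall n, measurable_fun setT (F n)) -> measurable_fun setT f ->
  (forall n, (sqint mu (F n) < +oo)%E) ->
  (sqint mu (F n \- f)%R @[n --> \oo] --> 0)%E -> (sqint mu f < +oo)%E.
Proof.
move=> mF mf fF /ge0_cvge0P; move=> /(_ (fun n => sqint_ge0 _ _)) /(_ 1 ltr01) [N _ HN].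
rewrite (_ : f = F N \- (F N \- f)); last by apply/funext => x /=; rewrite opprB addrC subrK.
apply: sqintB_lty => //; first exact: measurable_funB.
by rewrite (lt_trans (HN N _))// ?ltry//=.
Qed.

Lemma is_levy_int_fun_L2 f Y : measurable_fun setT f -> is_levy_int P L f Y ->
  (sqint leb f < +oo)%E.
Proof.
move=> mf /is_levy_intE [mY [q [wq qf qY]]].
exact: (@sqint_limit_lty _ _ leb _ f (fun n => measurable_step_fun (q n)) mf
  (fun n => step_fun_L2 (wq n)) qf).
Qed.

Lemma is_levy_int_L2 f Y : is_levy_int P L f Y -> (sqint P Y < +oo)%E.
Proof.
move=> /is_levy_intE [mY [q [wq qf qY]]].
exact: (@sqint_limit_lty _ _ P _ Y (fun n => measurable_step_int (q n)) mY
  (fun n => step_int_L2 (wq n)) qY).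
Qed.

Lemma levy_int_isometry f Y : measurable_fun setT f -> is_levy_int P L f Y ->
  sqint P Y = (s2%:E * sqint leb f)%E.
Proof.
move=> mf fY; have f2 := is_levy_int_fun_L2 mf fY; have Y2 := is_levy_int_L2 fY.
move/is_levy_intE : fY => [mY [q [wq qf qY]]].
have c1 := @sqint_cvg _ _ _ leb _ _ (fun n => measurable_step_fun (q n)) mf f2 qf.
have c2 := sqint_cvg (fun n => measurable_step_int (q n)) mY Y2 qY.
apply/esym; apply: cvg_unique c2 => //.
rewrite (_ : (fun n => _) = (fun n => s2%:E * sqint leb (step_fun (q n)))%E); last first.
  by apply/funext => n; rewrite (step_isometry mL L_increment).
exact: cvgeZl.
Qed.

(** The isometry, applied to the difference of $f$ and a step function, transfers
    convergence from the integrands to the integrals. *)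
Lemma is_levy_int_cvg f Y q : measurable_fun setT f -> is_levy_int P L f Y ->
  (forall n, step_wf (q n)) ->
  (sqint leb (step_fun (q n) \- f)%R @[n --> \oo] --> 0)%E ->
  (sqint P (step_int L (q n) \- Y)%R @[n --> \oo] --> 0)%E.
Proof.
move=> mf fY wq qf.
rewrite (_ : (fun n => _) = (fun n => s2%:E * sqint leb (step_fun (q n) \- f)%R)%E).
  by rewrite -(mule0 s2%:E); exact: cvgeZl.
apply/funext => n.
have := is_levy_int_linear (-1) (measurable_step_fun (q n)) mf (levy_int_step (wq n)) fY.
move/levy_int_isometry => /(_ _).
rewrite (_ : (fun x => _ + _) = step_fun (q n) \- f); last by apply/funext => x /=; rewrite mulN1r.
rewrite (_ : (fun x => _ + _) = step_int L (q n) \- Y); last by apply/funext => x /=; rewrite mulN1r.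
by apply; apply: measurable_funB => //; exact: measurable_step_fun.
Qed.

(** A subsequence along which the step functions converge geometrically fast has
    integrals to which [fast_cauchy_complete] applies. *)
Lemma is_levy_int_exists f q : measurable_fun setT f ->
  (forall n, step_wf (q n)) ->
  (sqint leb (step_fun (q n) \- f)%R @[n --> \oo] --> 0)%E ->
  exists Y, is_levy_int P L f Y.
Proof.
move=> mf wq qf.
(* The divisor compensates the factor s2 of the isometry and the constants of the
   triangle inequality, so that the increments of the integrals are below 4^-j. *)
pose e (j : nat) : R := 4^-1 ^+ j / (4 * (s2 + 1)).
have s21 : 0 < s2 + 1 by rewrite ltr_wpDl.
have e0 j : 0 < e j by rewrite divr_gt0 ?mulr_gt0// exprn_gt0// invr_gt0.
have close j : exists n, (sqint leb (step_fun (q n) \- f)%R < (e j)%:E)%E.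
  move/ge0_cvge0P : qf => /(_ (fun n => sqint_ge0 _ _)) /(_ _ (e0 j)) [N _ HN].
  by exists N; apply: HN => /=.
have [k kP] := choice close.
have k_cvg : (sqint leb (step_fun (q (k j)) \- f)%R @[j --> \oo] --> 0)%E.
  apply: (@squeeze_cvge _ _ _ _ (cst 0%E) _ (fun n => (e n)%:E)).
  - by apply: nearW => n; rewrite sqint_ge0 ltW.
  - exact: cvg_cst.
  - apply: cvg_EFin; first exact: nearW.
    rewrite -(mul0r (4 * (s2 + 1))^-1); apply: cvgMl; apply: cvg_expr.
    by rewrite ger0_norm ?invr_ge0// invf_lt1// ltr1n.
have [||Y mY cY] := @fast_cauchy_complete _ _ _ P (fun j => step_int L (q (k j))).
- by move=> n; exact: measurable_step_int.
- move=> j.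
  have -> : step_int L (q (k j.+1)) \- step_int L (q (k j)) =
      step_int L (q (k j.+1) ++ map (scale (-1)) (q (k j))).
    by rewrite step_int_linear; apply/funext => w /=; rewrite mulN1r.
  rewrite (step_isometry mL L_increment); last by rewrite step_wf_cat step_wf_scale !wq.
  have -> : step_fun (q (k j.+1) ++ map (scale (-1)) (q (k j))) =
      (step_fun (q (k j.+1)) \- f) \- (step_fun (q (k j)) \- f).
    by rewrite step_fun_linear; apply/funext => w /=; rewrite mulN1r; ring.
  have ms n : measurable_fun setT (step_fun (q n) \- f).
    by apply: measurable_funB => //; exact: measurable_step_fun.
  apply: (@le_trans _ _ (s2%:E * (2%:E * (e j.+1)%:E + 2%:E * (e j)%:E))%E).
    rewrite lee_wpmul2l ?lee_fin//; apply: le_trans (sqintB_le leb (ms _) (ms _)) _.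
    by apply: leeD; rewrite lee_wpmul2l// ltW.
  rewrite -!EFinM lee_fin /e exprS.
  have p0 : 0 < 4^-1 ^+ j :> R by rewrite exprn_gt0// invr_gt0.
  move: (4^-1 ^+ j) p0 => p p0.
  rewrite (_ : s2 * _ = p * (s2 / (s2 + 1)) * (5 / 8)); last by field; rewrite gt_eqF.
  have h : s2 / (s2 + 1) <= 1 by rewrite ler_pdivrMr// mul1r lerDl.
  have h0 : 0 <= s2 / (s2 + 1) by rewrite divr_ge0// ltW.
  nra.
- by exists Y; apply/is_levy_intE; split => //; exists (q \o k); split => // n; exact: wq.
Qed.

Lemma levy_intP f q : measurable_fun setT f -> (forall n, step_wf (q n)) ->
  (sqint leb (step_fun (q n) \- f)%R @[n --> \oo] --> 0)%E ->
  is_levy_int P L f (levy_int P L f).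
Proof.
move=> mf wq qf; have [Y fY] := is_levy_int_exists mf wq qf.
have := @xgetPex _ (cst 0) [set Y | measurable_fun setT f /\ is_levy_int P L f Y].
by case=> //; exists Y.
Qed.

(** Polarization of the isometry. *)
Lemma levy_int_covariance f g Y Z : measurable_fun setT f -> measurable_fun setT g ->
  is_levy_int P L f Y -> is_levy_int P L g Z ->
  (\int[P]_w (Y w * Z w)%:E = s2%:E * \int[leb]_x (f x * g x)%:E)%E.
Proof.
move=> mf mg fY gZ.
have [mY _] := fY; have [mZ _] := gZ.
have f2 := is_levy_int_fun_L2 mf fY.
have g2 := is_levy_int_fun_L2 mg gZ.
have Y2 := is_levy_int_L2 fY.
have Z2 := is_levy_int_L2 gZ.
have iso c : sqint P (fun w => Y w + c * Z w) = (s2%:E * sqint leb (fun x : R => (f x + c * g x)%R))%E.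
  apply: (levy_int_isometry).
    by apply: measurable_funD => //; exact: measurable_funM.
  exact: is_levy_int_linear.
have plus (U : Type) (u v : U -> R) : (fun x => u x + 1 * v x) = u \+ v.
  by apply/funext => x /=; rewrite mul1r.
have minus (U : Type) (u v : U -> R) : (fun x => u x + (-1) * v x) = u \- v.
  by apply/funext => x /=; rewrite mulN1r.
have := iso 1; have := iso (-1); rewrite !plus !minus => im.
rewrite (sqint_polarization mY mZ Y2 Z2) (@sqint_polarization _ _ _ leb f g mf mg f2 g2) im.
have iI := @mul_integrable _ _ _ leb f g mf mg f2 g2.
have iJ := mul_integrable mY mZ Y2 Z2.
have sB := @sqintB_lty _ _ _ leb f g mf mg f2 g2.
have := integrable_fin_num measurableT iI; have := integrable_fin_num measurableT iJ.
have := sqint_fin sB; case: (sqint leb _) => // a _.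
case: (\int[P]_w _)%E => // b _; case: (\int[leb]_x _)%E => // c _ [].
rewrite mulrDr => /addrI e; congr (EFin _); lra.
Qed.

End LevyIntegral.

(** * Integrals of powers *)

(** By monotone convergence, bounds on an exhausting sequence of sets pass to the
    union; this reduces improper integrals to compact intervals. *)
Lemma integral_bigcup_le {R : realType} d (T : measurableType d) (mu : {measure set T -> \bar R})
    (F : nat -> set T) (f : T -> \bar R) (M : \bar R) :
  {homo F : n m / (n <= m)%N >-> (n <= m)%O} -> (forall i, measurable (F i)) ->
  measurable_fun setT f -> (forall x, (0 <= f x)%E) ->
  (forall n, (\int[mu]_(x in F n) f x <= M)%E) ->
  (\int[mu]_(x in \bigcup_n F n) f x <= M)%E.
Proof.
move=> ndF mF mf f0 fM.
have := @ge0_nondecreasing_set_cvg_integral _ _ _ F f mu ndF mF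
  (fun n => measurable_funTS mf) (fun i x _ => f0 x).
by move/(cvge_to_le); apply; apply: nearW.
Qed.

Section PowerIntegrals.
Context {R : realType}.
Local Notation leb := (@lebesgue_measure R).
Implicit Types a b c x y : R.

Lemma continuous_powR_gt0 c x : 0 < x -> {for x, continuous (@powR R ^~ c)}.
Proof.
move=> x0; apply/differentiable_continuous/derivable1_diffP.
by apply: derivable_powR; rewrite in_itv/= x0.
Qed.

Lemma measurable_powRE c : measurable_fun setT (fun x => (x `^ c)%:E).
Proof. by apply/measurable_EFinP; exact: measurable_powR. Qed.

Lemma integral_powR c a b : c != 0 -> 0 < a -> a < b ->
  (\int[leb]_(x in `[a, b]) (x `^ (c - 1))%:E = (c^-1 * (b `^ c - a `^ c))%:E)%E.
Proof.
move=> c0 a0 ab; have b0 := lt_trans a0 ab.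
have cF x : 0 < x -> {for x, continuous (fun x => c^-1 * x `^ c)}.
  by move=> x0; apply: cvgMr; exact: continuous_powR_gt0.
rewrite (@continuous_FTC2 _ _ (fun x => c^-1 * x `^ c)) ?mulrBr//.
- apply: continuous_in_subspaceT => x; rewrite inE/= in_itv/= => /andP[ax _].
  by apply: continuous_powR_gt0; exact: lt_le_trans ax.
- split.
  + move=> x; rewrite in_itv/= => /andP[ax _]; apply: derivableM => //.
    by apply: derivable_powR; rewrite in_itv/= (lt_trans a0 ax).
  + by apply: cvg_at_right_filter; exact: cF.
  + by apply: cvg_at_left_filter; exact: cF.
- move=> x; rewrite in_itv/= => /andP[ax _].
  have x0 : x \in `]0, +oo[ by rewrite in_itv/= (lt_trans a0 ax).
  rewrite derive1Ml; last exact: derivable_powR.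
  by rewrite powR_derive1// mulrA mulVf ?mul1r.
Qed.

Lemma integral_powR_near0 c b : 0 < c -> 0 < b ->
  (\int[leb]_(x in `]0%R, b]) (x `^ (c - 1))%:E <= (b `^ c / c)%:E)%E.
Proof.
move=> c0 b0.
have -> : `]0, b]%classic = \bigcup_n `[b / n.+2%:R, b]%classic :> set R.
  apply/seteqP; split => [x /=|x [n _] /=]; rewrite !in_itv/= => /andP[h1 h2].
    exists (Num.truncn (b / x)) => //=; rewrite in_itv/= h2 andbT.
    rewrite ler_pdivrMr// mulrC -ler_pdivrMr// ltW//.
    by rewrite (lt_le_trans (truncnS_gt _))// ler_nat.
  by rewrite h2 andbT (lt_le_trans _ h1)// divr_gt0.
apply: integral_bigcup_le => //.
- move=> n m nm; rewrite subsetEset => x /=; rewrite !in_itv/= => /andP[h ->]; rewrite andbT.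
  by apply: le_trans h; rewrite ler_pM2l// lef_pV2 ?posrE// ler_nat.
- exact: measurable_powRE.
- by move=> x; rewrite lee_fin powR_ge0.
- move=> n; rewrite integral_powR ?gt_eqF// ?divr_gt0//.
    by rewrite lee_fin mulrC ler_pM2r ?invr_gt0// lerBlDr lerDl powR_ge0.
  by rewrite ltr_pdivrMr// ltr_pMr// ltr1n.
Qed.

Lemma integral_powR_neary c : c < 0 ->
  (\int[leb]_(x in `[1%R, +oo[) (x `^ (c - 1))%:E <= (- c^-1)%:E)%E.
Proof.
move=> c0.
have -> : `[1, +oo[%classic = \bigcup_n `[1, n.+2%:R]%classic :> set R.
  apply/seteqP; split => [x /=|x [n _] /=]; rewrite !in_itv/= ?andbT.
    move=> h; exists (Num.truncn x) => //=; rewrite in_itv/= h/= ltW//.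
    by rewrite (lt_le_trans (truncnS_gt _))// ler_nat.
  by move=> /andP[].
apply: integral_bigcup_le => //.
- move=> n m nm; rewrite subsetEset => x /=; rewrite !in_itv/= => /andP[-> h]/=.
  by apply: le_trans h _; rewrite ler_nat.
- exact: measurable_powRE.
- by move=> x; rewrite lee_fin powR_ge0.
- move=> n; rewrite integral_powR ?lt_eqF// ?ltr1n//.
  rewrite lee_fin powR1 mulrBr mulr1 gerDr.
  by rewrite mulr_le0_ge0 ?powR_ge0// invr_le0 ltW.
Qed.

(** Finiteness is the point: [Gamma] is a real-valued integral, which would be 0 if
    the integral were infinite. The integrand is below $x^{d-1}$ on $]0, 1]$ and
    below the exponential density on $]1, \infty[$. *)
Lemma Gamma_gt0 d : 0 < d -> d < 1 -> 0 < Gamma d :> R.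
Proof.
move=> d0 d1; rewrite /Gamma /Rintegral.
pose f (x : R) := x `^ (d - 1) * expR (- x).
rewrite -[fine _]/(fine (\int[leb]_(x in `]0%R, +oo[) (f x)%:E)%E).
have mf : measurable_fun setT (EFin \o f).
  apply/measurable_EFinP; apply: measurable_funM; first exact: measurable_powR.
  by apply: measurableT_comp => //; exact: measurable_expR.
have f0 x : (0 <= (f x)%:E)%E by rewrite lee_fin mulr_ge0 ?powR_ge0 ?expR_ge0.
apply: fine_gt0; apply/andP; split.
- apply: (@lt_le_trans _ _ (\int[leb]_(x in `[1%R, 2%R]) (2^-1 * expR (-2))%:E)%E).
    rewrite integral_cst//= lebesgue_measure_itv/= lte_fin ltr1n -EFinB -EFinM lte_fin.
    by rewrite mulr_gt0// ?mulr_gt0 ?invr_gt0 ?expR_gt0//; lra.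
  apply: (@le_trans _ _ (\int[leb]_(x in `[1%R, 2%R]) (f x)%:E)%E).
    apply: ge0_le_integral => //.
    + exact: measurable_funTS.
    + move=> x /=; rewrite in_itv/= => /andP[x1 x2]; rewrite lee_fin /f.
      have x0 : 0 < x by exact: lt_le_trans x1.
      apply: ler_pM; rewrite ?invr_ge0 ?expR_ge0//.
        apply: (@le_trans _ _ (x `^ (-1))).
          by rewrite powRN (powRr1 (ltW x0)) lef_pV2 ?posrE.
        by apply: ler_powR => //; lra.
      by rewrite ler_expR; lra.
  apply: ge0_subset_integral => //; first exact: measurable_funTS.
  by move=> x /=; rewrite !in_itv/= andbT => /andP[x1 _]; exact: lt_le_trans x1.
- have -> : `]0, +oo[%classic = `]0, 1]%classic `|` `]1, +oo[%classic :> set R.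
    apply/seteqP; split => x /=; rewrite !in_itv/= ?andbT.
      by move=> x0; have [x1|x1] := leP x 1; [left; rewrite x0|right].
    by case=> [/andP[]//|]; exact: lt_trans.
  rewrite ge0_integral_setU//; last 2 first.
  + exact: measurable_funTS.
  + apply/disj_setPS => x [] /=; rewrite !in_itv/= andbT => /andP[_ h1] h2.
    by move: (le_lt_trans h1 h2); rewrite ltxx.
  apply: lte_add_pinfty.
    apply: (@le_lt_trans _ _ (\int[leb]_(x in `]0%R, 1%R]) (x `^ (d - 1))%:E)%E).
      apply: ge0_le_integral => //.
      * exact: measurable_funTS.
      * by apply: measurable_funTS; exact: measurable_powRE.
      * move=> x /=; rewrite in_itv/= => /andP[x0 _]; rewrite lee_fin /f.
        by rewrite ler_piMr ?powR_ge0// -expR0 ler_expR oppr_le0 ltW.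
    by apply: le_lt_trans (integral_powR_near0 d0 ltr01) _; exact: ltry.
  apply: (@le_lt_trans _ _ (\int[leb]_x (exponential_pdf 1 x)%:E)%E); last first.
    by rewrite integral_exponential_pdf// ltry.
  rewrite integral_mkcond; apply: ge0_le_integral => //.
  + by move=> x _; rewrite patchE; case: ifPn.
  + by apply/(measurable_restrictT _ _).1 => //; exact: measurable_funTS.
  + by apply/measurable_EFinP; exact: measurable_exponential_pdf.
  + move=> x _; rewrite patchE; case: ifPn => [|_]; last first.
      by rewrite lee_fin exponential_pdf_ge0.
    rewrite inE/= in_itv/= andbT => x1; have x0 : 0 < x := lt_trans ltr01 x1.
    rewrite lee_fin (exponential_pdfE _ (ltW x0)) mul1r mulN1r /f.
    rewrite ler_piMl ?expR_ge0// -[leRHS](powRr0 x); apply: ler_powR; first exact: ltW.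
    by rewrite subr_le0 ltW.
Qed.

End PowerIntegrals.

Section Reflection.
Context {R : realType}.
Local Notation leb := (@lebesgue_measure R).

Lemma lebesgue_measure_reflect (c : R) (A : set R) : measurable A ->
  leb ((fun x => c - x) @^-1` A) = leb A.
Proof.
move=> mA.
have mr : measurable_fun setT ((fun x => c - x) : R -> R) by exact: measurable_funB.
apply/esym; apply: (@lebesgue_measure_unique _ (pushforward leb ((fun x => c - x) : R -> measurableTypeR R))) => //.
move=> _ [[a b] _ <-] /=; rewrite /pushforward.
have -> : (fun x => c - x) @^-1` `]a, b] = `[c - b, c - a[%classic.
  apply/seteqP; split => x /=; rewrite !in_itv/= => /andP[h1 h2]; apply/andP; split; lra.
rewrite !lebesgue_measure_itv/= !lte_fin ltrD2l ltrN2.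
by case: ifP => // _; rewrite -!EFinB; congr EFin; ring.
Qed.

(** Translations are composed of two reflections, so this change of variable
    covers them too. *)
Lemma integral_reflect (c : R) (f : R -> \bar R) : measurable_fun setT f ->
  (forall x, (0 <= f x)%E) ->
  (\int[leb]_x f (c - x)%R = \int[leb]_x f x)%E.
Proof.
move=> mf f0.
have mr : measurable_fun (setT : set (measurableTypeR R)) ((fun x : R => c - x) : measurableTypeR R -> measurableTypeR R).
  exact: measurable_funB.
have := @ge0_integral_pushforward _ _ _ _ _ _ mr leb setT f measurableT mf (fun y _ => f0 y).
rewrite preimage_setT => <-; apply: eq_measure_integral => A mA _.
exact: lebesgue_measure_reflect.
Qed.

End Reflection.

(** * Fractional integrals of bounded kernels *)

Lemma ler_powR_neg {R : realType} (r a b : R) : r <= 0 -> 0 < a -> a <= b ->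
  b `^ r <= a `^ r.
Proof.
move=> r0 a0 ab; have b0 := lt_le_trans a0 ab.
rewrite -[r]opprK !(powRN _ (- r)) lef_pV2 ?posrE ?powR_gt0//.
by rewrite ge0_ler_powR// ?nnegrE ?oppr_ge0// ltW.
Qed.

Section FractionalIntegral.
Context {R : realType}.
Local Notation leb := (@lebesgue_measure R).
Implicit Types (k : R -> R) (y s : R).

(** Extending both integrands by 0 makes integrals over different sets comparable
    pointwise. *)
Lemma ge0_le_integral_patch (A B : set R) (f g : R -> \bar R) :
  measurable A -> measurable B -> measurable_fun setT f -> measurable_fun setT g ->
  (forall x, (0 <= f x)%E) -> (forall x, (0 <= g x)%E) ->
  (forall x, A x -> (f x <= (g \_ B) x)%E) ->
  (\int[leb]_(x in A) f x <= \int[leb]_(x in B) g x)%E.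
Proof.
move=> mA mB mf mg f0 g0 fg.
rewrite [leLHS]integral_mkcond [leRHS]integral_mkcond; apply: ge0_le_integral => //.
- by move=> x _; rewrite patchE; case: ifPn.
- by apply/(measurable_restrictT _ _).1 => //; exact: measurable_funTS.
- by apply/(measurable_restrictT _ _).1 => //; exact: measurable_funTS.
- move=> x _; rewrite [leLHS]patchE; case: ifPn => [/set_mem/fg//|_].
  by rewrite patchE; case: ifPn.
Qed.

Variable d : R.
Hypotheses (d_gt0 : 0 < d) (d_lt1 : d < 1).

(** Up to the factor $1/\Gamma(d)$, the value at $t - y$ of the fractional
    integral of $u \mapsto k(t - u)$, kept as an extended real for comparison and
    convergence arguments. *)
Definition kernel_int k y : \bar R :=
  (\int[leb]_(s in `]0%R, +oo[) (k (y - s) * s `^ (d - 1))%:E)%E.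

(** Kernels for which $s^{d-1}$ on $]0, y]$ is an integrable majorant of the
    integrand of [kernel_int]. *)
Definition unit_kernel k : Prop := [/\ measurable_fun setT k,
  forall v, 0 <= k v <= 1 & forall v, v <= 0 -> k v = 0].

Lemma measurable_frac_kernel k y : unit_kernel k ->
  measurable_fun setT (fun s => (k (y - s) * s `^ (d - 1))%:E).
Proof.
case=> mk _ _; apply/measurable_EFinP; apply: measurable_funM.
  by apply: measurableT_comp => //; exact: measurable_funB.
exact: measurable_powR.
Qed.

Lemma frac_kernel_ge0 k y s : unit_kernel k -> (0 <= (k (y - s) * s `^ (d - 1))%:E)%E.
Proof.
by case=> _ k01 _; rewrite lee_fin mulr_ge0 ?powR_ge0//; case/andP: (k01 (y - s)).
Qed.

Lemma kernel_int_ge0 k y : unit_kernel k -> (0 <= kernel_int k y)%E.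
Proof. by move=> uk; apply: integral_ge0 => s _; exact: frac_kernel_ge0. Qed.

Lemma le_kernel_int k k' y : unit_kernel k -> unit_kernel k' ->
  (forall v, k v <= k' v) -> (kernel_int k y <= kernel_int k' y)%E.
Proof.
move=> uk uk' kk'; apply: ge0_le_integral => //.
- by move=> s _; exact: frac_kernel_ge0.
- by apply: measurable_funTS; exact: measurable_frac_kernel.
- by apply: measurable_funTS; exact: measurable_frac_kernel.
- by move=> s _; rewrite lee_fin ler_wpM2r ?powR_ge0.
Qed.

Lemma kernel_int_vanish k y a : unit_kernel k -> y <= a ->
  (forall v, v <= a -> k v = 0) -> kernel_int k y = 0%E.
Proof.
move=> uk ya k0; apply: integral0_eq => s /=; rewrite in_itv/= andbT => s0.
by rewrite k0 ?mul0r//; lra.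
Qed.

Lemma kernel_int_le0 k y : unit_kernel k -> y <= 0 -> kernel_int k y = 0%E.
Proof. by move=> uk y0; apply: (kernel_int_vanish uk y0); case: uk. Qed.

Lemma kernel_int_le k y : unit_kernel k -> 0 < y ->
  (kernel_int k y <= (y `^ d / d)%:E)%E.
Proof.
move=> uk y0; apply: le_trans (integral_powR_near0 d_gt0 y0).
apply: ge0_le_integral_patch => //.
- exact: measurable_frac_kernel.
- exact: measurable_powRE.
- by move=> x; exact: frac_kernel_ge0.
- by move=> x; rewrite lee_fin powR_ge0.
- case: uk => _ k01 k0 s /=; rewrite in_itv/= andbT => s0; rewrite patchE.
  case: ifPn => [_|].
    by rewrite lee_fin ler_piMl ?powR_ge0//; case/andP: (k01 (y - s)).
  rewrite notin_setE/= in_itv/= s0/= => /negP; rewrite -ltNge => ys.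
  by rewrite k0 ?mul0r//; lra.
Qed.

Lemma kernel_int_fin k y : unit_kernel k -> kernel_int k y \is a fin_num.
Proof.
move=> uk; have [y0|y0] := leP y 0; first by rewrite kernel_int_le0.
by rewrite ge0_fin_numE ?kernel_int_ge0// (le_lt_trans (kernel_int_le uk y0))// ltry.
Qed.

(** The change of variable $v = x + s$, composed of two reflections. *)
Lemma kernel_int_shift k t x : unit_kernel k ->
  (\int[leb]_(v in `]x, +oo[) (k (t - v) * (v - x) `^ (d - 1))%:E)%E =
  kernel_int k (t - x).
Proof.
move=> uk; rewrite /kernel_int integral_mkcond [RHS]integral_mkcond.
set G := (X in _ = (\int[leb]_s X s)%E).
have mG : measurable_fun setT G.
  apply/(measurable_restrictT _ _).1 => //; apply: measurable_funTS.
  exact: measurable_frac_kernel.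
have G0 s : (0 <= G s)%E by rewrite /G patchE; case: ifPn => // _; exact: frac_kernel_ge0.
rewrite -(integral_reflect 0 mG G0).
have mG' : measurable_fun setT (fun w : R => G (0 - w)).
  by apply: measurableT_comp => //; exact: measurable_funB.
rewrite -(integral_reflect x mG')//; apply: eq_integral => v _.
rewrite /G !patchE !mem_setE/= !in_itv/= !andbT sub0r opprB subr_gt0.
by rewrite (_ : t - x - (v - x) = t - v)//; lra.
Qed.

(** The fractional integral commutes with reflected translations. This is why the
    process is a moving average. *)
Lemma frac_int_kernel k t x : unit_kernel k ->
  frac_int d (fun u => k (t - u)) x = (Gamma d)^-1 * fine (kernel_int k (t - x)).
Proof. by move=> uk; rewrite /frac_int -kernel_int_shift. Qed.

Lemma integrable_kernel_shift k t x : unit_kernel k ->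
  leb.-integrable `]x, +oo[ (fun v => (k (t - v) * (v - x) `^ (d - 1))%:E).
Proof.
move=> uk; apply/integrableP; split.
  apply: measurable_funTS; apply/measurable_EFinP; apply: measurable_funM.
    by case: uk => mk _ _; apply: measurableT_comp => //; exact: measurable_funB.
  apply: (@measurableT_comp _ _ _ _ _ _ (@powR R ^~ (d - 1))); first exact: measurable_powR.
  exact: measurable_funB.
under eq_integral => v _ do rewrite gee0_abs ?lee_fin ?mulr_ge0 ?powR_ge0 ?(andP (let: And3 _ k01 _ := uk in k01 _)).1//.
by rewrite kernel_int_shift// -ge0_fin_numE ?kernel_int_ge0 ?kernel_int_fin.
Qed.

Variables (h A : R).
Hypotheses (h_gt0 : 0 < h) (h_lt1 : h < 1) (A_ge0 : 0 <= A).

(** Split at $y/2$: one factor of the integrand is then nonsingular and bounded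
    by its value at $y/2$, the other is a power integrated from 0. *)
Lemma kernel_int_decay k y : unit_kernel k -> (forall v, 0 < v -> k v <= A * v `^ (h - 1)) ->
  0 < y -> (kernel_int k y <= (A * (d^-1 + h^-1) * (y / 2) `^ (d + h - 1))%:E)%E.
Proof.
move=> uk kA y0; pose b := y / 2; have b0 : 0 < b by rewrite divr_gt0.
pose Q (c s : R) : \bar R := ((fun s => (s `^ (c - 1))%:E) \_ `]0, b]) s.
have mQ c : measurable_fun setT (Q c).
  by apply/(measurable_restrictT _ _).1 => //; apply: measurable_funTS; exact: measurable_powRE.
have Q0 c s : (0 <= Q c s)%E.
  by rewrite /Q patchE; case: ifPn => // _; rewrite lee_fin powR_ge0.
have IQ c : 0 < c -> (\int[leb]_s Q c s <= (b `^ c / c)%:E)%E.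
  by move=> c0; rewrite -integral_mkcond; exact: integral_powR_near0.
pose a1 := A * b `^ (h - 1); pose a2 := A * b `^ (d - 1).
have a10 : 0 <= a1 by rewrite mulr_ge0// powR_ge0.
have a20 : 0 <= a2 by rewrite mulr_ge0// powR_ge0.
have mQy : measurable_fun setT (fun s => Q h (y - s)).
  by apply: measurableT_comp => //; exact: measurable_funB.
apply: (@le_trans _ _ (\int[leb]_s (a1%:E * Q d s + a2%:E * Q h (y - s)%R))%E).
  apply: ge0_le_integral_patch => //.
  - exact: measurable_frac_kernel.
  - by apply: emeasurable_funD; apply: measurable_funeM.
  - by move=> x; exact: frac_kernel_ge0.
  - by move=> s; rewrite adde_ge0// mule_ge0.
  - move=> s /=; rewrite in_itv/= andbT => s0; rewrite patchE in_setT.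
    have [sb|bs] := leP s b.
      apply: (@le_trans _ _ (a1%:E * Q d s)%E); last by rewrite leeDl// mule_ge0.
      rewrite /Q patchE mem_set/= ?in_itv/= ?s0// -EFinM lee_fin.
      rewrite ler_wpM2r ?powR_ge0// (le_trans (kA _ _))//; first by move: sb; rewrite /b; lra.
      rewrite ler_wpM2l//; apply: ler_powR_neg => //; first by rewrite subr_le0 ltW.
      by move: sb; rewrite /b; lra.
    apply: (@le_trans _ _ (a2%:E * Q h (y - s)%R)%E); last by rewrite leeDr// mule_ge0.
    have [ys|sy] := leP y s.
      by case: uk => _ _ k0; rewrite k0 ?mul0r ?mule_ge0//; lra.
    rewrite /Q patchE mem_set/=; last by rewrite in_itv/= subr_gt0 sy/=; move: bs; rewrite /b; lra.
    rewrite -EFinM lee_fin /a2 mulrAC; apply: ler_pM; rewrite ?powR_ge0//.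
    + by case: uk => _ k01 _; case/andP: (k01 (y - s)).
    + by apply: kA; rewrite subr_gt0.
    + by apply: ler_powR_neg => //; [rewrite subr_le0 ltW | exact: ltW].
have mM (c : R) (f : R -> \bar R) : measurable_fun setT f ->
    measurable_fun setT (fun s => c%:E * f s)%E by exact: measurable_funeM.
rewrite ge0_integralD//; try exact: mM; try by move=> s _; rewrite mule_ge0.
rewrite !ge0_integralZl_EFin//; last exact: mQ.
rewrite (integral_reflect y (mQ h))//.
apply: (@le_trans _ _ (a1%:E * (b `^ d / d)%:E + a2%:E * (b `^ h / h)%:E)%E).
  by apply: leeD; rewrite lee_wpmul2l// IQ.
rewrite -!EFinM lee_fin /a1 /a2.
have E1 : b `^ (h - 1) * b `^ d = b `^ (d + h - 1).
  by rewrite -powRD ?(gt_eqF b0) ?implybT//; congr (@powR R _ _); ring.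
have E2 : b `^ (d - 1) * b `^ h = b `^ (d + h - 1).
  by rewrite -powRD ?(gt_eqF b0) ?implybT//; congr (@powR R _ _); ring.
rewrite (_ : _ + _ = A * (b `^ (h - 1) * b `^ d) / d + A * (b `^ (d - 1) * b `^ h) / h); last by ring.
by rewrite E1 E2 -/b; lra.
Qed.

End FractionalIntegral.

Section KernelContinuity.
Context {R : realType}.
Local Notation leb := (@lebesgue_measure R).
Variable d : R.
Hypotheses (d_gt0 : 0 < d) (d_lt1 : d < 1).

(** The integrands are dominated by $s^{d-1}$ on a bounded interval and converge
    except at $s = y$, where $k$ may jump. *)
Lemma kernel_int_cvg (k : R -> R) (u : nat -> R) y : unit_kernel k ->
  (forall v, v != 0 -> {for v, continuous k}) ->
  u n @[n --> \oo] --> y -> kernel_int d k (u n) @[n --> \oo] --> kernel_int d k y.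
Proof.
move=> uk ck uy.
have [b b0 ub] : exists2 b, 0 < b & forall n, u n <= b.
  have /cvg_seq_bounded [M [Mr HM]] : cvgn u by apply/cvg_ex; exists y.
  exists (Num.max 1 (M + 1)); first by rewrite lt_max ltr01.
  move=> n; have := HM (M + 1); rewrite ltrDl ltr01 => /(_ isT n I) => h.
  by rewrite le_max (le_trans (ler_norm _) h) orbT.
pose F n (s : R) : \bar R := (k (u n - s) * s `^ (d - 1))%:E.
pose G : R -> \bar R := ((fun s => (s `^ (d - 1))%:E) \_ `]0, b]).
have mG : measurable_fun setT G.
  by apply/(measurable_restrictT _ _).1 => //; apply: measurable_funTS; exact: measurable_powRE.
pose D : set R := `]0, +oo[%classic.
have mD : measurable D by exact: measurable_itv.
have mF n : measurable_fun D (F n).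
  by apply: measurable_funTS; exact: measurable_frac_kernel.
have mf : measurable_fun D (fun s => (k (y - s) * s `^ (d - 1))%:E).
  by apply: measurable_funTS; exact: measurable_frac_kernel.
have cF : {ae leb, forall s, D s ->
    F n s @[n --> \oo] --> (k (y - s) * s `^ (d - 1))%:E}.
  have : leb.-negligible [set y] by apply/negligibleP => //; exact: lebesgue_measure_set1.
  apply: negligibleS => s /= H; apply: contrapT => sy; apply: H => _.
  apply: cvg_EFin; first exact: nearW.
  apply: cvgMl.
  have ys : y - s != 0 by rewrite subr_eq0; apply/eqP => ys; exact/sy/esym.
  have us : u n - s @[n --> \oo] --> y - s by apply: cvgB => //; exact: cvg_cst.
  exact: (cvg_comp _ _ us (ck _ ys)).
have iG : leb.-integrable D G.
  apply/integrableP; split; first exact: measurable_funTS.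
  apply: (@le_lt_trans _ _ (b `^ d / d)%:E); last exact: ltry.
  apply: le_trans (integral_powR_near0 d_gt0 b0).
  apply: ge0_le_integral_patch => //.
  - exact: measurableT_comp.
  - exact: measurable_powRE.
  - by move=> x; rewrite lee_fin powR_ge0.
  - move=> x _; rewrite gee0_abs// /G patchE; case: ifPn => // _.
    by rewrite lee_fin powR_ge0.
have FG : {ae leb, forall s, forall n, D s -> (`|F n s| <= G s)%E}.
  apply: aeW => s n Ds; have s0 : 0 < s by have : s \in `]0, +oo[ := Ds; rewrite in_itv/= andbT.
  case: (uk) => _ k01 k0; have /andP[k1 k2] := k01 (u n - s).
  rewrite /F /G patchE; case: ifPn => [_|].
    by rewrite gee0_abs lee_fin ?mulr_ge0 ?powR_ge0// ler_piMl ?powR_ge0.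
  rewrite notin_setE/= in_itv/= s0/= => /negP; rewrite -ltNge => bs.
  have us : u n - s <= 0 by rewrite subr_le0 (le_trans (ub n) (ltW bs)).
  by rewrite (k0 _ us) mul0r /= normr0.
by have [_ _] := @dominated_convergence _ _ R leb D mD F _ G mF mf cF iG FG.
Qed.

Lemma continuous_kernel_int (k : R -> R) : unit_kernel k ->
  (forall v, v != 0 -> {for v, continuous k}) ->
  continuous (fun y => fine (kernel_int d k y)).
Proof.
move=> uk ck y; apply/(@cvg_nbhsP _ R^o) => u uy.
apply: fine_cvg; rewrite fineK ?kernel_int_fin//.
exact: kernel_int_cvg.
Qed.

End KernelContinuity.

Section Envelope.
Context {R : realType}.
Local Notation leb := (@lebesgue_measure R).

(** Up to a constant, a majorant of the bounded functions that vanish on the left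
    of -1 and decay like $y^p$. The margin between -1 and 0 absorbs the displacement
    caused by sampling on a grid of mesh at most 1. *)
Definition envelope (p y : R) : R := if -1 < y then (Num.max 1 y) `^ p else 0.

Lemma measurable_envelope p : measurable_fun setT (envelope p).
Proof.
apply: measurable_fun_ifT => //.
- exact: measurable_fun_ltr.
- apply: (@measurableT_comp _ _ _ _ _ _ (@powR R ^~ p)); first exact: measurable_powR.
  exact: measurable_maxr.
Qed.

Lemma envelope_ge0 p y : 0 <= envelope p y.
Proof. by rewrite /envelope; case: ifP => // _; exact: powR_ge0. Qed.

(** On $[1, \infty[$ the square is $y^{2p}$ with $2p < -1$. *)
Lemma envelope_L2 p : p < - 2^-1 -> (sqint leb (envelope p) < +oo)%E.
Proof.
move=> p2; pose f x : \bar R := (envelope p x ^+ 2)%:E.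
have mf : measurable_fun setT f by exact: (measurable_sq (measurable_envelope p)).
have f0 x : (0 <= f x)%E by rewrite lee_fin sqr_ge0.
pose g (x : R) : \bar R := (x `^ (2 * p))%:E.
have mg : measurable_fun setT g by exact: measurable_powRE.
have g0 x : (0 <= g x)%E by rewrite lee_fin powR_ge0.
rewrite /sqint -/f -(setUv (`[1%R, +oo[%classic : set R)) ge0_integral_setU//; last 3 first.
- exact: (@measurable_funTS _ _ _ _ _ f).
- by move=> x _; exact: f0.
- exact/disj_setPCl.
apply: lte_add_pinfty.
- apply: (@le_lt_trans _ _ (\int[leb]_(x in `[1%R, +oo[) g x)%E).
    apply: ge0_le_integral => //; try exact: measurable_funTS.
      by move=> x _; exact: f0.
    move=> x /=; rewrite in_itv/= andbT => x1.
    rewrite lee_fin /envelope (_ : -1 < x); last lra.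
    by rewrite max_r// -powR_mulrn ?powR_ge0// -powRrM mulrC.
  have c0 : 2 * p + 1 < 0 by lra.
  have := integral_powR_neary c0; rewrite addrK => H.
  by apply: le_lt_trans H _; exact: ltry.
- apply: (@le_lt_trans _ _ (\int[leb]_(x in `](-1)%R, 1%R[) (cst 1%E x))%E); last first.
    by rewrite integral_cst//= mul1e lebesgue_measure_itv/=; case: ifP => _; rewrite ltry.
  apply: ge0_le_integral_patch => //; first exact: measurableC.
  move=> x /=; rewrite in_itv/= andbT => /negP; rewrite -ltNge => x1.
  rewrite patchE; case: ifPn => [_|].
    rewrite /= lee_fin /envelope; case: ifP => _; last by rewrite expr0n ler01.
    by rewrite max_l ?(ltW x1)// powR1 expr1n.
  rewrite notin_setE/= in_itv/= x1 andbT => /negP; rewrite -leNgt => x2.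
  by rewrite /f /envelope ltNge x2/= expr0n.
exact: measurableC.
Qed.

End Envelope.

(** * The moving-average kernel *)

Lemma powR_le1 {R : realType} (a r : R) : 0 <= a -> a <= 1 -> 0 <= r -> a `^ r <= 1.
Proof.
move=> a0 a1 r0; have := @ge0_ler_powR _ r r0 a 1.
by rewrite powR1; apply; rewrite ?nnegrE.
Qed.

Section MovingAverageKernel.
Context {R : realType}.
Local Notation leb := (@lebesgue_measure R).
Variables d alpha h : R.
Hypotheses (d_gt0 : 0 < d) (d_lt : d < 1 / 2) (alpha_gt0 : 0 < alpha)
  (h_gt0 : 0 < h) (h_lt : h < 1 / 2 - d).

Let d_lt1 : d < 1. Proof. by move: d_lt; lra. Qed.
Let h_lt1 : h < 1. Proof. by move: d_gt0 h_lt; lra. Qed.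

(** The integrand of $Z^d(t)$ as a function of the lag $v = t - u$. *)
Definition weight (v : R) : R := (alpha / (alpha + v)) `^ (1 - h) * \1_(`]0, +oo[) v.

Lemma weightE v : 0 < v -> weight v = (alpha / (alpha + v)) `^ (1 - h).
Proof. by move=> v0; rewrite /weight indicE mem_set ?mulr1//= in_itv/= v0. Qed.

Lemma weight_powRE v : 0 < v -> weight v = alpha `^ (1 - h) * (alpha + v) `^ (h - 1).
Proof.
move=> v0; have av : 0 < alpha + v by rewrite addr_gt0.
rewrite weightE// powRM ?invr_ge0 ?(ltW alpha_gt0) ?(ltW av)//; congr (_ * _).
by rewrite -(powR_inv1 (ltW av)) -powRrM mulN1r opprB.
Qed.

Lemma weight_le0 v : v <= 0 -> weight v = 0.
Proof.
by move=> v0; rewrite /weight indicE memNset ?mulr0//= in_itv/= andbT; apply/negP; rewrite -leNgt.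
Qed.

Lemma unit_kernel_weight : unit_kernel weight.
Proof.
split.
- have -> : weight = (fun v => alpha `^ (1 - h) * (alpha + v) `^ (h - 1) * \1_(`]0, +oo[) v).
    apply/funext => v; have [v0|v0] := leP v 0; last by rewrite weight_powRE// indicE mem_set ?mulr1//= in_itv/= v0.
    by rewrite weight_le0// indicE memNset ?mulr0//= in_itv/= andbT; apply/negP; rewrite -leNgt.
  apply: measurable_funM => //; apply: measurable_funM => //.
  apply: (@measurableT_comp _ _ _ _ _ _ (@powR R ^~ (h - 1))); first exact: measurable_powR.
  exact: measurable_funD.
- move=> v; have [v0|v0] := leP v 0; first by rewrite weight_le0// lexx ler01.
  rewrite weightE// powR_ge0/= powR_le1 ?subr_ge0 ?(ltW h_lt1)//.
  + by rewrite divr_ge0// ?addr_ge0// ltW.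
  + by rewrite ler_pdivrMr ?addr_gt0// mul1r lerDl ltW.
- exact: weight_le0.
Qed.

Lemma continuous_weight v : v != 0 -> {for v, continuous weight}.
Proof.
rewrite neq_lt => /orP[v0|v0]; rewrite /prop_for /continuous_at.
- rewrite weight_le0 ?ltW//; apply: cvg_near_cst; near=> x; rewrite weight_le0//; apply: ltW; near: x.
  exact: lt_nbhsl.
- have av : 0 < alpha + v by rewrite addr_gt0.
  have E : \forall x \near v, alpha `^ (1 - h) * (alpha + x) `^ (h - 1) = weight x.
    by near=> x; rewrite weight_powRE//; near: x; exact: lt_nbhsr.
  apply: cvg_trans (near_eq_cvg E) _; rewrite weight_powRE//.
  apply: cvgMr.
  apply: (@cvg_comp _ _ _ (fun x => alpha + x) (@powR R ^~ (h - 1)) _ (nbhs (alpha + v))).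
    by apply: cvgD; [exact: cvg_cst | exact: cvg_id].
  exact: continuous_powR_gt0.
Unshelve. all: by end_near. Qed.

Lemma weight_decay v : 0 < v -> weight v <= alpha `^ (1 - h) * v `^ (h - 1).
Proof.
move=> v0; rewrite weight_powRE// ler_wpM2l ?powR_ge0//.
by apply: ler_powR_neg => //; [rewrite subr_le0 ltW | rewrite lerDr ltW].
Qed.

(** The moving-average kernel of $Z^d$: the fractional integral of [weight]. *)
Definition ma_kernel (y : R) : R := (Gamma d)^-1 * fine (kernel_int d weight y).

Let G0 : 0 < Gamma d := Gamma_gt0 d_gt0 d_lt1.

Lemma ma_kernel_ge0 y : 0 <= ma_kernel y.
Proof.
rewrite mulr_ge0 ?invr_ge0 ?(ltW G0)// fine_ge0//.
exact: (kernel_int_ge0 _ _ unit_kernel_weight).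
Qed.

Lemma ma_kernel_le0 y : y <= 0 -> ma_kernel y = 0.
Proof. by move=> y0; rewrite /ma_kernel (kernel_int_le0 _ unit_kernel_weight y0) mulr0. Qed.

Lemma continuous_ma_kernel : continuous ma_kernel.
Proof.
move=> y; apply: cvgMr.
exact: (continuous_kernel_int d_gt0 unit_kernel_weight continuous_weight).
Qed.

Lemma measurable_ma_kernel : measurable_fun setT ma_kernel.
Proof. exact: (continuous_measurable_fun continuous_ma_kernel). Qed.

Let p := d + h - 1.
Let p_lt : p < - 2^-1. Proof. by rewrite /p; move: h_lt; lra. Qed.

(** [weight] is at most 1, which bounds the kernel on $[0, 1]$, and decays like
    $v^{h-1}$, which gives the order $y^{d+h-1}$ by [kernel_int_decay]. *)
Lemma ma_kernel_envelope : exists2 C, 0 <= C & forall y, ma_kernel y <= C * Num.max 1 y `^ p.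
Proof.
pose A := alpha `^ (1 - h).
have A0 : 0 <= A by rewrite powR_ge0.
pose C := d^-1 + A * (d^-1 + h^-1) * 2^-1 `^ p.
have di : 0 < d^-1 by rewrite invr_gt0.
have hi : 0 < h^-1 by rewrite invr_gt0.
have C2 : 0 <= A * (d^-1 + h^-1) * 2^-1 `^ p.
  by rewrite !mulr_ge0 ?powR_ge0// addr_ge0// ltW.
have C0 : 0 <= C by rewrite addr_ge0// ltW.
exists ((Gamma d)^-1 * C); first by rewrite mulr_ge0// invr_ge0 ltW.
move=> y; rewrite -mulrA ler_pM2l ?invr_gt0// -lee_fin fineK ?(kernel_int_fin d_gt0 _ unit_kernel_weight)//.
have [y0|y0] := leP y 0.
  by rewrite (kernel_int_le0 _ unit_kernel_weight y0) lee_fin mulr_ge0// powR_ge0.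
have [y1|y1] := leP y 1.
  rewrite powR1 mulr1 (le_trans (kernel_int_le d_gt0 unit_kernel_weight y0))// lee_fin.
  rewrite /C -[leLHS]addr0 lerD// ler_piMl ?(ltW di)//.
  by rewrite powR_le1 ?(ltW d_gt0) ?(ltW y0).
rewrite (le_trans (kernel_int_decay d_gt0 d_lt1 h_gt0 h_lt1 A0 unit_kernel_weight weight_decay y0))//.
rewrite lee_fin -/p powRM ?invr_ge0 ?(ltW y0)// /C mulrDl -mulrA [_ * 2^-1 `^ p]mulrC !mulrA.
by rewrite -[leLHS]add0r lerD// mulr_ge0 ?powR_ge0// ltW.
Qed.

(** Keep only $s \in ]0, 1[$ in the fractional integral: there $s^{d-1} \ge 1$, and
    [weight] at $y - s$ is at least $\alpha/(\alpha + y)$ because its base and its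
    exponent are at most 1. *)
Lemma ma_kernel_lower y : 1 <= y -> (Gamma d)^-1 * (alpha / (alpha + y)) <= ma_kernel y.
Proof.
move=> y1; have y0 : 0 < y := lt_le_trans ltr01 y1.
have ay : 0 < alpha + y by rewrite addr_gt0.
rewrite ler_pM2l ?invr_gt0// -lee_fin fineK ?(kernel_int_fin d_gt0 _ unit_kernel_weight)//.
apply: (@le_trans _ _ (\int[leb]_(s in `]0%R, 1%R[) (cst (alpha / (alpha + y))%:E s))%E).
  rewrite integral_cst//= lebesgue_measure_itv/= lte_fin ltr01 -EFinB subr0 mule1//.
apply: ge0_le_integral_patch => //.
- exact: measurable_frac_kernel unit_kernel_weight.
- by move=> s; rewrite lee_fin divr_ge0// ltW.
- by move=> s; exact: frac_kernel_ge0 unit_kernel_weight.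
- move=> s /=; rewrite in_itv/= => /andP[s0 s1].
  rewrite patchE mem_set/= ?in_itv/= ?s0// lee_fin.
  have ys : 0 < y - s by rewrite subr_gt0 (lt_le_trans s1).
  have h1 : alpha / (alpha + y) <= weight (y - s).
    rewrite weightE//.
    have ays : 0 < alpha + (y - s) by rewrite addr_gt0.
    apply: (@le_trans _ _ (alpha / (alpha + (y - s)))).
      by rewrite ler_pM2l// lef_pV2 ?posrE// lerD2l lerBlDr lerDl ltW.
    apply: ger1_powR; last by rewrite gerBl ltW.
    by rewrite divr_gt0//= ler_pdivrMr// mul1r lerDl ltW.
  rewrite -[leLHS]mulr1; apply: ler_pM => //; first by rewrite divr_ge0// ltW.
  have d10 : d - 1 <= 0 by rewrite subr_le0 ltW.
  by have := ler_powR_neg d10 s0 (ltW s1); rewrite powR1.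
Qed.

End MovingAverageKernel.

(** * Approximation by step functions on grids *)

Section StepApproximation.
Context {R : realType}.
Local Notation leb := (@lebesgue_measure R).
Variables (F : R -> R) (C p : R).
Hypotheses (cF : continuous F) (F_ge0 : forall y, 0 <= F y)
  (F_le0 : forall y, y <= 0 -> F y = 0) (C_ge0 : 0 <= C)
  (F_le : forall y, F y <= C * Num.max 1 y `^ p) (p_lt : p < - 2^-1).

Let mF : measurable_fun setT F. Proof. exact: continuous_measurable_fun. Qed.

Definition grid_steps (t delta a : R) (N : nat) : seq (R * R * R) :=
  mkseq (fun j => (F (t - (a + j%:R) * delta), (a + j%:R) * delta, (a + j.+1%:R) * delta)) N.

Lemma grid_steps_wf t delta a N : 0 <= delta -> step_wf (grid_steps t delta a N).
Proof.
move=> d0; rewrite /step_wf all_map; apply/allP => j _ /=.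
by rewrite ler_wpM2r// lerD2l ler_nat.
Qed.

Lemma grid_stepsS t delta a N x :
  step_fun (grid_steps t delta a N.+1) x = step_fun (grid_steps t delta a N) x +
   F (t - (a + N%:R) * delta) * \1_(`](a + N%:R) * delta, (a + N.+1%:R) * delta]) x.
Proof.
by rewrite /step_fun /grid_steps /mkseq -addn1 iotaD map_cat big_cat/= big_seq1 add0n addn1.
Qed.

(** Inside the grid the step function takes the value of $F(t - \cdot)$ at a point
    at distance at most the mesh; the cell of $x$ is found by adding the cells one
    by one from the left. *)
Lemma grid_step_fun t delta a N x : 0 < delta ->
  if (a * delta < x) && (x <= (a + N%:R) * delta)
  then exists2 c, c < x <= c + delta & step_fun (grid_steps t delta a N) x = F (t - c)
  else step_fun (grid_steps t delta a N) x = 0.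
Proof.
move=> d0; elim: N => [|N IH].
  rewrite addr0; case: ifP => [/andP[h1 h2]|_]; first by move: (lt_le_trans h1 h2); rewrite ltxx.
  by rewrite /step_fun big_nil.
rewrite grid_stepsS indicE mem_setE/= in_itv/=.
have e : (a + N.+1%:R) * delta = (a + N%:R) * delta + delta by rewrite -natr1; ring.
have aN : a * delta <= (a + N%:R) * delta by rewrite ler_wpM2r ?(ltW d0)// lerDl.
move: IH; rewrite e; set b := (a + N%:R) * delta.
have [xb|bx] /= := leP x b.
  by rewrite mulr0 addr0 (le_trans xb) ?lerDl ?(ltW d0).
rewrite andbF (le_lt_trans aN bx)/= => ->; rewrite add0r.
case: ifP => xbd; last by rewrite [_ <= _]xbd mulr0.
by exists b; [rewrite bx xbd | rewrite [X in (nat_of_bool X)%:R]xbd mulr1].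
Qed.

Variables (delta a : nat -> R) (N : nat -> nat).
Hypotheses (delta_gt0 : forall n, 0 < delta n) (delta_le1 : forall n, delta n <= 1)
  (delta_cvg : delta n @[n --> \oo] --> 0)
  (grid_cover : forall x : R, \forall n \near \oo,
     a n * delta n < x <= (a n + (N n)%:R) * delta n).

Let ps t n := step_fun (grid_steps t (delta n) (a n) (N n)).

Let ps_cvg t x : ps t n x @[n --> \oo] --> F (t - x).
Proof.
have /choice [c cP] : forall n, exists c, x - delta n <= c <= x /\
    (a n * delta n < x <= (a n + (N n)%:R) * delta n -> ps t n x = F (t - c)).
  move=> n; have := @grid_step_fun t (delta n) (a n) (N n) x (delta_gt0 n).
  case: ifP => [h [c /andP[c1 c2] E]|h _].
    by exists c; split => //; rewrite lerBlDr c2 ltW.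
  by exists x; split; rewrite ?h// lexx andbT gerBl ltW.
have cx : c n @[n --> \oo] --> x.
  apply: (@squeeze_cvgr _ _ _ _ (fun n => x - delta n) (cst x)).
  - by apply: nearW => n; case: (cP n).
  - by rewrite -[X in _ --> X]subr0; apply: cvgB => //; exact: cvg_cst.
  - exact: cvg_cst.
have Fc : F (t - c n) @[n --> \oo] --> F (t - x).
  apply: (@cvg_comp _ _ _ (fun n => t - c n) F _ (nbhs (t - x))); last exact: cF.
  by apply: cvgB => //; exact: cvg_cst.
apply: cvg_trans (near_eq_cvg _) Fc.
by apply: filterS (grid_cover x) => n h; rewrite (cP n).2.
Qed.

Let F_envelope y : F y <= C * envelope p y.
Proof.
rewrite /envelope; case: ifPn => [_|]; first exact: F_le.
by rewrite -leNgt => y1; rewrite F_le0 ?mulr0//; lra.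
Qed.

(** The sampled argument of $F$ exceeds $t - x$ by at most the mesh, hence by at
    most 1. If it is positive then $t - x > -1$, and the envelope is nonincreasing
    on $]-1, \infty[$. *)
Let ps_envelope t n x : 0 <= ps t n x <= C * envelope p (t - x).
Proof.
have E0 : 0 <= C * envelope p (t - x) by rewrite mulr_ge0// envelope_ge0.
have := @grid_step_fun t (delta n) (a n) (N n) x (delta_gt0 n).
case: ifP => [h [c /andP[c1 c2] E]|h E]; rewrite /ps E ?lexx ?E0// F_ge0/=.
have d1 := delta_le1 n; have [c0|c0] := leP (t - c) 0; first by rewrite F_le0.
apply: le_trans (F_le _) _; rewrite ler_wpM2l// /envelope.
rewrite (_ : -1 < t - x); last lra.
apply: ler_powR_neg; first by move: p_lt; lra.
- by rewrite lt_max ltr01.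
- by rewrite ge_max !le_max lexx/= (_ : t - x <= t - c) ?orbT//; lra.
Qed.

Let measurable_ps t n : measurable_fun setT (ps t n).
Proof.
by apply: measurable_sum => -[[b u] v]; exact: measurable_funM.
Qed.

Let sq_envelope_integrable t :
  leb.-integrable setT (fun x : R => ((C * envelope p (t - x)) ^+ 2)%:E).
Proof.
have mE : measurable_fun setT (fun x : R => C * envelope p x).
  by apply: measurable_funM => //; exact: measurable_envelope.
have mEt : measurable_fun setT (fun x : R => C * envelope p (t - x)).
  by apply: (measurableT_comp mE); exact: measurable_funB.
apply: (@sqint_integrable _ _ _ leb (fun x : R => C * envelope p (t - x)) mEt).
rewrite /sqint.
rewrite (@integral_reflect _ t (fun x : R => ((C * envelope p x) ^+ 2)%:E)).
- rewrite -[X in (X < _)%E]/(sqint leb (fun x : R => C * envelope p x)).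
  rewrite sqintZ; last exact: measurable_envelope.
  by rewrite lte_mul_pinfty// ?lee_fin ?sqr_ge0//; exact: envelope_L2.
- exact: measurable_sq.
- by move=> x; rewrite lee_fin sqr_ge0.
Qed.

(** Dominated convergence: pointwise convergence is the continuity of $F$, and the
    majorant is the square of the envelope. *)
Lemma grid_steps_cvg t :
  (sqint leb (step_fun (grid_steps t (delta n) (a n) (N n)) \- (fun x : R => F (t - x)))%R
    @[n --> \oo] --> 0)%E.
Proof.
have mFt : measurable_fun setT (fun x : R => F (t - x)).
  by apply: (measurableT_comp mF); exact: measurable_funB.
have mf n : measurable_fun setT (fun x : R => ((ps t n x - F (t - x)) ^+ 2)%:E).
  by apply: measurable_sq; exact: measurable_funB.
have cf : {ae leb, forall x : R, setT x -> ((ps t n x - F (t - x)) ^+ 2)%:E @[n --> \oo] --> (cst 0%E x : \bar R)}.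
  apply: aeW => x _; apply: cvg_EFin; first exact: nearW.
  have h : ps t n x - F (t - x) @[n --> \oo] --> (0 : R).
    by rewrite -(subrr (F (t - x))); apply: cvgB; [exact: ps_cvg | exact: cvg_cst].
  rewrite -[X in _ --> X](mulr0 (0 : R)).
  exact: (cvg_trans _ (cvgM h h)).
have dom : {ae leb, forall x : R, forall n, setT x -> (`|((ps t n x - F (t - x)) ^+ 2)%:E| <=
    ((C * envelope p (t - x)) ^+ 2)%:E)%E}.
  apply: aeW => x n _; rewrite gee0_abs ?lee_fin ?sqr_ge0//.
  have /andP[h1 h2] := ps_envelope t n x.
  have h3 := F_envelope (t - x); have h4 := F_ge0 (t - x).
  have h5 := le_trans h1 h2.
  rewrite -[leLHS]real_normK ?num_real// ler_sqr ?nnegrE ?normr_ge0 ?h5//.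
  rewrite ler_norml; apply/andP; split.
    by rewrite lerNl opprB (le_trans _ h3)// gerBl.
  by rewrite (le_trans _ h2)// gerBl.
have intE := sq_envelope_integrable t.
have [_ _] := @dominated_convergence _ _ R leb setT measurableT
  (fun n (x : R) => ((ps t n x - F (t - x)) ^+ 2)%:E) (cst 0%E)
  (fun x : R => ((C * envelope p (t - x)) ^+ 2)%:E) mf (measurable_cst _) cf intE dom.
by rewrite integral0.
Qed.

End StepApproximation.

(** * The process as a moving average *)

Section KernelMeasurability.
Context {R : realType}.
Local Notation leb := (@lebesgue_measure R).

(** Tonelli. Truncated kernels jump away from 0, where [continuous_kernel_int] does
    not apply. *)
Lemma measurable_kernel_int (d : R) (k : R -> R) : unit_kernel k ->
  measurable_fun setT (kernel_int d k).
Proof.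
case=> mk k01 k0.
pose Phi (z : R * measurableTypeR R) : \bar R :=
  (k (z.1 - z.2) * (z.2 : R) `^ (d - 1) * \1_(`]0, +oo[ : set R) z.2)%:E.
have mPhi : measurable_fun setT Phi.
  apply/measurable_EFinP; apply: measurable_funM; first apply: measurable_funM.
  - by apply: (measurableT_comp mk); exact: measurable_funB.
  - apply: (@measurableT_comp _ _ _ _ _ _ (@powR R ^~ (d - 1))) => //; exact: measurable_powR.
  - have m1 : measurable_fun setT (\1_(`]0, +oo[ : set (measurableTypeR R)) : measurableTypeR R -> R) by [].
    exact: (measurableT_comp m1 (@measurable_snd _ _ R (measurableTypeR R))).
have Phi0 z : (0 <= Phi z)%E.
  rewrite lee_fin !mulr_ge0 ?powR_ge0 ?indicE ?ler0n//.
  by case/andP: (k01 (z.1 - z.2)).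
have := @measurable_fun_fubini_tonelli_F _ _ _ _ _ leb Phi mPhi Phi0.
rewrite (_ : fubini_F _ _ = kernel_int d k)//.
apply/funext => y; rewrite /fubini_F /kernel_int [RHS]integral_mkcond.
apply: eq_integral => s _; rewrite patchE /Phi indicE !mem_setE /= !in_itv/= andbT.
by case: (0 < s); rewrite ?mulr1 ?mulr0.
Qed.

End KernelMeasurability.

Section Truncation.
Context {disp : measure_display} {T : measurableType disp} {R : realType}.
Variables (P : probability T R) (L : R -> T -> R).
Local Notation leb := (@lebesgue_measure R).
Variables d alpha h : R.
Hypotheses (d_gt0 : 0 < d) (d_lt : d < 1 / 2) (alpha_gt0 : 0 < alpha)
  (h_gt0 : 0 < h) (h_lt : h < 1 / 2 - d).
Hypothesis L1_L2 : (sqint P (L 1) < +oo)%E.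

Let d_lt1 : d < 1. Proof. by move: d_lt; lra. Qed.
Local Notation wt := (weight alpha h).
Local Notation F := (ma_kernel d alpha h).
Let G0 : 0 < Gamma d := Gamma_gt0 d_gt0 d_lt1.
Let wt_u : unit_kernel wt. Proof. exact: (@unit_kernel_weight R d). Qed.

Lemma moving_average_integrandE t :
  (fun u => (alpha / (alpha + t - u)) `^ (1 - h) * \1_(`]-oo, t[) u) =
  (fun u => wt (t - u)).
Proof.
apply/funext => u; rewrite /weight addrA; congr (_ * _).
by rewrite !indicE !mem_setE/= !in_itv/= andbT subr_gt0.
Qed.

Lemma frac_int_weight t : frac_int d (fun u => wt (t - u)) = (fun x => F (t - x)).
Proof. by apply/funext => x; rewrite frac_int_kernel. Qed.

Let head n v := wt v * \1_(`]-oo, n%:R[) v.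
Let tail n v := wt v * \1_(`[n%:R, +oo[) v.

Let tail_u n : unit_kernel (tail n).
Proof.
case: wt_u => m01 p01 p0; split.
- by apply: measurable_funM.
- move=> v; have /andP[h0 h1] := p01 v.
  have i0 : 0 <= \1_(`[n%:R, +oo[) v :> R by rewrite indicE ler0n.
  have i1 : \1_(`[n%:R, +oo[) v <= 1 :> R by rewrite indicE lern1 leq_b1.
  by rewrite /tail mulr_ge0//= mulr_ile1.
- by move=> v v0; rewrite /tail p0 ?mul0r.
Qed.

Let head_tail n t : (fun u => head n (t - u)) \- (fun u => wt (t - u)) =
  (fun u => - tail n (t - u)).
Proof.
apply/funext => u /=; rewrite /head /tail !indicE !mem_setE/= !in_itv/= andbT.
by rewrite leNgt; case: (_ < _); rewrite /= ?mulr1 ?mulr0; ring.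
Qed.

Let frac_int_tail n t x :
  frac_int d (fun u => - tail n (t - u)) x = - ((Gamma d)^-1 * fine (kernel_int d (tail n) (t - x))).
Proof.
rewrite /frac_int.
under eq_Rintegral do rewrite mulNr -mulN1r.
rewrite RintegralZl//; last exact: (integrable_kernel_shift d_gt0 t x (tail_u n)).
rewrite mulN1r mulrN; congr (- (_ * _)).
by rewrite -kernel_int_shift.
Qed.

Let tail_le n y : 0 <= (Gamma d)^-1 * fine (kernel_int d (tail n) y) <= F y.
Proof.
have Gi : 0 <= (Gamma d)^-1 by rewrite invr_ge0 ltW.
rewrite mulr_ge0 ?fine_ge0 ?(kernel_int_ge0 _ _ (tail_u n))//=.
rewrite ler_wpM2l// fine_le// ?(kernel_int_fin d_gt0 _ (tail_u n)) ?(kernel_int_fin d_gt0 _ wt_u)//.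
apply: le_kernel_int => // v; have [_ p01 _] := wt_u.
by rewrite ler_piMr// ?indicE ?lern1 ?leq_b1//; case/andP: (p01 v).
Qed.

Let tail_small n y : y < n%:R -> kernel_int d (tail n) y = 0%E.
Proof.
move=> yn; apply: integral0_eq => s /=; rewrite in_itv/= andbT => s0.
rewrite /tail indicE memNset ?mulr0 ?mul0r//= in_itv/= andbT; apply/negP; rewrite -ltNge.
by rewrite (lt_trans _ yn)// gtrBl.
Qed.

Lemma ma_kernel_L2 t : leb.-integrable setT (fun x : R => (F (t - x) ^+ 2)%:E).
Proof.
have [C C0 FC] := ma_kernel_envelope d_gt0 d_lt alpha_gt0 h_gt0 h_lt.
have p_lt : d + h - 1 < - 2^-1 by move: h_lt; lra.
pose E x := C * envelope (d + h - 1) x.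
have mE : measurable_fun setT E.
  by apply: measurable_funM => //; exact: measurable_envelope.
have mF : measurable_fun setT F by exact: measurable_ma_kernel.
have mFt : measurable_fun setT (fun x : R => F (t - x)).
  by apply: (measurableT_comp mF); exact: measurable_funB.
apply: (@sqint_integrable _ _ _ leb (fun x : R => F (t - x)) mFt).
rewrite /sqint (@integral_reflect _ t (fun x : R => (F x ^+ 2)%:E)); last 2 first.
- exact: measurable_sq.
- by move=> x; rewrite lee_fin sqr_ge0.
apply: (@le_lt_trans _ _ (sqint leb E)).
  apply: sqint_le => // y.
  have F0 : 0 <= F y by exact: ma_kernel_ge0.
  suff FE : F y <= E y by rewrite !ger0_norm// (le_trans F0).
  rewrite /E /envelope; case: ifPn => [_|]; first exact: FC.
  rewrite -leNgt => y1; have y0 : y <= 0 by lra.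
  by rewrite (@ma_kernel_le0 R d alpha h) ?mulr0.
rewrite sqintZ; last exact: measurable_envelope.
by rewrite lte_mul_pinfty// ?lee_fin ?sqr_ge0//; exact: envelope_L2.
Qed.

Lemma Lfun_bounded_support (f : R -> R) (a b : R) : measurable_fun setT f ->
  (forall x, `|f x| <= \1_(`[a, b]) x) -> f \in Lfun leb 1%E /\ f \in Lfun leb 2%:E.
Proof.
move=> mf fab.
have Iab : (\int[leb]_x (\1_(`[a, b]) x)%:E < +oo)%E.
  rewrite integral_indic// setIT /= lebesgue_measure_itv/=.
  by case: ifP => _; rewrite ltry.
split; rewrite inE; apply/andP; split; rewrite inE//=.
- rewrite /finite_norm Lnorm1; apply: le_lt_trans Iab.
  apply: ge0_le_integral => //.
  + by apply: measurableT_comp => //; exact/measurable_EFinP.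
  + by apply/measurable_EFinP.
  + by move=> x _ /=; rewrite lee_fin.
- rewrite /finite_norm Lnorm2_sqint; apply: poweR_lty; apply: le_lt_trans Iab.
  apply: ge0_le_integral => //.
  + by move=> x _; rewrite lee_fin sqr_ge0.
  + exact: measurable_sq.
  + by apply/measurable_EFinP.
  + move=> x _ /=; rewrite lee_fin -[leLHS]real_normK ?num_real//.
    have := fab x; rewrite indicE; case: (_ \in _) => /= h1.
      by rewrite expr_le1.
    by rewrite (_ : `|f x| = 0) ?expr0n//; apply/eqP; rewrite eq_le h1 normr_ge0.
Qed.

(** Truncation to lags below $n$ gives bounded functions with bounded support. The
    fractional integral of the rest lies between 0 and the square integrable
    $F$, and vanishes at lags below $n$, so its norm tends to 0. *)
Lemma in_H_moving_average t : in_H P L d (fun u => wt (t - u)).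
Proof.
have [mwt p01 p0] := wt_u.
have mpt : measurable_fun setT (fun u : R => wt (t - u)).
  by apply: (measurableT_comp mwt); exact: measurable_funB.
split => //.
  by apply: aeW => x; exact: (integrable_kernel_shift d_gt0 t x wt_u).
exists (fun n u => head n (t - u)).
  move=> n; apply: (@Lfun_bounded_support _ (t - n%:R) t).
    have mh : measurable_fun setT (head n) by exact: measurable_funM.
    by apply: (measurableT_comp mh); exact: measurable_funB.
  move=> u; have /andP[h0 h1] := p01 (t - u).
  have [u1|u1] := ltP t u.
    by rewrite /head p0 ?mul0r ?normr0 ?indicE ?ler0n// subr_le0 ltW.
  rewrite /head normrM [`|wt _|]ger0_norm// !indicE !mem_setE/= !in_itv/= u1 andbT normr_nat.
  have [u2|u2] := ltP (t - u) n%:R.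
    by rewrite (_ : t - n%:R <= u) ?mulr1//; lra.
  by rewrite mulr0 ler0n.
rewrite /H_normsq.
set c := ('E_P[_])%E.
have cE : c = sqint P (L 1) by rewrite /c unlock.
have E n : (\int[leb]_u (frac_int d ((fun u => head n (t - u)) \- (fun u => wt (t - u)))%R u ^+ 2)%:E =
    \int[leb]_u (((Gamma d)^-1 * fine (kernel_int d (tail n) (t - u))) ^+ 2)%:E)%E.
  rewrite (head_tail n t); apply: eq_integral => u _.
  by rewrite (frac_int_tail n t u) sqrrN.
under eq_fun do rewrite E.
rewrite -(mule0 c).
apply: cvgeZl; first by rewrite cE sqint_fin.
have mf n : measurable_fun setT (fun u : R => (((Gamma d)^-1 * fine (kernel_int d (tail n) (t - u))) ^+ 2)%:E).
  apply: measurable_sq; apply: measurable_funM => //.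
  have mk : measurable_fun setT (fun y => fine (kernel_int d (tail n) y)).
    exact: (measurableT_comp (fine_measurable measurableT) (measurable_kernel_int d (tail_u n))).
  by apply: (measurableT_comp mk); exact: measurable_funB.
have cf : {ae leb, forall x : R, setT x -> (((Gamma d)^-1 * fine (kernel_int d (tail n) (t - x))) ^+ 2)%:E @[n --> \oo] --> (cst 0%E x : \bar R)}.
  apply: aeW => x _; apply: cvg_near_cst.
  exists (Num.truncn (t - x)).+1 => // n /= xn.
  rewrite tail_small ?mulr0 ?expr0n//.
  by rewrite (lt_le_trans (truncnS_gt _))// ler_nat.
have dom : {ae leb, forall x : R, forall n, setT x -> (`|(((Gamma d)^-1 * fine (kernel_int d (tail n) (t - x))) ^+ 2)%:E| <=
    (F (t - x) ^+ 2)%:E)%E}.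
  apply: aeW => x n _; rewrite gee0_abs ?lee_fin ?sqr_ge0//.
  have /andP[h1 h2] := tail_le n (t - x).
  by rewrite ler_sqr ?nnegrE ?(le_trans h1).
have intE := ma_kernel_L2 t.
have [_ _] := @dominated_convergence _ _ R leb setT measurableT
  (fun n (u : R) => (((Gamma d)^-1 * fine (kernel_int d (tail n) (t - u))) ^+ 2)%:E) (cst 0%E)
  (fun x : R => (F (t - x) ^+ 2)%:E) mf (measurable_cst _) cf intE dom.
by rewrite integral0.
Qed.

(** The process $Z^d$ is the moving average with kernel [F] driven by $L$: its
    integrand belongs to $H$, and the fractional integral moves onto the kernel. *)
Lemma moving_average_levy_int t :
  frac_levy_int_upto P L d t (fun u => (alpha / (alpha + t - u)) `^ (1 - h)) =
  levy_int P L (fun x => F (t - x)).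
Proof.
rewrite /frac_levy_int_upto moving_average_integrandE /frac_levy_int.
case: asboolP => [_|]; first by rewrite frac_int_weight.
by move=> H; exfalso; apply: H; exact: in_H_moving_average.
Qed.

End Truncation.

(** * Laws of tuples and their limits *)

Section TupleLaws.
Context {disp : measure_display} {T : measurableType disp} {R : realType}.
Variables (P : probability T R) (n : nat).

Let quadrant (a : nat -> R) : set (n.-tuple R) :=
  [set x | forall i : 'I_n, tnth x i < a i].
Let quadrants : set (set (n.-tuple R)) := [set A | exists a, A = quadrant a].

Let measurable_quadrant a : measurable (quadrant a).
Proof.
rewrite (_ : quadrant a = \bigcap_(i in [set: 'I_n]) [set x | tnth x i < a i]); last first.
  by apply/seteqP; split => x /= xa i; [move=> _; exact: xa | exact: (xa i I)].
apply: fin_bigcap_measurable => // i _.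
have := @measurable_tnth _ R n i measurableT `]-oo, a i[%classic (measurable_itv _).
by rewrite setTI; congr measurable; apply/seteqP; split => x /=; rewrite in_itv.
Qed.

(** The lower-left quadrants generate the product $\sigma$-algebra: a half-space
    is the increasing union of the quadrants whose other sides go to infinity. *)
Let measurable_quadrants A : measurable A -> <<s quadrants >> A.
Proof.
have mid : measurable_fun [set: g_sigma_algebraType quadrants]
    (fun x : n.-tuple R => x).
  apply/measurable_fun_tnthP => i.
  apply: (measurability _ (RGenInftyO.measurableE R)) => // _ [_ [a ->] <-].
  rewrite setTI.
  rewrite (_ : _ @^-1` _ = \bigcup_k quadrant (fun j => if j == i :> nat then a else k%:R)).
    by apply: bigcupT_measurable => k; apply: sub_sigma_algebra; exists (fun j => if j == i :> nat then a else k%:R).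
  apply/seteqP; split => x /=; rewrite in_itv/=.
    move=> xa; pose K := (\max_(j < n) (Num.truncn (tnth x j)).+1)%N.
    exists K => // j; case: eqP => [/val_inj ->//|_].
    apply: lt_le_trans (truncnS_gt _) _; rewrite ler_nat.
    exact: (@leq_bigmax _ (fun j : 'I_n => (Num.truncn (tnth x j)).+1) j).
  by case=> k _ /(_ i); rewrite eqxx.
by move=> mA; have := mid measurableT A mA; rewrite setTI.
Qed.

(** Quadrants are stable under intersection and generate the $\sigma$-algebra. *)
Lemma tuple_law_unique (mu1 mu2 : probability (n.-tuple R) R) :
  (forall a, mu1 (quadrant a) = mu2 (quadrant a)) ->
  forall A, measurable A -> mu1 A = mu2 A.
Proof.
move=> E A mA.
apply: (g_sigma_algebra_measure_unique quadrants _ (fun k => quadrant (fun=> k%:R))).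
- by move=> _ [a ->].
- by move=> k; exists (fun=> k%:R).
- apply/seteqP; split => // x _.
  exists (\max_(j < n) (Num.truncn (tnth x j)).+1)%N => // j.
  apply: lt_le_trans (truncnS_gt _) _; rewrite ler_nat.
  exact: (@leq_bigmax _ (fun j : 'I_n => (Num.truncn (tnth x j)).+1) j).
- move=> _ _ [a ->] [b ->]; exists (fun i => Num.min (a i) (b i)).
  apply/seteqP; split => x /= => [[xa xb] i|xab].
    by rewrite lt_min xa xb.
  by split => i; have := xab i; rewrite lt_min => /andP[].
- by move=> _ [a ->]; exact: E.
- by move=> k; rewrite (le_lt_trans (probability_le1 _ _))// ?ltry.
- exact: measurable_quadrants.
Qed.

Lemma tuple_process_measurable (X : 'I_n -> T -> R) : (forall i, measurable_fun setT (X i)) ->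
  measurable_fun setT (fun w => [tuple X i w | i < n]).
Proof.
move=> mX; apply/measurable_fun_tnthP => i.
by rewrite (_ : _ \o _ = X i)//; apply/funext => w /=; rewrite tnth_mktuple.
Qed.

Lemma eq_tuple_law (X Y : 'I_n -> T -> R) :
  (forall i, measurable_fun setT (X i)) -> (forall i, measurable_fun setT (Y i)) ->
  (forall a : nat -> R, P [set w | forall i : 'I_n, X i w < a i] = P [set w | forall i : 'I_n, Y i w < a i]) ->
  forall A : set (n.-tuple R), measurable A ->
  P [set w | A [tuple X i w | i < n]] = P [set w | A [tuple Y i w | i < n]].
Proof.
move=> mX mY E.
pose Xr : {mfun T >-> n.-tuple R} := HB.pack (fun w => [tuple X i w | i < n])
  (isMeasurableFun.Build _ _ _ _ _ (tuple_process_measurable mX)).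
pose Yr : {mfun T >-> n.-tuple R} := HB.pack (fun w => [tuple Y i w | i < n])
  (isMeasurableFun.Build _ _ _ _ _ (tuple_process_measurable mY)).
apply: (@tuple_law_unique (distribution P Xr) (distribution P Yr)) => a.
rewrite /distribution /pushforward.
have EX (Z : 'I_n -> T -> R) : (fun w => [tuple Z i w | i < n]) @^-1` quadrant a =
    [set w | forall i : 'I_n, Z i w < a i].
  by apply/seteqP; split => w /= h i; have := h i; rewrite tnth_mktuple.
by rewrite [X in P X = _]EX [X in _ = P X]EX.
Qed.

End TupleLaws.

Section LimitLaws.
Context {disp : measure_display} {T : measurableType disp} {R : realType}.
Variables (P : probability T R) (n : nat).

Let box (X : 'I_n -> T -> R) (a : nat -> R) : set T :=
  [set w | forall i : 'I_n, X i w < a i].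

Let measurable_box X a : (forall i, measurable_fun setT (X i)) -> measurable (box X a).
Proof.
move=> mX.
rewrite (_ : box X a = \bigcap_(i in [set: 'I_n]) (X i @^-1` `]-oo, a i[)); last first.
  apply/seteqP; split => x /= xa i; first by move=> _; rewrite /= in_itv/=; exact: xa.
  by have := xa i I; rewrite /= in_itv.
apply: fin_bigcap_measurable => // i _.
by rewrite -[X in measurable X]setTI; exact: mX.
Qed.

(** Outside the events $|Y_i - X_i| \ge e$, whose probabilities Chebyshev's
    inequality bounds, a point of the smaller box for $X$ is in the box for $Y$. *)
Let box_perturb (X Y : 'I_n -> T -> R) (a : nat -> R) (e : R) : 0 < e ->
  (forall i, measurable_fun setT (X i)) -> (forall i, measurable_fun setT (Y i)) ->
  (P (box X (fun i => a i - e)%R) <= P (box Y a) + \sum_(i < n) (e ^- 2)%:E * sqint P (Y i \- X i)%R)%E.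
Proof.
move=> e0 mX mY.
have mYX i : measurable_fun setT (Y i \- X i) by exact: measurable_funB.
pose D (k : nat) := if insub k is Some i then [set w | e <= `|(Y i \- X i) w|] else set0.
have mD k : measurable (D k).
  rewrite /D; case: insub => [i|]; last exact: measurable0.
  rewrite -[X in measurable X]setTI.
  by apply: (@measurable_fun_le _ _ R setT (cst e)) => //; exact: measurableT_comp.
have mUD : measurable (\big[setU/set0]_(i < n) D i) by exact: bigsetU_measurable.
have mb := measurable_box a mY.
apply: (@le_trans _ _ (P (box Y a `|` \big[setU/set0]_(i < n) D i))).
  rewrite le_measure ?inE//; first exact: measurable_box.
    exact: measurableU.
  move=> w Xw; have [h|] := pselect (exists i : 'I_n, e <= `|Y i w - X i w|).
    case: h => i hi; right; rewrite -bigcup_mkord; exists (i : nat); first exact: ltn_ord.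
    by rewrite /D valK.
  move=> /forallNP h; left => i; have /negP := h i; rewrite -ltNge => hi.
  have := Xw i => /=; have := ler_norm (Y i w - X i w); lra.
apply: le_trans (measureU2 _ mb mUD) _; rewrite leeD2l//.
apply: le_trans (Boole_inequality _ _) _ => //.
apply: lee_sum => i _; rewrite /D; case: insubP => [j _ /val_inj ->|]; last by rewrite ltn_ord.
exact: sqint_chebyshev.
Qed.

Variables (X Y : 'I_n -> T -> R) (Xm Ym : nat -> 'I_n -> T -> R).
Hypotheses (mX : forall i, measurable_fun setT (X i)) (mY : forall i, measurable_fun setT (Y i))
  (mXm : forall m i, measurable_fun setT (Xm m i)) (mYm : forall m i, measurable_fun setT (Ym m i)).
Hypotheses (cX : forall i, (sqint P (Xm m i \- X i)%R @[m --> \oo] --> 0)%E)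
  (cY : forall i, (sqint P (Ym m i \- Y i)%R @[m --> \oo] --> 0)%E).
Hypothesis XYm : forall m a, P (box (Xm m) a) = P (box (Ym m) a).

(** Passing from $X$ to its approximation and from the approximation to $Y$ each
    costs a shift of $e$ of the sides of the box; then let the approximations
    converge, and $e$ tend to 0. Boxes are open, hence increasing unions of their
    shrunken copies. *)
Lemma limit_law_le a : (P (box X a) <= P (box Y a))%E.
Proof.
have step (e : R) : 0 < e -> (P (box X (fun i => a i - e - e)%R) <= P (box Y a))%E.
  move=> e0.
  have cs (Z : 'I_n -> T -> R) (Zm : nat -> 'I_n -> T -> R) :
      (forall i, (sqint P (Zm m i \- Z i)%R @[m --> \oo] --> 0)%E) ->
      (\sum_(i < n) (e ^- 2)%:E * sqint P (Zm m i \- Z i)%R @[m --> \oo] --> 0)%E.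
    move=> cZ; rewrite -[X in _ --> X](_ : \sum_(i < n) (e ^- 2)%:E * 0 = 0)%E; last first.
      by rewrite big1// => i _; rewrite mule0.
    apply: cvg_nnesum => i _; last exact: cvgeZl.
    by apply: nearW => m; rewrite mule_ge0 ?sqint_ge0// lee_fin invr_ge0 exprn_ge0// ltW.
  have c : (\sum_(i < n) (e ^- 2)%:E * sqint P (Xm m i \- X i)%R +
       \sum_(i < n) (e ^- 2)%:E * sqint P (Ym m i \- Y i)%R @[m --> \oo] --> 0)%E.
    by rewrite -[X in _ --> X]adde0; apply: cvgeD => //; exact: cs.
  have c2 : (P (box Y a) + (\sum_(i < n) (e ^- 2)%:E * sqint P (Xm m i \- X i)%R +
       \sum_(i < n) (e ^- 2)%:E * sqint P (Ym m i \- Y i)%R) @[m --> \oo] --> P (box Y a))%E.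
    rewrite -[X in _ --> X]adde0; apply: cvgeD => //; last exact: cvg_cst.
    by rewrite fin_num_adde_defl.
  apply: (cvge_to_ge c2); apply: nearW => m.
  apply: le_trans (box_perturb (fun i => a i - e) e0 mX (mXm m)) _.
  rewrite XYm addeA [leRHS]addeAC leeD2r//.
  apply: le_trans (box_perturb a e0 (mYm m) mY) _; rewrite leeD2l//.
  by apply: lee_sum => i _; rewrite sqintBC.
pose F k := box X (fun i => a i - k.+1%:R^-1 - k.+1%:R^-1).
have UF : box X a = \bigcup_k F k.
  apply/seteqP; split => [w Xw|w [k _ Fw] i].
    pose K := (\max_(j < n) Num.truncn (2 / (a j - X j w)))%N.
    exists K => // i /=; have ai : 0 < a i - X i w by rewrite subr_gt0; exact: Xw.
    have : 2 / (a i - X i w) < K.+1%:R.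
      apply: lt_le_trans (truncnS_gt _) _; rewrite ler_nat ltnS.
      exact: (@leq_bigmax _ (fun j : 'I_n => Num.truncn (2 / (a j - X j w))) i).
    rewrite ltr_pdivrMr// mulrC -ltr_pdivrMr// => h.
    by move: h; move: (K.+1%:R^-1) => z; lra.
  apply: lt_le_trans (Fw i) _.
  have : 0 < k.+1%:R^-1 :> R by rewrite invr_gt0.
  by move: (k.+1%:R^-1) => z; lra.
have mF k : measurable (F k) by exact: measurable_box.
have := @nondecreasing_cvg_mu _ _ _ P F mF; rewrite -UF.
move=> /(_ (measurable_box _ mX)) H.
have {}H : (P \o F) k @[k --> \oo] --> P (box X a).
  apply: H => k l kl; rewrite subsetEset => w Fw i.
  apply: lt_le_trans (Fw i) _.
  have : l.+1%:R^-1 <= k.+1%:R^-1 :> R by rewrite lef_pV2 ?posrE// ler_nat.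
  by move: (k.+1%:R^-1) (l.+1%:R^-1) => y z; lra.
apply: (cvge_to_le H); apply: nearW => k.
by apply: step; rewrite invr_gt0.
Qed.

End LimitLaws.

(** * Increments on a grid *)

Section GridLaws.
Context {disp : measure_display} {T : measurableType disp} {R : realType}.
Variable P : probability T R.

Lemma ae_eq_probability (A B : set T) : measurable A -> measurable B ->
  {ae P, forall w, A w <-> B w} -> P A = P B.
Proof.
move=> mA mB AB; rewrite -(setIT A) -(setIT B) -!integral_indic//.
apply: ge0_ae_eq_integral => //.
- by apply/measurable_EFinP.
- by apply/measurable_EFinP.
- apply: filterS AB => w [h1 h2] _; rewrite !indicE.
  by congr (EFin (nat_of_bool _)%:R); apply/idP/idP => /set_mem h; apply/mem_set; auto.
Qed.

Lemma measurable_forall_lt N (V : nat -> T -> R) (B : nat -> set R) :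
  (forall j, (j < N)%N -> measurable_fun setT (V j)) -> (forall j, measurable (B j)) ->
  measurable [set w | forall j, (j < N)%N -> B j (V j w)].
Proof.
move=> mV mB.
rewrite (_ : mkset _ = \bigcap_(j in `I_N) (V j @^-1` B j)); last by [].
apply: fin_bigcap_measurable; first exact: finite_II.
by move=> j jN; rewrite -[X in measurable X]setTI; exact: mV.
Qed.

Section OneSided.
Variable X : R -> T -> R.
Hypothesis X_levy : levy_process P X.

Lemma levy_grid_law (delta : R) M (B : nat -> set R) : 0 <= delta ->
  (forall j, measurable (B j)) ->
  P [set w | forall j, (j < M)%N -> B j (X (j.+1%:R * delta) w - X (j%:R * delta) w)] =
  (\prod_(0 <= j < M) P (X delta @^-1` B j))%E.
Proof.
move=> d0 mB; case: X_levy => -[_ _ iX _ _] _.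
have := iX (fun j => j%:R * delta) _ _ M (fun i => B i) (fun i => mB i).
rewrite mul0r lexx => /(_ isT) H.
rewrite big_mkord.
transitivity (P [set w | forall i : 'I_M, B i (X (i.+1%:R * delta) w - X (i%:R * delta) w)]).
  congr (P _); apply/seteqP; split => w /= h; first by move=> i; exact: h.
  by move=> j jM; exact: (h (Ordinal jM)).
rewrite H; last by move=> i; rewrite ler_wpM2r// ler_nat.
apply: eq_bigr => i _.
have := @levy_increment_law _ _ _ P X X_levy (i%:R * delta) (i.+1%:R * delta) (B i).
rewrite mulr_ge0// => /(_ isT); rewrite ler_wpM2r ?ler_nat// => /(_ isT (mB i)).
by rewrite -mulrBl -natrB// subSnn mul1r.
Qed.

Lemma sigma_of_grid (delta : R) M (B : nat -> set R) : 0 <= delta ->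
  (forall j, measurable (B j)) ->
  sigma_of [set t | 0 <= t] X
    [set w | forall j, (j < M)%N -> B j (X (j.+1%:R * delta) w - X (j%:R * delta) w)].
Proof.
move=> d0 mB.
have nn (j : nat) : [set t | 0 <= t] (j%:R * delta) by rewrite /= mulr_ge0.
pose G := [set A : set T | exists t B, [/\ [set t : R | 0 <= t] t, measurable B & A = X t @^-1` B]].
rewrite (_ : mkset _ = \bigcap_(j in `I_M)
   ((X (j.+1%:R * delta) \- X (j%:R * delta)) @^-1` B j)); last by [].
have := @fin_bigcap_measurable _ (g_sigma_algebraType G) nat `I_M
   (fun j => (X (j.+1%:R * delta) \- X (j%:R * delta)) @^-1` B j) (finite_II M).
apply=> j _.
have := measurable_funB (@sigma_of_measurable _ _ _ [set t | 0 <= t] X _ (nn j.+1))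
      (@sigma_of_measurable _ _ _ [set t | 0 <= t] X _ (nn j)).
by move=> /(_ measurableT (B j) (mB j)); rewrite setTI.
Qed.

End OneSided.

Variable L : R -> T -> R.
Variables X1 X2 : R -> T -> R.
Hypotheses (X1_levy : levy_process P X1) (X2_levy : levy_process P X2).
Hypothesis X12_ind : independent_processes P [set t | 0 <= t] X1 X2.
Hypothesis X12_law : same_law P [set t | 0 <= t] X1 X2.
Hypothesis LE : forall t w, L t w = (if 0 <= t then X1 t w else 0) -
                          (if t <= 0 then X2 (- t) w else 0).

Let mL t : measurable_fun setT (L t).
Proof. exact: (two_sided_measurable X1_levy X2_levy LE). Qed.

Definition grid_increment (delta : R) (M j : nat) (w : T) : R :=
  L ((- M%:R + j.+1%:R) * delta) w - L ((- M%:R + j%:R) * delta) w.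

Lemma measurable_grid_increment delta M j : measurable_fun setT (grid_increment delta M j).
Proof. exact: measurable_funB. Qed.

(** Cells on the right of 0 carry increments of $X_1$, cells on the left carry
    increments of $X_2$ in reverse order. *)
Lemma grid_law delta M (B : nat -> set R) : 0 <= delta -> (forall j, measurable (B j)) ->
  P [set w | forall j, (j < M + M)%N -> B j (grid_increment delta M j w)] =
  (\prod_(0 <= j < M + M) P (X1 delta @^-1` B j))%E.
Proof.
move=> d0 mB.
pose S1 := [set w | forall j, (j < M)%N -> B (M + j)%N (X1 (j.+1%:R * delta) w - X1 (j%:R * delta) w)].
pose S2 := [set w | forall j, (j < M)%N -> B (M - j.+1)%N (X2 (j.+1%:R * delta) w - X2 (j%:R * delta) w)].
have jd (j : nat) : 0 <= j%:R * delta by rewrite mulr_ge0.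
have mS1 : measurable S1.
  by apply: (@measurable_forall_lt M _ (fun j => B (M + j)%N)) => // j _; exact: (levy_increment_measurable X1_levy).
have mS2 : measurable S2.
  by apply: (@measurable_forall_lt M _ (fun j => B (M - j.+1)%N)) => // j _; exact: (levy_increment_measurable X2_levy).
have -> : P [set w | forall j, (j < M + M)%N -> B j (grid_increment delta M j w)] = P (S1 `&` S2).
  apply: ae_eq_probability.
  - by apply: measurable_forall_lt => // j _; exact: measurable_grid_increment.
  - exact: measurableI.
  - apply: filterS (two_sided_ae X1_levy X2_levy LE) => w Lw.
    have E1 j : grid_increment delta M (M + j) w = X1 (j.+1%:R * delta) w - X1 (j%:R * delta) w.
      rewrite /grid_increment -addnS !natrD !addrA !(addNr, add0r) !Lw.
      rewrite !(max_l (jd _)) !(max_r (x := - _)) ?oppr_le0//; ring.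
    have E2 j : (j < M)%N -> grid_increment delta M (M - j.+1) w = X2 (j.+1%:R * delta) w - X2 (j%:R * delta) w.
      move=> jM; rewrite /grid_increment -subSn// subSS !natrB ?(ltnW jM)//.
      rewrite (_ : - M%:R + (M%:R - j%:R) = - j%:R); last by ring.
      rewrite (_ : - M%:R + (M%:R - j.+1%:R) = - j.+1%:R); last by ring.
      rewrite !mulNr !Lw !opprK !(max_l (jd _)) !(max_r (x := - _)) ?oppr_le0//; ring.
    split => [h|[h1 h2] j jMM].
      split=> j jM; first by rewrite -E1; apply: h; rewrite ltn_add2l.
      by rewrite -E2//; apply: h; rewrite (leq_ltn_trans (leq_subr _ _))// -addn1 leq_add2l (leq_trans _ jM).
    have [Mj|jM] := leqP M j.
      have := h1 (j - M)%N; rewrite -E1 subnKC//; apply.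
      by rewrite ltn_subLR.
    have jM' : (M - j.+1 < M)%N by rewrite ltn_subrL (leq_trans _ jM).
    by have := h2 _ jM'; rewrite -E2// subnSK// subKn// ltnW.
rewrite X12_ind; last 2 first.
- exact: (@sigma_of_grid X1 delta M (fun j => B (M + j)%N)).
- exact: (@sigma_of_grid X2 delta M (fun j => B (M - j.+1)%N)).
rewrite (@levy_grid_law X1 X1_levy delta M (fun j => B (M + j)%N))//.
rewrite (@levy_grid_law X2 X2_levy delta M (fun j => B (M - j.+1)%N))//.
rewrite (@big_cat_nat _ _ _ M 0 (M + M))//= ?leq_addr// muleC; congr (_ * _)%E.
  rewrite [RHS]big_nat_rev/= add0n; apply: eq_bigr => j _.
  by rewrite -(same_law_marginal X12_law).
transitivity (\prod_(0 + M <= j < M + M) P (X1 delta @^-1` B j))%E; last by rewrite add0n.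
by rewrite big_addn addnK; apply: eq_bigr => j _; rewrite addnC.
Qed.

(** Leave the increments outside the window unconstrained: [grid_law] then gives the
    same product for all windows of the same size, so the laws agree on quadrants. *)
Lemma window_law delta M N j0 (A : set (N.-tuple R)) : 0 <= delta -> (j0 + N <= M + M)%N ->
  measurable A ->
  P [set w | A [tuple grid_increment delta M (j0 + i) w | i < N]] =
  P [set w | A [tuple grid_increment delta M i w | i < N]].
Proof.
move=> d0 jN mA.
have NM : (N <= M + M)%N by exact: leq_trans (leq_addl _ _) jN.
have win k (b : nat -> R) : (k + N <= M + M)%N ->
    P [set w | forall i : 'I_N, grid_increment delta M (k + i) w < b i] =
    (\prod_(0 <= j < N) P (X1 delta @^-1` `]-oo, b j[))%E.
  move=> kN.
  pose B j := if ((k <= j) && (j < k + N))%N then `]-oo, b (j - k)%N[%classic else [set: R].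
  have mB j : measurable (B j) by rewrite /B; case: ifP => // _; exact: measurable_itv.
  transitivity (P [set w | forall j, (j < M + M)%N -> B j (grid_increment delta M j w)]).
    congr (P _); apply/seteqP; split => w /= h.
      move=> j jMM; rewrite /B; case: ifPn => // /andP[h1 h2]; rewrite /= in_itv/=.
      have jk : (j - k < N)%N by rewrite ltn_subLR.
      by have := h (Ordinal jk); rewrite /= subnKC.
    move=> i; have := h (k + i)%N; rewrite /B leq_addr ltn_add2l ltn_ord/= addKn in_itv/=.
    by apply; rewrite (leq_trans _ kN)// ltn_add2l.
  rewrite (grid_law M d0 mB).
  rewrite (@big_cat_nat _ _ _ k 0 (M + M))//=; last by rewrite (leq_trans (leq_addr N k)).
  rewrite (@big_cat_nat _ _ _ (k + N) k (M + M))//= ?leq_addr//.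
  rewrite big_nat_cond [X in (X * _)%E]big1 ?mul1e; last first.
    move=> j /andP[/andP[_ jk] _]; rewrite /B leqNgt jk/= preimage_setT.
    exact: probability_setT.
  rewrite [X in (_ * X)%E]big_nat_cond [X in (_ * X)%E]big1 ?mule1; last first.
    move=> j /andP[/andP[jk _] _]; rewrite /B ltnNge jk/= andbF preimage_setT.
    exact: probability_setT.
  transitivity (\prod_(0 + k <= j < k + N) P (X1 delta @^-1` B j))%E; first by rewrite add0n.
  rewrite big_addn addKn; apply: eq_big_nat => j /andP[_ jN'].
  by rewrite /B addnK leq_addl addnC ltn_add2l jN'.
apply: (@eq_tuple_law _ _ _ P N (fun i => grid_increment delta M (j0 + i))
  (fun i => grid_increment delta M i)) => //.
- by move=> i; exact: measurable_grid_increment.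
- by move=> i; exact: measurable_grid_increment.
- by move=> b; rewrite win// -(win 0%N).
Qed.

End GridLaws.

(** * Stationarity and long memory of the moving average *)

(** A negative shift undoes a positive one. *)
Lemma stationary_forward {disp : measure_display} {T : measurableType disp} {R : realType}
    (P : probability T R) (X : R -> T -> R) :
  (forall n (t : n.-tuple R) s (A : set (n.-tuple R)), 0 < s -> measurable A ->
     P [set w | A [tuple X (tnth t i + s) w | i < n]] =
     P [set w | A [tuple X (tnth t i) w | i < n]]) ->
  stationary P X.
Proof.
move=> shiftX n t s A mA.
have shiftE (u : n.-tuple R) (r : R) w :
    [tuple X (tnth [tuple tnth u i + r | i < n] i) w | i < n] =
    [tuple X (tnth u i + r) w | i < n].
  by apply: eq_mktuple => i; rewrite tnth_mktuple.
have fddE (u : n.-tuple R) (r : R) : fdd P X [tuple tnth u i + r | i < n] A =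
    P [set w | A [tuple X (tnth u i + r) w | i < n]].
  by rewrite /fdd /pushforward; congr (P _); apply/funext => w; exact: (congr1 A (shiftE u r w)).
rewrite fddE; have [s0|s0|<-] := ltgtP 0 s.
- exact: shiftX.
- pose u := [tuple tnth t i + s | i < n].
  have uE : [tuple tnth u i - s | i < n] = t.
    by apply: eq_from_tnth => i; rewrite !tnth_mktuple addrK.
  rewrite -[in RHS]uE fddE (shiftX n u (- s)) ?oppr_gt0//; congr (P _); apply/funext => w.
  by congr (A _); apply: eq_mktuple => i; rewrite tnth_mktuple.
- rewrite /fdd /pushforward; congr (P _); apply/funext => w.
  by congr (A _); apply: eq_mktuple => i; rewrite addr0.
Qed.

Section MovingAverageProcess.
Context {disp : measure_display} {T : measurableType disp} {R : realType}.
Variables (P : probability T R) (L : R -> T -> R).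
Local Notation leb := (@lebesgue_measure R).
Hypothesis L_levy : two_sided_levy_process P L.
Hypothesis L1_L2 : (sqint P (L 1) < +oo)%E.
Hypothesis L1_mean : (\int[P]_w (L 1 w)%:E = 0)%E.
Variables d alpha h : R.
Hypotheses (d_gt0 : 0 < d) (d_lt : d < 1 / 2) (alpha_gt0 : 0 < alpha)
  (h_gt0 : 0 < h) (h_lt : h < 1 / 2 - d).
Local Notation F := (ma_kernel d alpha h).

Let s2 := fine (sqint P (L 1)).
Let s2_ge0 : 0 <= s2. Proof. by rewrite fine_ge0// sqint_ge0. Qed.

Definition moving_average (t : R) : T -> R := levy_int P L (fun x => F (t - x)).
Local Notation Z := moving_average.

Let mL t : measurable_fun setT (L t).
Proof. by case: L_levy => X1 [X2 [[l1 l2] _ _ LE]]; exact: (two_sided_measurable l1 l2 LE). Qed.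

Let L_increment s t : sqint P (L t \- L s) = (`|t - s| * s2)%:E.
Proof.
case: L_levy => X1 [X2 [[l1 l2] ind law LE]].
exact: (two_sided_increment_sqint l1 l2 ind law LE L1_L2 L1_mean).
Qed.

Let mFt t : measurable_fun setT (fun x : R => F (t - x)).
Proof.
have mF : measurable_fun setT F by exact: measurable_ma_kernel.
by apply: (measurableT_comp mF); exact: measurable_funB.
Qed.

(** Grids of mesh $s/m$ with $m$ a growing integer: translation by $s$ is
    translation by $m$ cells. Both the window starting at cell $m$ and its
    translate lie in a symmetric grid with $2(m^2 + m)$ cells. *)
Let nsub (s : R) k := (k.+1 + Num.truncn s)%N.
Let mesh s k : R := s / (nsub s k)%:R.
Let half s k := (nsub s k * nsub s k + nsub s k)%N.
Let ncells s k := (nsub s k * nsub s k + nsub s k * nsub s k)%N.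
Let start s k j0 : R := - (half s k)%:R + (j0 * nsub s k)%:R.
Let grid s j0 t k := grid_steps F t (mesh s k) (start s k j0) (ncells s k).

Let nsub_gt0 s k : 0 < (nsub s k)%:R :> R. Proof. by rewrite ltr0n. Qed.

Let nsub_mesh s k : (nsub s k)%:R * mesh s k = s.
Proof. by rewrite mulrC divfK// gt_eqF. Qed.

Let mesh_gt0 s k : 0 < s -> 0 < mesh s k.
Proof. by move=> s0; rewrite divr_gt0. Qed.

Let mesh_le1 s k : 0 < s -> mesh s k <= 1.
Proof.
move=> s0; rewrite ler_pdivrMr// mul1r (le_trans (ltW (truncnS_gt _)))//.
by rewrite ler_nat /nsub addSn ltnS leq_addl.
Qed.

Let mesh_cvg s : 0 < s -> mesh s k @[k --> \oo] --> 0.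
Proof.
move=> s0; apply: (@squeeze_cvgr _ _ _ _ (cst 0) (fun k => s * harmonic k)).
- apply: nearW => k; rewrite (ltW (mesh_gt0 k s0))/= ler_pM2l// lef_pV2 ?posrE//.
  by rewrite ler_nat /nsub leq_addr.
- exact: cvg_cst.
- by rewrite -(mulr0 s); apply: cvgMr; exact: cvg_harmonic.
Qed.

Let start_mesh s k j0 : start s k j0 * mesh s k = - (nsub s k)%:R * s - s + j0%:R * s.
Proof.
have := nsub_mesh s k; rewrite /start /half natrD !natrM.
by move: (mesh s k) (nsub s k)%:R => e m <-; ring.
Qed.

Let grid_covers s j0 : 0 < s -> (j0 = 1 \/ j0 = 2)%N -> forall x, \forall k \near \oo,
  start s k j0 * mesh s k < x <= (start s k j0 + (ncells s k)%:R) * mesh s k.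
Proof.
move=> s0 j12 x.
have j1 : 1 <= j0%:R :> R by case: j12 => ->; rewrite ler1n.
have j2 : j0%:R <= 2 :> R by case: j12 => ->; rewrite ler_nat.
exists (Num.truncn (`|x| / s + 2)) => // k /= kx.
have kx' : `|x| / s + 2 < (nsub s k)%:R.
  by rewrite (lt_le_trans (truncnS_gt _))// ler_nat /nsub addSn ltnS (leq_trans kx)// leq_addr.
have {}kx' : `|x| < ((nsub s k)%:R - 2) * s by rewrite -ltr_pdivrMr// ltrBrDr.
rewrite [X in _ < _ <= X]mulrDl !start_mesh /ncells [X in _ < _ <= _ + X * _]natrD natrM.
rewrite [X in _ < _ <= _ + X]mulrDl -!(mulrA (nsub s k)%:R) nsub_mesh.
have js1 : s <= j0%:R * s by rewrite ler_peMl// ltW.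
have js2 : j0%:R * s <= 2 * s by rewrite ler_wpM2r// ltW.
have := ler_norm x; have := ler_norm (- x); rewrite normrN.
by move: kx'; move: (nsub s k)%:R => m; move: `|x| (j0%:R * s) js1 js2 => y z *; apply/andP; split; nra.
Qed.

Let grid_wf s j0 t k : 0 < s -> step_wf (grid s j0 t k).
Proof. by move=> s0; apply: grid_steps_wf; rewrite ltW// mesh_gt0. Qed.

Let grid_cvg s j0 t : 0 < s -> (j0 = 1 \/ j0 = 2)%N ->
  (sqint leb (step_fun (grid s j0 t k) \- (fun x : R => F (t - x)))%R @[k --> \oo] --> 0)%E.
Proof.
move=> s0 j12; have [C C0 FC] := ma_kernel_envelope d_gt0 d_lt alpha_gt0 h_gt0 h_lt.
have p_lt : d + h - 1 < - 2^-1 by move: h_lt; lra.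
apply: (grid_steps_cvg _ _ _ C0 FC p_lt).
- exact: continuous_ma_kernel.
- exact: ma_kernel_ge0.
- exact: (@ma_kernel_le0 R d alpha h).
- by move=> k; exact: mesh_gt0.
- by move=> k; exact: mesh_le1.
- exact: mesh_cvg.
- exact: grid_covers.
Qed.

Lemma moving_averageP t : is_levy_int P L (fun x => F (t - x)) (Z t).
Proof.
apply: (levy_intP mL L_increment s2_ge0 (mFt t) (q := grid 1 1 t)).
- by move=> k; exact: grid_wf.
- by apply: grid_cvg => //; left.
Qed.

Lemma measurable_moving_average t : measurable_fun setT (Z t).
Proof. by case: (moving_averageP t). Qed.

Let step_int_cvg s j0 t : 0 < s -> (j0 = 1 \/ j0 = 2)%N ->
  (sqint P (step_int L (grid s j0 t k) \- Z t)%R @[k --> \oo] --> 0)%E.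
Proof.
move=> s0 j12; apply: (is_levy_int_cvg mL L_increment (mFt t) (moving_averageP t)).
- by move=> k; exact: grid_wf.
- exact: grid_cvg.
Qed.

Let step_int_grid s j0 t k w : step_int L (grid s j0 t k) w =
  \sum_(i < ncells s k) F (t - (- (half s k)%:R + (j0 * nsub s k + i)%:R) * mesh s k) *
    grid_increment L (mesh s k) (half s k) (j0 * nsub s k + i) w.
Proof.
rewrite /step_int /grid /grid_steps /mkseq big_map -[X in iota 0 X]subn0 -/(index_iota 0 _) big_mkord.
apply: eq_bigr => i _; rewrite /grid_increment /start.
by rewrite -addnS !natrD !addrA.
Qed.

Let measurable_step_intL q : measurable_fun setT (step_int L q).
Proof. exact: measurable_step_int. Qed.

(** When the times and the window move by $s$ together, the sampled values of $F$
    do not change. The two step integrals are then the same function of the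
    increments of $L$ in two windows of the same size. *)
Lemma moving_average_shift n (t : n.-tuple R) s (A : set (n.-tuple R)) : 0 < s ->
  measurable A ->
  P [set w | A [tuple Z (tnth t i + s) w | i < n]] = P [set w | A [tuple Z (tnth t i) w | i < n]].
Proof.
move=> s0 mA; case: L_levy => X1 [X2 [[l1 l2] ind law LE]].
have E k (a : nat -> R) :
    P [set w | forall i : 'I_n, step_int L (grid s 2 (tnth t i + s) k) w < a i] =
    P [set w | forall i : 'I_n, step_int L (grid s 1 (tnth t i) k) w < a i].
  pose c (i : 'I_n) (j : nat) := F (tnth t i - (- (half s k)%:R + (1 * nsub s k + j)%:R) * mesh s k).
  pose B := [set x : (ncells s k).-tuple R | forall i : 'I_n, \sum_(j < ncells s k) c i j * tnth x j < a i].
  have mB : measurable B.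
    rewrite (_ : B = \bigcap_(i in [set: 'I_n])
      ((fun x : (ncells s k).-tuple R => \sum_(j < ncells s k) c i j * tnth x j) @^-1` `]-oo, a i[)); last first.
      apply/seteqP; split => x /= xa i; first by move=> _; rewrite /= in_itv/=; exact: xa.
      by have := xa i I; rewrite /= in_itv.
    apply: fin_bigcap_measurable => // i _.
    have mS : measurable_fun setT (fun x : (ncells s k).-tuple R => \sum_(j < ncells s k) c i j * tnth x j).
      apply: measurable_sum => j; apply: measurable_funM => //; exact: measurable_tnth.
    by rewrite -[X in measurable X]setTI; exact: mS.
  have gridS i j : tnth t i + s - (- (half s k)%:R + (2 * nsub s k + j)%:R) * mesh s k =
      tnth t i - (- (half s k)%:R + (1 * nsub s k + j)%:R) * mesh s k.
    have := nsub_mesh s k; move: (mesh s k) (nsub s k) (half s k) => e m H <-.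
    by rewrite (natrD _ (2 * m)%N) (natrD _ (1 * m)%N) mul1n natrM; ring.
  have W j0 : (j0 = 1 \/ j0 = 2)%N ->
      P [set w | B [tuple grid_increment L (mesh s k) (half s k) (j0 * nsub s k + i) w | i < ncells s k]] =
      P [set w | B [tuple grid_increment L (mesh s k) (half s k) i w | i < ncells s k]].
    move=> j12; apply: (window_law l1 l2 ind law LE) => //; first by rewrite ltW// mesh_gt0.
    rewrite /ncells /half; rewrite addnACA addnC leq_add2l addnn -mul2n leq_mul2r.
    by case: j12 => ->; rewrite orbT.
  transitivity (P [set w | B [tuple grid_increment L (mesh s k) (half s k) (2 * nsub s k + i) w | i < ncells s k]]).
    congr (P _); apply/seteqP; split => w /= H i; have := H i; rewrite step_int_grid.
      by congr (_ < _); apply: eq_bigr => j _; rewrite tnth_mktuple gridS.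
    by congr (_ < _); apply: eq_bigr => j _; rewrite tnth_mktuple gridS.
  rewrite W; last by right.
  rewrite -(W 1%N); last by left.
  congr (P _); apply/seteqP; split => w /= H i; have := H i; rewrite step_int_grid.
    by congr (_ < _); apply: eq_bigr => j _; rewrite tnth_mktuple.
  by congr (_ < _); apply: eq_bigr => j _; rewrite tnth_mktuple.
pose U (i : 'I_n) := Z (tnth t i + s); pose V (i : 'I_n) := Z (tnth t i).
pose Um k (i : 'I_n) := step_int L (grid s 2 (tnth t i + s) k).
pose Vm k (i : 'I_n) := step_int L (grid s 1 (tnth t i) k).
have mU i : measurable_fun setT (U i) by exact: measurable_moving_average.
have mV i : measurable_fun setT (V i) by exact: measurable_moving_average.
have mUm k i : measurable_fun setT (Um k i) by exact: measurable_step_intL.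
have mVm k i : measurable_fun setT (Vm k i) by exact: measurable_step_intL.
have cU i : (sqint P (Um k i \- U i)%R @[k --> \oo] --> 0)%E.
  by apply: step_int_cvg => //; right.
have cV i : (sqint P (Vm k i \- V i)%R @[k --> \oo] --> 0)%E.
  by apply: step_int_cvg => //; left.
apply: (eq_tuple_law mU mV _ mA) => a; apply/eqP; rewrite eq_le; apply/andP; split.
  exact: (limit_law_le mU mV mUm mVm cU cV E).
exact: (limit_law_le mV mU mVm mUm cV cU (fun k b => esym (E k b))).
Qed.

Lemma moving_average_stationary : stationary P Z.
Proof. exact: stationary_forward moving_average_shift. Qed.

(** A centered process whose increments have variance 0 stays at its initial
    value, which is 0. *)
Lemma two_sided_variance_gt0 : not_identically_zero P L -> 0 < s2.
Proof.
move=> L0; rewrite lt0r fine_ge0 ?sqint_ge0// andbT; apply: contra_notP L0 => /negP/negPn/eqP s0 t.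
have L0 : {ae P, forall w, L 0 w = 0}.
  case: L_levy => X1 [X2 [[[[_ X10 _ _ _] _] [[_ X20 _ _ _] _]] _ _ LE]].
  by apply: filterS2 X10 X20 => w w1 w2; rewrite LE lexx oppr0 w1 w2 subrr.
have := L_increment 0 t; rewrite s0 mulr0 => /sqint_eq0 H.
have {}H := H (measurable_funB (mL t) (mL 0)).
by apply: filterS2 L0 H => w h0 /= /eqP; rewrite subr_eq0 h0 => /eqP.
Qed.

Lemma moving_average_covariance s t :
  ('E_P[fun w => (Z s w * Z t w)%R] =
   s2%:E * \int[leb]_x (F (s - x) * F (t - x))%:E)%E.
Proof.
rewrite unlock; apply: (levy_int_covariance mL L_increment) => //.
- exact: moving_averageP.
- exact: moving_averageP.
Qed.

(** Integrate over $x \in [-2, -1]$ only: $F(-x)$ is bounded below by a constant and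
    $F(n - x)$ by a multiple of $1/n$, as $\alpha + n + 2 \le (\alpha + 3) n$. *)
Lemma moving_average_covariance_ge n : (0 < n)%N ->
  (((Gamma d)^-1 ^+ 2 * (alpha ^+ 2 / ((alpha + 2) * (alpha + 3))) * s2 * n%:R^-1)%:E <=
   'E_P[fun w => (Z 0 w * Z n%:R w)%R])%E.
Proof.
move=> n0; rewrite moving_average_covariance.
have n1 : 1 <= n%:R :> R by rewrite ler1n.
have n0' : 0 < n%:R :> R := lt_le_trans ltr01 n1.
have G0 : 0 < Gamma d by apply: Gamma_gt0 => //; move: d_lt; lra.
set c := _ ^+ 2 * _.
have -> : (c * s2 * n%:R^-1)%:E = (s2%:E * (c * n%:R^-1)%:E)%E by rewrite -EFinM; congr EFin; ring.
apply: lee_wpmul2l; first by rewrite lee_fin fine_ge0// sqint_ge0.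
pose b : R := (Gamma d)^-1 * (alpha / (alpha + 2)).
pose b' : R := (Gamma d)^-1 * (alpha / ((alpha + 3) * n%:R)).
have Gi : 0 < (Gamma d)^-1 by rewrite invr_gt0.
have a2 : 0 < alpha + 2 by rewrite addr_gt0.
have a3 : 0 < alpha + 3 by rewrite addr_gt0.
have b0 : 0 <= b by rewrite mulr_ge0 ?(ltW Gi)// divr_ge0// ltW.
have b'0 : 0 <= b' by rewrite mulr_ge0 ?(ltW Gi)// divr_ge0// ltW// mulr_gt0.
have low y z : 1 <= y -> alpha + y <= z -> (Gamma d)^-1 * (alpha / z) <= F y.
  move=> y1 yz; have ay : 0 < alpha + y by rewrite addr_gt0// (lt_le_trans ltr01).
  apply: le_trans (ma_kernel_lower d_gt0 d_lt alpha_gt0 h_gt0 h_lt y1).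
  by rewrite ler_pM2l// ler_pM2l// lef_pV2 ?posrE// (lt_le_trans ay).
have -> : c * n%:R^-1 = b * b' by rewrite /c /b /b' !invfM; ring.
apply: (@le_trans _ _ (\int[leb]_(x in `[(-2)%R, (-1)%R]) (cst (b * b')%:E x))%E).
  rewrite integral_cst//= lebesgue_measure_itv/= lte_fin ltrN2 ltr1n.
  rewrite -EFinB -EFinM lee_fin ler_peMr ?(mulr_ge0 b0 b'0)//; lra.
apply: ge0_le_integral_patch => //.
- by apply/measurable_EFinP; apply: measurable_funM; exact: mFt.
- by move=> x; rewrite lee_fin mulr_ge0.
- by move=> x; rewrite lee_fin mulr_ge0// ma_kernel_ge0.
- move=> x /=; rewrite in_itv/= => /andP[x2 x1]; rewrite patchE mem_set//= lee_fin.
  apply: ler_pM => //; first by apply: low; lra.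
  apply: low; first lra.
  by move: n%:R n1 => m n1; nra.
Qed.

(** The covariances dominate a multiple of the harmonic series. *)
Lemma moving_average_long_memory : not_identically_zero P L -> long_memory P Z.
Proof.
move=> /two_sided_variance_gt0 s20.
have G0 : 0 < Gamma d by apply: Gamma_gt0 => //; move: d_lt; lra.
pose c : R := (Gamma d)^-1 ^+ 2 * (alpha ^+ 2 / ((alpha + 2) * (alpha + 3))) * s2.
have c0 : 0 < c.
  by rewrite !mulr_gt0 ?exprn_gt0 ?invr_gt0 ?mulr_gt0 ?addr_gt0.
have nd : {homo series (@harmonic R) : m n / (m <= n)%N >-> m <= n}.
  by apply/nondecreasing_seqP => n; rewrite seriesSr lerDl harmonic_ge0.
have := nondecreasing_dvgn_lt nd (@dvg_harmonic R) => H.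
have {}H : (c * series (@harmonic R) N)%:E @[N --> \oo] --> +oo%E.
  apply/cvgeryP.
  exact: (@gt0_cvgMry R (series (@harmonic R) @ \oo) _ c id c0 H).
apply: gee_cvgy H; apply: nearW => N.
rewrite /series/= mulr_sumr -sumEFin big_add1/=.
by apply: lee_sum => n _; exact: moving_average_covariance_ge.
Qed.

End MovingAverageProcess.

Theorem proposition2 (R : realType) (disp : measure_display)
    (T : measurableType disp) (P : probability T R) (L : R -> T -> R)
    (P_complete : measure_is_complete P)
    (L_levy : two_sided_levy_process P L)
    (L_nonzero : not_identically_zero P L)
    (L_centered : ('E_P[L 1%R] = 0)%E)
    (L_square : ('E_P[fun w => (L 1 w ^+ 2)%R] < +oo)%E)
    (L_jump : no_brownian_component P L)
    (d alpha h : R)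
    (d_gt0 : 0 < d) (d_lt : d < 1 / 2)
    (alpha_gt0 : 0 < alpha)
    (h_gt0 : 0 < h) (h_lt : h < 1 / 2 - d) :
  let Z := fun t : R =>
    frac_levy_int_upto P L d t
      (fun u => (alpha / (alpha + t - u)) `^ (1 - h)) in
  stationary P Z /\ long_memory P Z.
Proof.
move=> Z.
have L1_mean : (\int[P]_w (L 1%R w)%:E = 0)%E by move: L_centered; rewrite unlock.
have L1_L2 : (sqint P (L 1%R) < +oo)%E by move: L_square; rewrite unlock.
have -> : Z = moving_average P L d alpha h.
  by apply/funext => t; exact: moving_average_levy_int.
split; first exact: moving_average_stationary.
exact: moving_average_long_memory.
Qed.
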